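(* Let $\lambda:\mathcal{RO}_0'\times S^1\to\mathcal{M}(\Sigma_2,\sigma)$ and $\Lambda:\mathcal{RO}'\times S^1\to\mathcal{H}(\Sigma_2)$ be the maps defined in the context. (1) The map $\lambda$ is continuous and the map $\Lambda$ is lower semicontinuous. (2) Fix $\alpha\notin\mathbb{Q}$. (a) For all $U\in\mathcal{RO}'$, $(\Lambda(U,\alpha),\sigma)$ is an almost one to one minimal extension of $(S^1,R_{n\alpha})$ for some natural number $n$ (that is, it is minimal and is an almost one to one extension of $(S^1,R_{n\alpha})$). (b) If $U\in\mathcal{RO}_0'$, then $(\Lambda(U,\alpha),\sigma)$ is uniquely ergodic. (c) If $Fr(U)$ is a finite set, then $(\Lambda(U,\alpha),\sigma)$ is a Denjoy minimal set with intrinsic rotation number $n\alpha$ for some natural number $n$. (d) For fixed $\alpha\notin\mathbb{Q}$, when considered as functions of $U$, $\Lambda$ (on $\mathcal{RO}'$) and $\lambda$ (on $\mathcal{RO}_0'$) are injective. (3) Fix $p/q\in\mathbb{Q}$ with $p$ and $q$ relatively prime. (a) For all $U\in\mathcal{RO}'$, $\Lambda(U,p/q)$ is a finite collection of periodic orbits of $\sigma$ whose periods divide $q$. (b) For fixed $p/q\in\mathbb{Q}$, when $\lambda$ is considered as a function of $U$ (in $\mathcal{RO}_0'$), its image is the convex hull of the ($\sigma$-invariant) probability measures supported on the periodic orbits of $\sigma$ whose periods divide $q$.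
   Context: Shift: $\Sigma_2=\{0,1\}^{\mathbb{Z}}$ with the product topology, $\sigma$ the shift, $(\sigma(s))_i=s_{i+1}$. $\mathcal{M}(\Sigma_2,\sigma)$ is the set of $\sigma$-invariant Borel probability measures with the weak topology ($\mu_n\to\mu_0$ iff $\int f\,d\mu_n\to\int f\,d\mu_0$ for all continuous $f:\Sigma_2\to\mathbb{R}$). $\mathcal{H}(\Sigma_2)$ is the space of closed subsets of $\Sigma_2$ with the Hausdorff topology. Circle: $S^1=\mathbb{R}/\mathbb{Z}$, $R_\eta(\theta)=\theta+\eta \bmod 1$, $m$ is Haar (probability) measure. $Cl$, $Int$, $Fr$ and $X^c$ denote closure, interior, frontier and complement; $\mathbf{I}_X$ is the indicator function of $X$. Regular open sets: a nonempty proper subset $U\subset S^1$ is regular open if $Int(Cl(U))=U$. $\mathcal{RO}$ is the set of all regular open sets, and $\mathcal{RO}_0=\{U\in\mathcal{RO}: m(Fr(U))=0\}$. Put $U^\ast=Int(U^c)$. For $U,V\in\mathcal{RO}$ let $d(U,V)=m(U\triangle V)$ (symmetric difference) and $d_\ast(U,V)=(d(U,V)+d(U^\ast,V^\ast))/2$; $\mathcal{RO}$ and $\mathcal{RO}_0$ carry the topology of the metric $d_\ast$. Write $U\sim V$ if $V=R_\eta(U)$ for some $\eta\in S^1$. Let $\mathcal{RO}'=\mathcal{RO}/\!\sim$ and $\mathcal{RO}_0'=\mathcal{RO}_0/\!\sim$ with the quotient topology, which is generated by the metric $d'([U],[V])=\inf\{d_\ast(U,R_\eta(V)):\eta\in S^1\}$.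 An equivalence class is also denoted by a representative $U$ (the property that $Fr(U)$ is finite does not depend on the representative). Construction: for $U\in\mathcal{RO}$ and $r\in S^1$ let $B=\{x\in S^1: R_r^i(x)\notin Fr(U)\text{ for all }i\in\mathbb{Z}\}$ (a dense $G_\delta$ set) and define the continuous map $\phi:B\to\Sigma_2$ by $(\phi(x))_i=\mathbf{I}_U(R_r^i(x))$. Set $\Lambda(U,r)=Cl(\phi(B))\subset\Sigma_2$. If $U\in\mathcal{RO}_0$, then $m(B)=1$ and $\lambda(U,r)=\phi_\ast(m)$, i.e. $\lambda(U,r)(X)=m(\phi^{-1}(X))$ for Borel $X$. Both are unchanged when $U$ is replaced by $R_\eta(U)$, so they descend to maps $\Lambda:\mathcal{RO}'\times S^1\to\mathcal{H}(\Sigma_2)$ and $\lambda:\mathcal{RO}_0'\times S^1\to\mathcal{M}(\Sigma_2,\sigma)$. Lower semicontinuity: a map $\Phi:E\to\mathcal{H}(X)$ is lower semicontinuous if for every closed $Y\subset X$ the set $\{e\in E:\Phi(e)\subset Y\}$ is closed in $E$. Dynamics: a dynamical system $(X,h)$ is a homeomorphism $h$ of a compact metric space $X$. It is minimal if every orbit is dense, and uniquely ergodic if it has exactly one invariant Borel probability measure. If there is a continuous semiconjugacy from $(X,h)$ onto $(Y,g)$, then $(X,h)$ is an extension of $(Y,g)$; the extension is almost one to one if the semiconjugacy is one to one on a dense $G_\delta$ set. A Denjoy example is an (orientation-preserving) circle homeomorphism with irrational rotation number that is not minimal; it has a unique minimal set. A Denjoy minimal set is a dynamical system topologically conjugate to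 the restriction of a Denjoy example $g$ to its minimal set; its intrinsic rotation number is the rotation number of $g$, which is well defined up to replacing $g$ by $g^{-1}$ (i.e. up to sign, modulo $1$).
   Formalization: In (3)(b) the image of λ is proved to be the stated convex hull with the two Dirac measures at the constant sequences removed; these are never attained, since a nonempty proper regular open U and Int(U^c) both have positive measure. *)

(* Defs.v *)
From HB Require Import structures.
From mathcomp Require Import all_boot all_order all_algebra.
From mathcomp Require Import all_classical all_reals all_analysis.
From mathcomp Require Import ring_quotient measurable_realfun borel_hierarchy.
From mathcomp Require Import lra ring.

Set Implicit Arguments.
Unset Strict Implicit.
Unset Printing Implicit Defensive.

Import Order.TTheory GRing.Theory Num.Theory.
Import numFieldNormedType.Exports.
Local Open Scope classical_set_scope.
Local Open Scope ring_scope.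
Local Open Scope quotient_scope.

Local Notation integers R := (GRing.ZmodClosed.clone R (@Num.int_num_subdef R) _).

(* R / Z, with the quotient group structure and the quotient topology. *)
Definition circle (R : realType) : Type :=
  quotient_topology (Quotient.quot (integers R)).
HB.instance Definition _ (R : realType) := PointedTopological.on (circle R).
HB.instance Definition _ (R : realType) := Quotient.on (circle R).
HB.instance Definition _ (R : realType) :=
  GRing.isZmodule.Build (circle R) (@Quotient.addqA _ (integers R))
    (@Quotient.addqC _ (integers R)) (@Quotient.add0q _ (integers R))
    (@Quotient.addNq _ (integers R)).

Definition Borel (T : ptopologicalType) := g_sigma_algebraType (@open T).

Section circle.
Context {R : realType}.
Implicit Types (x y : R) (a eta theta : circle R).

Definition toS1 x : circle R := \pi_(circle R) x.

Lemma toS1B x y : toS1 (x - y) = toS1 x - toS1 y.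
Proof. exact: (raddfB (\pi_(Quotient.quot (integers R)))). Qed.

Lemma toS1D x y : toS1 (x + y) = toS1 x + toS1 y.
Proof. exact: (raddfD (\pi_(Quotient.quot (integers R)))). Qed.

Lemma toS1_eq x y : toS1 x = toS1 y <-> exists m : int, x - y = m%:~R.
Proof.
have E := Quotient.idealrBE (integers R) x y.
split=> [xy|[m xy]].
  by apply/intrP; move/eqP: (xy : \pi_(Quotient.quot (integers R)) x = \pi y); rewrite -E.
apply: (_ : \pi_(Quotient.quot (integers R)) x = \pi y); apply/eqP; rewrite -E.
by apply/intrP; exists m.
Qed.

Lemma toS1K a : toS1 (repr a) = a. Proof. exact: reprK. Qed.

Lemma toS1_frac a : exists2 x, 0 <= x < 1 & toS1 x = a.
Proof.
exists (repr a - (Num.floor (repr a))%:~R).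
  by have := floor_itv (repr a); rewrite intrD mulr1z; lra.
rewrite -[RHS]toS1K; apply/toS1_eq; exists (- Num.floor (repr a)).
by rewrite addrAC subrr sub0r mulrNz.
Qed.

Lemma toS1_continuous : continuous toS1. Proof. exact: pi_continuous. Qed.

Definition rotation eta theta : circle R := theta + eta.

Lemma rot_continuous eta : continuous (rotation eta).
Proof.
apply/quotient_continuous.
have -> : rotation eta \o \pi_(circle R) = toS1 \o (fun x => x + repr eta).
  by apply/funext => x /=; rewrite /rotation toS1D toS1K.
move=> x; apply: continuous_comp; last exact: toS1_continuous.
by apply: cvgD; [exact: cvg_id|exact: cvg_cst].
Qed.

(* Lebesgue measure on the fundamental domain [0, 1[; see haar_rot for the
   rotation invariance. *)
Definition haar (A : set (Borel (circle R))) : \bar R :=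
  lebesgue_measure (`[0, 1[ `&` toS1 @^-1` A).

Lemma measurable_toS1 :
  measurable_fun setT (toS1 : measurableTypeR R -> Borel (circle R)).
Proof.
refine (@measurability _ _ (measurableTypeR R) (Borel (circle R)) setT toS1 (@open (circle R)) _ _); first by [].
move=> _ [B oB <-]; rewrite setTI.
apply: open_measurable; move/continuousP: toS1_continuous; exact.
Qed.

Lemma measurable_toS1_preimage (A : set (Borel (circle R))) :
  measurable A -> measurable (toS1 @^-1` A : set (measurableTypeR R)).
Proof. by move=> mA; rewrite -[X in measurable X]setTI; exact: measurable_toS1. Qed.

Lemma lebesgue_translate (e : R) (A : set (measurableTypeR R)) :
  measurable A ->
  lebesgue_measure ((fun x : R => x + e) @^-1` A) = lebesgue_measure A :> \bar R.
Proof.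
move=> mA.
have mf : measurable_fun setT ((fun x => x + e) : measurableTypeR R -> measurableTypeR R).
  by apply: measurable_funD => //; exact: measurable_id.
pose P : {measure set (measurableTypeR R) -> \bar R} :=
  measure_function_pushforward__canonical__measure_function_Measure (@lebesgue_measure R) mf.
apply/esym; apply: (@lebesgue_measure_unique R P) => // X [[a b] _ <-].
rewrite /P /= /pushforward.
have -> : (fun x : R => x + e) @^-1` `]a, b]%classic = `]a - e, b - e]%classic.
  by apply/seteqP; split => x /=; rewrite !in_itv /= ltrBlDr lerBrDr.
rewrite !lebesgue_measure_itv /= !lte_fin ltrD2r; case: ifPn => // _.
by rewrite -!EFinB; congr EFin; ring.
Qed.

Lemma toS1D1 x : toS1 (x + 1) = toS1 x.
Proof. by apply/toS1_eq; exists 1; rewrite addrAC subrr add0r. Qed.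

Let haar0 : haar set0 = 0%E.
Proof. by rewrite /haar preimage_set0 setI0 measure0. Qed.

Let haar_ge0 A : (0 <= haar A)%E. Proof. exact: measure_ge0. Qed.

Let haar_sigma_additive : semi_sigma_additive haar.
Proof.
move=> F mF tF mUF; rewrite /haar preimage_bigcup setI_bigcupr.
have mG n : measurable (`[0%R, 1%R[ `&` toS1 @^-1` F n : set (measurableTypeR R)).
  by apply: measurableI; [exact: measurable_itv|exact: measurable_toS1_preimage].
apply: measure_semi_sigma_additive => //; last exact: bigcupT_measurable.
apply/trivIsetP => i j _ _ ij; rewrite -subset0 => x [[_ Fi] [_ Fj]].
move/trivIsetP : tF => /(_ _ _ Logic.I Logic.I ij)/seteqP[+ _].
by move=> /(_ (toS1 x)); apply.
Qed.

HB.instance Definition _ := isMeasure.Build _ (Borel (circle R)) R haar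
  haar0 haar_ge0 haar_sigma_additive.

Let haar_setT : haar setT = 1%E.
Proof.
by rewrite /haar preimage_setT setIT lebesgue_measure_itv /= lte_fin ltr01 sube0.
Qed.

HB.instance Definition _ :=
  Measure_isProbability.Build _ (Borel (circle R)) R haar haar_setT.

Lemma measurable_rot eta :
  measurable_fun setT (rotation eta : Borel (circle R) -> Borel (circle R)).
Proof.
refine (@measurability _ _ (Borel (circle R)) (Borel (circle R)) setT (rotation eta)
  (@open (circle R)) _ _); first by [].
move=> _ [B oB <-]; rewrite setTI; apply: sub_sigma_algebra.
by move/continuousP: (@rot_continuous eta); exact.
Qed.

Lemma haar_rot eta (A : set (Borel (circle R))) : measurable A ->
  haar (rotation eta @^-1` A) = haar A.
Proof.
move=> mA; have [e /andP[e0 e1] <-] := toS1_frac eta.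
pose P : set (measurableTypeR R) := toS1 @^-1` A.
have mP : measurable P by exact: measurable_toS1_preimage.
have mPI (i : interval R) : measurable (([set` i] : set (measurableTypeR R)) `&` P).
  by apply: measurableI mP; exact: measurable_itv.
have -> : haar (rotation (toS1 e) @^-1` A) = lebesgue_measure (`[e, 1 + e[ `&` P).
  rewrite /haar -[RHS](lebesgue_translate e) //; congr lebesgue_measure.
  apply/seteqP; split => x /=; rewrite !in_itv /= /rotation /P /= toS1D => -[x01 Ax].
    by split=> //; move/andP: x01 => [? ?]; apply/andP; split; lra.
  by split=> //; move/andP: x01 => [? ?]; apply/andP; split; lra.
have split3 (a b c : R) : a <= b -> b <= c ->
    lebesgue_measure (`[a, c[ `&` P) =
    (lebesgue_measure (`[a, b[ `&` P) + lebesgue_measure (`[b, c[ `&` P))%E.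
  move=> ab bc; rewrite -measureU //.
    rewrite -setIUl; congr (lebesgue_measure (_ `&` _)).
    apply/seteqP; split => x /=; rewrite !in_itv /=.
      move=> /andP[ax xc]; have [xb|bx] := ltP x b; [left|right];
      by apply/andP; split.
    by case=> /andP[? ?]; apply/andP; split; lra.
  rewrite setIACA setIid -subset0 => x [[/=]]; rewrite !in_itv /=.
  by move=> /andP[_ ?] /andP[? _]; lra.
rewrite /haar -/P (split3 e 1 (1 + e)); [|lra..].
rewrite (split3 0 e 1); [|lra..].
rewrite addeC; congr (_ + _)%E.
rewrite -[LHS](lebesgue_translate 1) //; congr lebesgue_measure.
apply/seteqP; split => x /=; rewrite !in_itv /= /P /= toS1D1 => -[x01 Ax].
  by split=> //; move/andP: x01 => [? ?]; apply/andP; split; lra.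
by split=> //; move/andP: x01 => [? ?]; apply/andP; split; lra.
Qed.

Lemma haar_open_gt0 (U : set (circle R)) : open U -> U !=set0 ->
  (0 < haar U)%E.
Proof.
move=> oU [a Ua]; have [x /andP[x0 x1] xa] := toS1_frac a.
have oP : open (toS1 @^-1` U) by move/continuousP: toS1_continuous; exact.
have Px : (toS1 @^-1` U) x by rewrite /= xa.
have [e /= e0 be] : nbhs_ball x (toS1 @^-1` U).
  by apply/nbhs_ballP; apply: open_nbhs_nbhs.
pose y := Num.min 1 (x + e).
have xy : x < y by rewrite lt_min x1 ltrDl.
apply: (@lt_le_trans _ _ (lebesgue_measure `[x, y[)).
  by rewrite lebesgue_measure_itv /= lte_fin xy -EFinD lte_fin subr_gt0.
apply: le_measure; rewrite ?inE; first exact: measurable_itv.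
  by apply: measurableI; [exact: measurable_itv|exact: open_measurable].
move=> z /=; rewrite !in_itv /= lt_min => /and3P[xz z1 ze]; split.
  by rewrite z1 andbT (le_trans x0).
by apply: be; rewrite /ball /= distrC ger0_norm ?subr_ge0// ltrBlDl.
Qed.

End circle.

Arguments circle : clear implicits.

Definition frontier (T : topologicalType) (A : set T) : set T :=
  closure A `\` interior A.

Section regular_open.
Context {R : realType}.
Implicit Types (U V W : set (circle R)).

Definition is_regular_open U :=
  [/\ U !=set0, U != setT & interior (closure U) = U].

(* RO0 is a record over RO, so that RO and RO0 each carry the metric dstar. *)
Record RO := MkRO { RO_set :> set (circle R) ; RO_setP : is_regular_open RO_set }.

Record RO0 := MkRO0 { RO0_RO :> RO ; RO0_ROP : haar (frontier RO0_RO) = 0%E }.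

HB.instance Definition _ := gen_eqMixin RO.
HB.instance Definition _ := gen_choiceMixin RO.
HB.instance Definition _ := gen_eqMixin RO0.
HB.instance Definition _ := gen_choiceMixin RO0.

Lemma RO_inj (U V : RO) : U = V :> set (circle R) -> U = V.
Proof.
by case: U V => [U pU] [V pV] /= UV; subst V; congr MkRO; exact: Prop_irrelevance.
Qed.

Lemma RO0_inj (U V : RO0) : U = V :> set (circle R) -> U = V.
Proof.
case: U V => [U pU] [V pV] /= /RO_inj UV; subst V; congr MkRO0.
exact: Prop_irrelevance.
Qed.

Lemma RO_open (U : RO) : open (U : set (circle R)).
Proof. by have [_ _ <-] := RO_setP U; exact: open_interior. Qed.

(* The set U^* = Int(U^c). *)
Definition ext_part U : set (circle R) := interior (~` U).

Definition dsym U V : R := fine (haar (U `+` V)).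

Definition dstar U V : R := (dsym U V + dsym (ext_part U) (ext_part V)) / 2.

Lemma measurable_open (T : ptopologicalType) (A : set T) :
  open A -> measurable (A : set (Borel T)).
Proof. exact: sub_sigma_algebra. Qed.

Let measurable_RO (U : RO) : measurable (U : set (Borel (circle R))).
Proof. by apply: measurable_open; exact: RO_open. Qed.

Let measurable_ext U : measurable (ext_part U : set (Borel (circle R))).
Proof. by apply: measurable_open; exact: open_interior. Qed.

Let measurable_setY' U V :
  measurable (U : set (Borel (circle R))) -> measurable (V : set (Borel (circle R))) ->
  measurable (U `+` V : set (Borel (circle R))).
Proof. by move=> mU mV; apply: measurableU; exact: measurableD. Qed.

Lemma haar_fin_num U : measurable (U : set (Borel (circle R))) ->
  haar U \is a fin_num.
Proof. by move=> mU; exact: fin_num_measure. Qed.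

Lemma dsymxx U : dsym U U = 0.
Proof. by rewrite /dsym setYK measure0. Qed.

Lemma dsymC U V : dsym U V = dsym V U.
Proof. by rewrite /dsym setYC. Qed.

Lemma dsym_ge0 U V : 0 <= dsym U V.
Proof. exact/fine_ge0/measure_ge0. Qed.

Lemma dsym_triangle U V W : measurable (U : set (Borel (circle R))) ->
  measurable (V : set (Borel (circle R))) ->
  measurable (W : set (Borel (circle R))) ->
  dsym U W <= dsym U V + dsym V W.
Proof.
move=> mU mV mW; have mUV := measurable_setY' mU mV.
have mVW := measurable_setY' mV mW.
rewrite /dsym -fineD; [|exact: haar_fin_num..].
apply: fine_le; [|by rewrite fin_numD !haar_fin_num|].
  by apply: haar_fin_num; exact: measurable_setY'.
apply: (@le_trans _ _ (haar ((U `+` V) `|` (V `+` W)))); last first.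
  exact: measureU2.
apply: le_measure; rewrite ?inE; [exact: measurable_setY'|exact: measurableU|].
move=> x [[Ux Wx]|[Wx Ux]]; have [Vx|Vx] := pselect (V x).
- by right; left.
- by left; left.
- by left; right.
- by right; right.
Qed.

Let dstarxx (U : RO) : dstar U U = 0.
Proof. by rewrite /dstar !dsymxx addr0 mul0r. Qed.

Let dstarC (U V : RO) : dstar U V = dstar V U.
Proof. by rewrite /dstar dsymC (dsymC (ext_part U)). Qed.

Let dstar_triangle (V U W : RO) : dstar U W <= dstar U V + dstar V W.
Proof.
rewrite /dstar -mulrDl ler_pM2r ?invr_gt0 // addrACA.
by apply: lerD; exact: dsym_triangle.
Qed.

Let dsym0_sub (U V : RO) : dsym U V = 0 -> U `<=` V.
Proof.
move=> UV0; suff UV : U `<=` closure V.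
  have [_ _ VE] := RO_setP V; rewrite -[X in _ `<=` X]VE.
  by apply: subset_trans (interiorS UV); rewrite -open_subsetE //; exact: RO_open.
rewrite -setD_eq0; apply: contrapT => /eqP/set0P D0.
have oD : open (U `\` closure V).
  by apply: openI; [exact: RO_open|rewrite openC; exact: closed_closure].
have := haar_open_gt0 oD D0; rewrite ltNge => /negP; apply.
have <- : haar (U `+` V) = 0%E.
  rewrite -[LHS]fineK; first by rewrite -/(dsym U V) UV0.
  by apply: haar_fin_num; exact: measurable_setY'.
apply: le_measure; rewrite ?inE; [exact: measurable_open|exact: measurable_setY'|].
by move=> x [Ux Vx]; left; split=> //; apply: contra_not Vx; exact: subset_closure.
Qed.

Let dstar_positivity (U V : RO) : dstar U V = 0 -> U = V.
Proof.
move=> /eqP; rewrite mulf_eq0 invr_eq0 pnatr_eq0 orbF => /eqP UV0.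
have {}UV0 : dsym U V = 0.
  by have := dsym_ge0 U V; have := dsym_ge0 (ext_part U) (ext_part V); lra.
by apply/RO_inj/seteqP; split; apply: dsym0_sub; rewrite // dsymC.
Qed.

HB.instance Definition _ := @isMetric.Build R RO (fun U V : RO => dstar U V)
  dstarxx dstar_positivity dstarC dstar_triangle.

Let dstar_positivity0 (U V : RO0) : dstar U V = 0 -> U = V.
Proof. by move/dstar_positivity => UV; apply: RO0_inj; rewrite UV. Qed.

HB.instance Definition _ := @isMetric.Build R RO0 (fun U V : RO0 => dstar U V)
  (fun U : RO0 => dstarxx U) dstar_positivity0
  (fun U V : RO0 => dstarC U V) (fun V U W : RO0 => dstar_triangle V U W).

(* V = R_eta(U) for some eta. *)
Definition rotated U V := exists eta, V = rotation eta @` U.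

Lemma image_rot eta U : rotation eta @` U = rotation (- eta) @^-1` U.
Proof.
apply/seteqP; split => [_ [x Ux <-]|x Ux] /=; first by rewrite /rotation addrK.
by exists (rotation (- eta) x) => //; rewrite /rotation addrNK.
Qed.

Lemma rotated_refl U : rotated U U.
Proof.
by exists 0; rewrite image_rot; apply/seteqP; split=> x; rewrite /= /rotation oppr0 addr0.
Qed.

Lemma rotated_sym U V : rotated U V -> rotated V U.
Proof.
move=> [eta ->]; exists (- eta); rewrite !image_rot opprK.
by apply/seteqP; split=> x; rewrite /= /rotation addrK.
Qed.

Lemma rotated_trans V U W : rotated U V -> rotated V W -> rotated U W.
Proof.
move=> [eta ->] [th ->]; exists (eta + th); rewrite !image_rot.
by apply/seteqP; split=> x; rewrite /= /rotation opprD addrA addrAC.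
Qed.

Definition RO_rel (U V : RO) := `[< rotated U V >].
Definition RO0_rel (U V : RO0) := `[< rotated U V >].

Let RO_rel_refl : reflexive RO_rel.
Proof. by move=> U; apply/asboolP/rotated_refl. Qed.

Let RO_rel_sym : symmetric RO_rel.
Proof. by move=> U V; apply: asbool_equiv_eq; split; exact: rotated_sym. Qed.

Let RO_rel_trans : transitive RO_rel.
Proof. by move=> V U W /asboolP UV /asboolP VW; apply/asboolP; exact: rotated_trans VW. Qed.

Canonical RO_equiv := EquivRel RO_rel RO_rel_refl RO_rel_sym RO_rel_trans.
Canonical RO0_equiv := EquivRel RO0_rel
  (fun U : RO0 => RO_rel_refl U) (fun U V : RO0 => RO_rel_sym U V)
  (fun V U W : RO0 => @RO_rel_trans V U W).
Canonical RO_encModRel := defaultEncModRel RO_rel.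
Canonical RO0_encModRel := defaultEncModRel RO0_rel.

End regular_open.
Arguments RO : clear implicits.
Arguments RO0 : clear implicits.

Definition RO' (R : realType) : Type :=
  quotient_topology {eq_quot (@RO_rel R)}.
HB.instance Definition _ (R : realType) := Topological.on (RO' R).
HB.instance Definition _ (R : realType) := Quotient.on (RO' R).

Definition RO_class (R : realType) (U : RO R) : RO' R := \pi_(RO' R) U.

Definition RO0' (R : realType) : Type :=
  quotient_topology {eq_quot (@RO0_rel R)}.
HB.instance Definition _ (R : realType) := Topological.on (RO0' R).
HB.instance Definition _ (R : realType) := Quotient.on (RO0' R).

Definition RO0_class (R : realType) (U : RO0 R) : RO0' R := \pi_(RO0' R) U.

Definition Sigma2 : Type := {ptws int -> bool}.
HB.instance Definition _ := Topological.on Sigma2.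
HB.instance Definition _ := isPointed.Build Sigma2 (fun=> false).

Definition full_shift (s : Sigma2) : Sigma2 := fun i => s (i + 1).

(* The closed subsets of T. Lower semicontinuity does not refer to a topology
   on this space, so none is put on it. *)
Record hyperspace (T : topologicalType) :=
  MkHyper { hyper_set :> set T ; hyper_closed : closed hyper_set }.

Lemma hyperspace_inj (T : topologicalType) (A B : hyperspace T) :
  A = B :> set T -> A = B.
Proof.
by case: A B => [A cA] [B cB] /= AB; subst B; congr MkHyper; exact: Prop_irrelevance.
Qed.

Definition lower_semicontinuous_map (E X : topologicalType)
    (Phi : E -> hyperspace X) :=
  forall Y : set X, closed Y -> closed [set e | Phi e `<=` Y].

Record invariant_probability (R : realType) (T : ptopologicalType)
    (f : T -> T) := MkInvProb {
  inv_prob :> probability (Borel T) R ;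
  inv_probP : forall A : set (Borel T), measurable A ->
    inv_prob (f @^-1` A) = inv_prob A }.

HB.instance Definition _ R T f := gen_eqMixin (@invariant_probability R T f).
HB.instance Definition _ R T f := gen_choiceMixin (@invariant_probability R T f).

(* The weak topology is the initial topology of the maps mu |-> \int g dmu, for
   all continuous g : T -> R. *)
Definition integrals (R : realType) (T : ptopologicalType) (f : T -> T)
    (mu : invariant_probability R f) : {ptws continuousType T R -> R} :=
  fun g => Rintegral mu setT (g : Borel T -> R).

HB.instance Definition _ R T f :=
  Topological.copy (@invariant_probability R T f)
    (initial_topology (@integrals R T f)).

Definition shift_invariant (R : realType) : Type := invariant_probability R full_shift.
HB.instance Definition _ (R : realType) := Topological.on (shift_invariant R).

(* A measure is a function on all sets that is only constrained on the
   measurable ones, so equality of measures is equality on Borel sets. *)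
Definition eq_on_Borel (R : realType) (T : ptopologicalType)
    (mu nu : set (Borel T) -> \bar R) :=
  forall A : set (Borel T), measurable A -> mu A = nu A.

Section coding.
Context {R : realType}.
Implicit Types (U : set (circle R)) (V : RO R) (r : circle R).

(* The point R_r^i(x), for i an integer, is x + r *~ i. *)
Definition codingB U r : set (circle R) :=
  [set x | forall i : int, ~ frontier U (x + r *~ i)].

Definition coding U r (x : circle R) : Sigma2 :=
  fun i => `[< U (x + r *~ i) >].

Definition coding_closure U r : hyperspace Sigma2 :=
  MkHyper (@closed_closure _ (coding U r @` codingB U r)).

Definition coding_measure U r (A : set (Borel Sigma2)) : \bar R :=
  haar (codingB U r `&` coding U r @^-1` A).

Let rot_iter r x i : rotation r x + r *~ i = x + r *~ (i + 1).
Proof. by rewrite /rotation mulrzDr mulr1z -addrA [r + _]addrC. Qed.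

Lemma coding_rot U r x : coding U r (rotation r x) = full_shift (coding U r x).
Proof. by apply/funext => i; rewrite /coding /full_shift rot_iter. Qed.

Lemma codingB_rot U r : rotation r @^-1` codingB U r = codingB U r.
Proof.
apply/seteqP; split=> x Bx i.
  by have := Bx (i - 1); rewrite rot_iter subrK.
by rewrite rot_iter; exact: Bx.
Qed.

Lemma frontier_preimage (eta : circle R) U :
  frontier (rotation eta @^-1` U) = rotation eta @^-1` frontier U.
Proof.
have sub th W : closure (rotation th @^-1` W) `<=` rotation th @^-1` closure W.
  move=> x clx A /(@rot_continuous _ th) /clx [y [/= Wy Ay]].
  by exists (rotation th y).
have rotK th : rotation (R := R) (- th) \o rotation th = id.
  by apply/funext => x; rewrite /rotation /= addrK.
have clE W : closure (rotation eta @^-1` W) = rotation eta @^-1` closure W.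
  apply/seteqP; split; first exact: sub.
  move=> x clx.
  have : (rotation (- eta) @^-1` closure (rotation eta @^-1` W)) (rotation eta x).
    apply: sub; rewrite -comp_preimage.
    have -> : rotation eta \o rotation (- eta) = id by rewrite -{1}(opprK eta) rotK.
    exact: clx.
  by rewrite /= -[rotation (- eta) _]/((rotation (- eta) \o rotation eta) x) rotK.
have iE W : interior W = ~` closure (~` W) by rewrite -interiorC setCK.
by rewrite /frontier !iE preimage_setC !clE.
Qed.

Let bad U r (n : nat) : set (circle R) :=
  if unpickle n is Some i then rotation (r *~ i) @^-1` frontier U else set0.

Let codingBE U r : codingB U r = ~` \bigcup_n bad U r n.
Proof.
apply/seteqP; split=> [x Bx [n _]|x Bx i Fx].
  by rewrite /bad; case: unpickle => // i; exact: Bx.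
by apply: Bx; exists (pickle i) => //; rewrite /bad pickleK.
Qed.

Let closed_frontier U : closed (frontier U).
Proof. by apply: closedI; [exact: closed_closure|apply: open_closedC; exact: open_interior]. Qed.

Let measurable_frontier U : measurable (frontier U : set (Borel (circle R))).
Proof.
by rewrite -[frontier U]setCK; apply: measurableC; apply: measurable_open; apply: closed_openC; exact: closed_frontier.
Qed.

Let measurable_bad U r n : measurable (bad U r n : set (Borel (circle R))).
Proof.
rewrite /bad; case: unpickle => [i|]; last exact: measurable0.
rewrite -[X in measurable X]setTI; apply: measurable_rot => //.
Qed.

Lemma measurable_codingB U r : measurable (codingB U r : set (Borel (circle R))).
Proof. by rewrite codingBE; apply: measurableC; exact: bigcupT_measurable. Qed.

Lemma haar_codingB (V : RO0 R) r : haar (codingB V r) = 1%E.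
Proof.
have bad0 n : haar (bad V r n) = 0%E.
  rewrite /bad; case: unpickle => [i|]; last exact: measure0.
  by rewrite haar_rot ?RO0_ROP//; exact: measurable_frontier.
rewrite codingBE (probability_setC haar); last exact: bigcupT_measurable.
transitivity (1 - 0 : \bar R)%E; last by rewrite sube0.
congr (1 - _)%E.
apply/eqP; rewrite eq_le measure_ge0 andbT.
apply: (le_trans (measure_sigma_subadditive haar (measurable_bad V r) _ _)) => //.
  exact: bigcupT_measurable.
by rewrite (eq_eseriesr (fun n _ => bad0 n)) eseries0.
Qed.

Lemma coding_cvg V r x : codingB V r x ->
  coding V r @ within (codingB V r) (nbhs x) --> coding V r x.
Proof.
move=> Bx; apply/cvg_sup => i S [S'] [[b] _ <-] /= bx bS.
apply: (filterS bS).
have near_const (W : set (circle R)) : open W -> W (x + r *~ i) ->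
    (forall y, W y -> RO_set V y = RO_set V (x + r *~ i)) ->
    \forall y \near nbhs x, b (coding V r y i).
  move=> oW Wx WV.
  have : nbhs (rotation (r *~ i) x) W.
    by apply: (@open_nbhs_nbhs (circle R)); split; [exact oW|exact: Wx].
  move/(@rot_continuous _ (r *~ i)) => nW.
  apply: (@filterS _ (nbhs x) _ (rotation (r *~ i) @^-1` W)) => // y /WV.
  by rewrite /coding /rotation => ->.
suff : \forall y \near nbhs x, b (coding V r y i).
  by apply: (@filterS _ (nbhs x)) => y by_ _.
have [Vx|nVx] := pselect (RO_set V (x + r *~ i)).
  apply: (near_const V) => //; first exact: RO_open.
  by move=> y Vy; apply/propext.
apply: (near_const (~` closure V)) => //.
- by apply: closed_openC; exact: closed_closure.
- move=> clV; apply: (Bx i); split => // intV; apply: nVx.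
  exact: interior_subset intV.
- move=> y ncl; apply/propext; split => // Vy.
  by case: ncl; exact: subset_closure.
Qed.

Lemma measurable_coding V r (A : set (Borel Sigma2)) : measurable A ->
  measurable (codingB V r `&` coding V r @^-1` A : set (Borel (circle R))).
Proof.
have mB := measurable_codingB V r.
suff : measurable_fun (codingB V r : set (Borel (circle R)))
    (coding V r : Borel (circle R) -> Borel Sigma2) by move=> /(_ mB); exact.
refine (@measurability _ _ (Borel (circle R)) (Borel Sigma2) _ _
  (@open Sigma2) _ _); first by [].
move=> _ [G oG <-].
pose W : set (circle R) := interior [set y | codingB V r y -> G (coding V r y)].
have -> : codingB V r `&` coding V r @^-1` G = codingB V r `&` W.
  apply/seteqP; split=> x [Bx Ox]; split => //.
    rewrite /W /interior /=; apply: (@coding_cvg V r x Bx).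
    by apply: open_nbhs_nbhs; split.
  by have := interior_subset Ox; exact.
by apply: measurableI => //; apply: measurable_open; exact: open_interior.
Qed.

Let coding_measure0 V r : coding_measure V r set0 = 0%E.
Proof. by rewrite /coding_measure preimage_set0 setI0 measure0. Qed.

Let coding_measure_ge0 V r A : (0 <= coding_measure V r A)%E.
Proof. exact: measure_ge0. Qed.

Let coding_measure_sigma_additive V r :
  semi_sigma_additive (coding_measure V r).
Proof.
move=> F mF tF mUF; rewrite /coding_measure preimage_bigcup setI_bigcupr.
have mG n := measurable_coding V r (mF n).
apply: measure_semi_sigma_additive => //; last exact: bigcupT_measurable.
apply/trivIsetP => i j _ _ ij; rewrite -subset0 => x [[_ Fi] [_ Fj]].
move/trivIsetP : tF => /(_ _ _ Logic.I Logic.I ij)/seteqP[+ _].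
by move=> /(_ (coding V r x)); apply.
Qed.

HB.instance Definition _ (V : RO0 R) r :=
  isMeasure.Build _ (Borel Sigma2) R (coding_measure V r)
    (coding_measure0 V r) (@coding_measure_ge0 V r)
    (@coding_measure_sigma_additive V r).

Let coding_measure_setT (V : RO0 R) r : coding_measure V r setT = 1%E.
Proof. by rewrite /coding_measure preimage_setT setIT haar_codingB. Qed.

HB.instance Definition _ (V : RO0 R) r :=
  Measure_isProbability.Build _ (Borel Sigma2) R (coding_measure V r)
    (coding_measure_setT V r).

Lemma coding_measure_shift V r (A : set (Borel Sigma2)) : measurable A ->
  coding_measure V r (full_shift @^-1` A) = coding_measure V r A.
Proof.
move=> mA; rewrite /coding_measure -[RHS](haar_rot r); last exact: measurable_coding.
rewrite preimage_setI codingB_rot; congr (haar (_ `&` _)).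
by apply/seteqP; split=> x /=; rewrite coding_rot.
Qed.

Definition coding_prob (V : RO0 R) r : shift_invariant R :=
  MkInvProb (inv_prob := coding_measure V r) (@coding_measure_shift V r).

Lemma codingB_image U r eta :
  codingB (rotation eta @` U) r = rotation (- eta) @^-1` codingB U r.
Proof.
rewrite image_rot /codingB frontier_preimage.
by apply/seteqP; split=> x Bx i; have := Bx i; rewrite /= /rotation addrAC.
Qed.

Lemma coding_image U r eta x :
  coding (rotation eta @` U) r x = coding U r (rotation (- eta) x).
Proof.
by apply/funext => i; rewrite /coding image_rot /= /rotation addrAC.
Qed.

Lemma coding_closure_rotated U U' r : rotated U U' ->
  coding_closure U r = coding_closure U' r.
Proof.
move=> [eta ->].
have E : coding U r @` codingB U r =
    coding (rotation eta @` U) r @` codingB (rotation eta @` U) r.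
  apply/seteqP; split=> _ [x Bx <-].
    exists (rotation eta x); last by rewrite coding_image /rotation addrK.
    by rewrite codingB_image /= /rotation addrK.
  exists (rotation (- eta) x); last by rewrite coding_image.
  by move: Bx; rewrite codingB_image.
by apply: hyperspace_inj; rewrite /= E.
Qed.

Lemma coding_measure_rotated V U' r (A : set (Borel Sigma2)) :
  measurable A -> rotated V U' ->
  coding_measure V r A = coding_measure U' r A.
Proof.
move=> mA [eta ->]; rewrite /coding_measure -[LHS](haar_rot (- eta)); last first.
  exact: measurable_coding.
rewrite codingB_image preimage_setI; congr (haar (_ `&` _)).
by apply/seteqP; split=> x /=; rewrite coding_image.
Qed.

(* Lambda and lambda are read off the canonical representative of a class;
   LambdaE and lambdaE show that every other representative gives the same
   result. *)
Definition Lambda (e : RO' R * circle R) : hyperspace Sigma2 :=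
  coding_closure (repr e.1) e.2.

Definition lambda (e : RO0' R * circle R) : shift_invariant R := coding_prob (repr e.1) e.2.

Lemma LambdaE V r : Lambda (RO_class V, r) = coding_closure V r.
Proof.
apply: coding_closure_rotated; apply/asboolP.
have := reprK (\pi_(RO' R) V : {eq_quot (@RO_rel R)}).
by move/eqmodP.
Qed.

Lemma lambdaE (V : RO0 R) r :
  eq_on_Borel (lambda (RO0_class V, r)) (coding_measure V r).
Proof.
move=> A mA; apply: coding_measure_rotated => //; apply/asboolP.
have := reprK (\pi_(RO0' R) V : {eq_quot (@RO0_rel R)}).
by move/eqmodP.
Qed.

End coding.

Section dynamics.
Context {S T : topologicalType}.

(* h restricts to a homeomorphism from A onto B. *)
Definition homeo_on (A : set S) (B : set T) (h : S -> T) :=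
  exists g : T -> S,
    [/\ set_fun A B h, set_fun B A g,
        {in A, cancel h g} /\ {in B, cancel g h},
        {within A, continuous h} & {within B, continuous g}].

End dynamics.

(* A dynamical system is a compact subset K of an ambient space together with a
   map f of the ambient space that restricts to a homeomorphism of K. The
   ambient spaces used, Sigma2 and the circle, are metrizable. *)
Section dynamical_systems.

Definition dynamical_system (T : topologicalType) (K : set T) (f : T -> T) :=
  compact K /\ homeo_on K K f.

(* The two-sided orbit of x in K. *)
Definition dyn_orbit (T : Type) (K : set T) (f : T -> T) (x : T) : set T :=
  [set y | K y /\ exists n : nat, iter n f x = y \/ iter n f y = x].

Definition minimal_system (T : topologicalType) (K : set T) (f : T -> T) :=
  forall x, K x -> K `<=` closure (dyn_orbit K f x).

(* Borel probability measures on K are identified with those Borel probability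
   measures mu on the ambient space such that mu K = 1. *)
Definition invariant_on (R : realType) (T : ptopologicalType) (K : set T)
    (f : T -> T) (mu : probability (Borel T) R) :=
  mu K = 1%E /\ forall A : set (Borel T), measurable A ->
    mu (K `&` f @^-1` A) = mu A.

Definition uniquely_ergodic (R : realType) (T : ptopologicalType) (K : set T)
    (f : T -> T) :=
  exists mu : probability (Borel T) R, invariant_on K f mu /\
    forall nu : probability (Borel T) R, invariant_on K f nu ->
      eq_on_Borel nu mu.

Definition conjugate (S T : topologicalType) (K : set S) (f : S -> S)
    (L : set T) (g : T -> T) :=
  exists2 h : S -> T, homeo_on K L h & {in K, forall x, h (f x) = g (h x)}.

Definition semiconjugacy (S T : topologicalType) (K : set S) (f : S -> S)
    (L : set T) (g : T -> T) (p : S -> T) :=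
  [/\ {within K, continuous p}, p @` K = L & {in K, forall x, p (f x) = g (p x)}].

(* The fibre of p through each point of the dense G_delta subset of K is a
   singleton. *)
Definition almost_one_to_one_extension (S T : topologicalType)
    (K : set S) (f : S -> S) (L : set T) (g : T -> T) :=
  [/\ dynamical_system K f, dynamical_system L g &
   exists2 p : S -> T, semiconjugacy K f L g p &
   exists D : set S, [/\ Gdelta D, K `<=` closure (K `&` D) &
     forall x y, K x -> D x -> K y -> p y = p x -> y = x]].

Definition minimal_period (T : Type) (f : T -> T) (x : T) (k : nat) :=
  [/\ (0 < k)%N, iter k f x = x &
   forall j, (0 < j < k)%N -> iter j f x <> x].

End dynamical_systems.

Section denjoy.
Context {R : realType}.
Implicit Types (g : circle R -> circle R) (G : R -> R).

(* A strictly increasing lift of degree one: a homeomorphism of the circle having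
   such a lift is orientation preserving. *)
Definition is_lift g G :=
  [/\ continuous G, {homo G : x y / x < y}, (forall x, G (x + 1) = G x + 1) &
      forall x, toS1 (G x) = g (toS1 x)].

(* t is a real representative of the rotation number of g, which is defined
   modulo 1: adding an integer to the lift G adds that integer to t. *)
Definition rotation_number g (t : R) :=
  exists2 G, is_lift g G &
    forall x, (fun n => (iter n G x - x) / n%:R) @ \oo --> t.

Definition denjoy_example g :=
  [/\ homeo_on setT setT g, exists G, is_lift g G,
      exists2 t, irrational t & rotation_number g t &
      ~ minimal_system setT g].

Definition minimal_set g (N : set (circle R)) :=
  [/\ N !=set0, dynamical_system N g & minimal_system N g].

(* (K, f) is a Denjoy minimal set of intrinsic rotation number t modulo 1. The
   intrinsic rotation number is only defined up to sign, and the predicate holds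
   for t if and only if it holds for - t, as one sees by conjugating g with the
   reflection x |-> - x. *)
Definition denjoy_minimal_set (T : topologicalType) (K : set T) (f : T -> T)
    (t : R) :=
  exists g N, [/\ denjoy_example g, minimal_set g N, rotation_number g t &
    conjugate K f N g].

End denjoy.

Section convex_hull.
Context {R : realType}.

(* Finite convex combinations of elements of E. *)
Definition convex_hull (E : set (shift_invariant R)) :
    set (shift_invariant R) :=
  [set mu | exists (n : nat) (c : 'I_n -> R) (nu : 'I_n -> shift_invariant R),
    [/\ forall i, 0 <= c i, \sum_(i < n) c i = 1, forall i, E (nu i) &
     eq_on_Borel mu (fun A => \sum_(i < n) (c i)%:E * nu i A)%E]].

(* The invariant probability measures supported on a periodic orbit of the shift
   whose period divides q. *)
Definition periodic_measures (q : nat) : set (shift_invariant R) :=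
  [set mu | exists s k, [/\ minimal_period full_shift s k, (k %| q)%N &
    mu (dyn_orbit setT full_shift s) = 1%E]].

(* The Dirac measures at the two constant sequences. They are supported on
   periodic orbits of period 1, but are not of the form lambda (U, r): as U is a
   nonempty proper regular open set, both U and Int(U^c) have positive measure. *)
Definition fixed_point_measures : set (shift_invariant R) :=
  [set mu | exists b : bool, mu [set fun=> b] = 1%E].

End convex_hull.

(* Main.v *)
(* Say that a sequence s follows a point x if x + r i lies in Cl(U) whenever s_i = 1 and
   outside U whenever s_i = 0. This relation is closed, every point of Lambda(U, r)
   follows some point of the circle, and if s follows x with respect to U and y with
   respect to V, for an irrational angle, then density of orbits forces V = U + (y - x).
   Hence the followed point is unique up to the stabilizer of U, which is the finite
   group of n-torsion points for some n; dividing the circle by it leads to the case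
   n = 1, where following is a continuous semiconjugacy onto the rotation, injective
   over B. Equality of Lambda or lambda for U and V yields a common s, hence (d).

   An invariant measure nu on Lambda gives a closed set C at most the maximal frequency
   of visits to the closed set F of points followed by elements of C. Equidistribution,
   uniform in the starting point, bounds it by m(F) = lambda(C). Applied to a clopen set
   and to its complement, this gives nu = lambda.

   If Fr(U) is finite, let J be an increasing map of the line that jumps exactly at the
   points of the orbits of Fr(U). Filling the jumps affinely turns the rotation into a
   Denjoy homeomorphism. A point s of Lambda is sent to J(x) or J(x+), where x is the
   followed point, according to the side from which codings converge to s.

   For a rational angle every coding is q-periodic. Conversely, an invariant measure on
   the q-periodic sequences is realized by cutting each of the q arcs of length 1 / q in
   proportion to the masses of these sequences.

   For (1), moving U by little in d_* or r by little changes the coding on a window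
   [-N, N] only on a set of small measure. *)
From HB Require Import structures.
Require Import Defs.
From mathcomp Require Import all_boot all_order all_algebra.
From mathcomp Require Import all_classical all_reals all_analysis.
From mathcomp Require Import ring_quotient measurable_realfun borel_hierarchy.
From mathcomp Require Import zify lra ring.
Set Implicit Arguments.
Unset Strict Implicit.
Unset Printing Implicit Defensive.
Import Order.TTheory GRing.Theory Num.Theory.
Import numFieldNormedType.Exports.
Local Open Scope classical_set_scope.
Local Open Scope ring_scope.

(** * The circle, the shift and itineraries *)

(** Regularity of U is what lets an itinerary determine U. Symbols only place orbit points in Cl(U)
    or off U, so density of orbits gives inclusions up to closure, and Int(Cl(U)) = U turns them
    into inclusions of open sets. Regularity also forbids punctures: when Fr(U) is finite, the two
    sides of a frontier point carry different symbols, and this separates the two ends of a gap in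
    the Denjoy case. The two terms of the metric match the two symbols. As Fr(U) may have positive
    measure, closeness of the sets does not by itself control their exteriors, where the symbol 0 is
    stable. A block read on an open set of points survives a small change of (U, r), while new
    blocks may appear on sets of small measure: hence only semicontinuity for Lambda, whereas lambda
    does not see such sets in the limit. The factor n is the order of the stabilizer of U: U is the
    preimage under x -> n x of a set with trivial stabilizer, and x -> n x carries the rotation by r
    to the rotation by n r. *)

Section circle_topology.
Context {R : realType}.
Implicit Types (x y t : R) (a b eta : circle R) (A U : set (circle R)).

Lemma toS1_0 : toS1 0 = 0 :> circle R.
Proof. by rewrite -(subrr (0 : R)) toS1B subrr. Qed.

Lemma toS1N x : toS1 (- x) = - toS1 x.
Proof. by rewrite -sub0r toS1B toS1_0 sub0r. Qed.

Lemma toS1Mn x n : toS1 (x *+ n) = toS1 x *+ n.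
Proof. by elim: n => [|n IH]; rewrite ?mulr0n ?toS1_0// !mulrS toS1D IH. Qed.

Lemma toS1Mz x (i : int) : toS1 (x *~ i) = toS1 x *~ i.
Proof.
case: i => n; first exact: toS1Mn.
by rewrite NegzE !mulrNz toS1N -!pmulrn toS1Mn.
Qed.

Lemma toS1_int (m : int) : toS1 m%:~R = 0 :> circle R.
Proof. by rewrite -toS1_0; apply/toS1_eq; exists m; rewrite subr0. Qed.

Lemma toS1Dz x (m : int) : toS1 (x + m%:~R) = toS1 x.
Proof. by rewrite toS1D toS1_int addr0. Qed.

(** The saturation of [O] is the union of its integer translates. *)
Lemma open_toS1_image (O : set R) : open O -> open (toS1 @` O : set (circle R)).
Proof.
move=> oO.
have -> : open (toS1 @` O : set (circle R)) = open (toS1 @^-1` (toS1 @` O) : set R).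
  by [].
have -> : (toS1 @^-1` (toS1 @` O) : set R) =
    \bigcup_(m in [set: int]) ((fun x : R => x + m%:~R) @^-1` O).
  apply/seteqP; split => [x [y Oy /= /toS1_eq[m ym]]|x [m _ /= Om]].
    by exists m => //=; rewrite -ym addrC subrK.
  by exists (x + m%:~R) => //; exact: toS1Dz.
apply: bigcup_open => m _; apply: open_comp => // x _.
by apply: cvgD; [exact: cvg_id|exact: cvg_cst].
Qed.

Lemma nbhs_circleP a A :
  nbhs a A <-> exists2 e : R, 0 < e & forall t, `|t| < e -> A (a + toS1 t).
Proof.
rewrite -(toS1K a); split=> [|[e e0 eA]].
  move/(@toS1_continuous R (repr a)) => /nbhs_ballP[e /= e0 eA].
  exists e => // t te; rewrite -toS1D; apply: eA.
  by rewrite /ball /= opprD addrA subrr sub0r normrN.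
rewrite nbhsE; exists (toS1 @` ball (repr a) e).
  split; first by apply: open_toS1_image; exact: ball_open.
  by exists (repr a) => //; exact: ballxx.
move=> _ [x ax <-]; rewrite -(subrK (repr a) x) addrC toS1D; apply: eA.
by rewrite distrC.
Qed.

Lemma open_circleP A : open A <->
  forall a, A a -> exists2 e : R, 0 < e & forall t, `|t| < e -> A (a + toS1 t).
Proof.
rewrite openE; split=> oA a Aa; first by apply/nbhs_circleP/oA.
by apply/nbhs_circleP/oA.
Qed.

Lemma closure_circleP A a : closure A a <->
  forall e : R, 0 < e -> exists2 t, `|t| < e & A (a + toS1 t).
Proof.
split=> [cA e e0|cA B /nbhs_circleP[e e0 eB]].
  have [b [Ab [t te tb]]] : A `&` [set a + toS1 t | t in [set t | `|t| < e]] !=set0.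
    by apply: cA; apply/nbhs_circleP; exists e => // t te; exists t.
  by exists t; rewrite ?tb.
by have [t te At] := cA _ e0; exists (a + toS1 t); split => //; exact: eB.
Qed.

Lemma circle_image_itv : toS1 @` `[0, 1]%classic = [set: circle R].
Proof.
apply/seteqP; split => // a _; have [x /andP[x0 x1] <-] := toS1_frac a.
by exists x => //=; rewrite in_itv /= x0 ltW.
Qed.

Lemma circle_compact : compact [set: circle R].
Proof.
rewrite -circle_image_itv; apply: continuous_compact; last exact: segment_compact.
by apply: continuous_subspaceT => x; exact: toS1_continuous.
Qed.

Lemma circle_hausdorff : hausdorff_space (circle R).
Proof.
move=> a b ab; have [x /andP[x0 x1] xab] := toS1_frac (b - a).
have [x_eq0|xN0] := eqVneq x 0.
  by apply/esym/eqP; rewrite -subr_eq0 -xab x_eq0 toS1_0.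
have {x0} x0 : 0 < x by rewrite lt_neqAle eq_sym xN0.
(* If the arcs of radius [e] around [a] and [b] met, there would be an integer strictly between 0
   and 1. *)
pose e := Num.min x (1 - x) / 2.
have e0 : 0 < e by rewrite divr_gt0 // lt_min x0 subr_gt0.
have nb c : nbhs c [set c + toS1 t | t in [set t : R | `|t| < e]].
  by apply/nbhs_circleP; exists e => // t te; exists t.
have [c [[t /= te tc] [s /= se sc]]] := ab _ _ (nb a) (nb b).
have /toS1_eq[m xm] : toS1 x = toS1 (t - s) :> circle R.
  rewrite toS1B xab; apply/eqP; rewrite subr_eq addrAC eq_sym subr_eq [toS1 t + a]addrC.
  by rewrite tc sc.
have /andP[e1 e2] : (2 * e <= x) && (2 * e <= 1 - x).
  by rewrite /e mulrC divfK // !ge_min !lexx orbT.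
have : m%:~R < 1%:~R :> R /\ (0 : int)%:~R < m%:~R :> R.
  move: te se; rewrite -xm !ltr_norml => /andP[? ?] /andP[? ?].
  by split; rewrite ?mulr1z ?mulr0z; lra.
by rewrite !ltr_int => -[? ?]; lia.
Qed.

Lemma rotation_open eta U : open U -> open (rotation eta @^-1` U).
Proof. by move=> oU; apply: open_comp => // x _; exact: rot_continuous. Qed.

Lemma rotation_closed eta U : closed U -> closed (rotation eta @^-1` U).
Proof. by move=> cU; apply: closed_comp => // x _; exact: rot_continuous. Qed.

Lemma rotation_compact_system eta : dynamical_system setT (rotation (R := R) eta).
Proof.
split; first exact: circle_compact.
exists (rotation (- eta)); split => //.
- by split=> x _; rewrite /rotation ?addrK ?addrNK.
- by apply: continuous_subspaceT => x; exact: rot_continuous.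
- by apply: continuous_subspaceT => x; exact: rot_continuous.
Qed.

End circle_topology.

Section Sigma2_topology.
Implicit Types (s : Sigma2) (A C : set Sigma2).

Lemma Sigma2_compact : compact [set: Sigma2].
Proof.
have -> : [set: Sigma2] = [set f | forall i : int, [set: bool] (f i)].
  by apply/seteqP; split.
exact: (@tychonoff int (fun=> bool) (fun=> setT) (fun=> bool_compact)).
Qed.

Lemma Sigma2_hausdorff : hausdorff_space Sigma2.
Proof. by apply: hausdorff_product => i; exact: discrete_hausdorff. Qed.

Definition agree (N : nat) s s' := forall i : int, (`|i| <= N)%N -> s' i = s i.

Lemma agreeW N M s s' : (N <= M)%N -> agree M s s' -> agree N s s'.
Proof. by move=> NM ss i iN; apply: ss; exact: leq_trans NM. Qed.

Lemma coord_continuous (i : int) : continuous ((fun s => s i) : Sigma2 -> bool).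
Proof. by move=> s; exact: (@proj_continuous int (fun=> bool) i s). Qed.

Lemma nbhs_coord s (i : int) : nbhs s [set s' | s' i = s i].
Proof. by apply: (@coord_continuous i s [set b | b = s i]); exact: discrete_set1. Qed.

Lemma nbhs_agree s N : nbhs s [set s' | agree N s s'].
Proof.
elim: N => [|N IH].
  by apply: filterS (nbhs_coord s 0) => s' ss' i; rewrite leqn0 absz_eq0 => /eqP ->.
have nI : nbhs s ([set s' | agree N s s'] `&` ([set s' : Sigma2 | s' N.+1%:Z = s N.+1%:Z] `&`
    [set s' : Sigma2 | s' (- N.+1%:Z) = s (- N.+1%:Z)])).
  by apply: filterI => //; apply: filterI; exact: nbhs_coord.
apply: filterS nI => s' [ss' [/= s1 s2]] i iN.
have [iN'|iN'] := leqP `|i|%N N; first exact: ss'.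
have [->|->] // : i = N.+1 \/ i = - N.+1%:Z by lia.
Qed.

Lemma nbhs_Sigma2P s A : nbhs s A <-> exists N, forall s', agree N s s' -> A s'.
Proof.
split=> [nA|[N NA]]; last by apply: filterS NA _; exact: nbhs_agree.
(* The sets containing a cylinder around [s] form a filter, whose convergence to [s] in the product
   topology can be checked one coordinate at a time. *)
pose F : set_system Sigma2 := [set B | exists N, forall s', agree N s s' -> B s'].
have FF : Filter F.
  split; first by exists 0%N.
    move=> B C [N NB] [M MC]; exists (maxn N M) => s' ss'.
    by split; [apply: NB|apply: MC]; apply: agreeW ss'; rewrite ?leq_maxl ?leq_maxr.
  by move=> B C BC [N NB]; exists N => s' /NB/BC.
suff : F --> s by apply.
apply/cvg_sup => i B [B'] [[b _ <-] /= bs bB]; apply: filterS bB _.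
by exists `|i|%N => s' /(_ i (leqnn _)) /= ->.
Qed.

Lemma open_Sigma2P A : open A <->
  forall s, A s -> exists N, forall s', agree N s s' -> A s'.
Proof. by rewrite openE; split=> oA s As; apply/nbhs_Sigma2P/oA. Qed.

Lemma closure_Sigma2P A s : closure A s <-> forall N, exists2 s', A s' & agree N s s'.
Proof.
split=> [cA N|cA B /nbhs_Sigma2P[N NB]].
  by have [s' [As' ss']] := cA _ (nbhs_agree s N); exists s'.
by have [s' As' ss'] := cA N; exists s'; split => //; exact: NB.
Qed.

Definition shiftz (k : int) s : Sigma2 := fun i => s (i + k).

Lemma full_shiftE s : full_shift s = shiftz 1 s. Proof. by []. Qed.

Lemma shiftz0 s : shiftz 0 s = s.
Proof. by apply/funext => i; rewrite /shiftz addr0. Qed.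

Lemma shiftzD k l s : shiftz k (shiftz l s) = shiftz (k + l) s.
Proof. by apply/funext => i; rewrite /shiftz addrA. Qed.

Lemma iter_full_shift n s : iter n full_shift s = shiftz n%:Z s.
Proof.
elim: n => [|n IH]; first by rewrite shiftz0.
by rewrite iterS IH full_shiftE shiftzD -PoszD.
Qed.

Lemma shiftz_continuous k : continuous (shiftz k).
Proof.
move=> s A /nbhs_Sigma2P[N NA]; apply/nbhs_Sigma2P; exists (N + `|k|)%N => s' ss'.
by apply: NA => i iN; apply: ss'; lia.
Qed.

End Sigma2_topology.

(** * Density and uniform return times of irrational rotations *)

Section irrational_rotation.
Context {R : realType}.
Implicit Types (x y t : R) (a b z : circle R).

Lemma irrational_mul_neq_int (alpha : R) (n : nat) (m : int) : irrational alpha ->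
  (0 < n)%N -> n%:R * alpha <> m%:~R.
Proof.
move=> irr n0 nam; apply: irr; exists (m%:~R / n%:R : rat) => //.
rewrite fmorph_div /= ratr_int ratr_nat -nam mulrAC mulfV ?mul1r //.
by rewrite pnatr_eq0 -lt0n.
Qed.

Lemma irrational_mul (alpha : R) (n : nat) : irrational alpha -> (0 < n)%N ->
  irrational (n%:R * alpha).
Proof.
move=> irr n0 [q _ qE]; apply: irr; exists (q / n%:R) => //.
rewrite fmorph_div /= ratr_nat qE mulrAC mulfV ?mul1r //.
by rewrite pnatr_eq0 -lt0n.
Qed.

(* Dirichlet: two of the first K + 1 points of the orbit share an arc of length 1 / K. *)
Lemma rotation_small_return (alpha e : R) : irrational alpha -> 0 < e ->
  exists m t, [/\ (0 < m)%N, t != 0, `|t| < e & toS1 alpha *+ m = toS1 t].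
Proof.
move=> irr e0; pose K := (Num.truncn e^-1).+1.
have K0 : 0 < K%:R :> R by rewrite ltr0n.
have Ke : K%:R^-1 < e.
  rewrite -[ltRHS]invrK ltf_pV2 ?posrE ?invr_gt0 //.
  have ie0 : 0 <= e^-1 by rewrite invr_ge0 ltW.
  by have /andP[] := truncn_itv ie0.
have [|x xP] := @choice nat R (fun i x => 0 <= x < 1 /\ toS1 x = toS1 alpha *+ i).
  by move=> i; have [x x01 xi] := toS1_frac (toS1 alpha *+ i); exists x.
have cellP (i : nat) : (Num.truncn (K%:R * x i) < K)%N.
  have [/andP[x0 x1] _] := xP i.
  have /andP[+ _] := truncn_itv (mulr_ge0 (ltW K0) x0).
  rewrite -(ltr_nat R) => /le_lt_trans; apply.
  by rewrite gtr_pMr.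
pose f (i : 'I_K.+1) : 'I_K := Ordinal (cellP i).
have /injectiveP/injectivePn[i [j ij fij]] : ~ injective f.
  by move=> /leq_card; rewrite !card_ord ltnn.
wlog lt_ij : i j ij fij / (i < j)%N => [H|].
  have [ji|ji|/val_inj ji] := ltngtP i j; first exact: (H i j).
    by apply: (H j i); rewrite // eq_sym.
  by rewrite ji eqxx in ij.
have E : toS1 alpha *+ (j - i) = toS1 (x j - x i).
  by rewrite toS1B !(xP _).2 mulrnBr // ltnW.
exists (j - i)%N, (x j - x i); split => //; first by rewrite subn_gt0.
  apply/eqP => x0; move: E; rewrite x0 -toS1Mn => /toS1_eq[m].
  rewrite subr0 -mulr_natl; apply: irrational_mul_neq_int => //.
  by rewrite subn_gt0.
apply: le_lt_trans Ke; rewrite -(ler_pM2l K0) mulfV ?gt_eqF //.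
rewrite -{1}(gtr0_norm K0) -normrM mulrBr.
have [/andP[xi0 _] _] := xP i; have [/andP[xj0 _] _] := xP j.
have /andP[] := truncn_itv (mulr_ge0 (ltW K0) xi0).
have /andP[] := truncn_itv (mulr_ge0 (ltW K0) xj0).
have -> : Num.truncn (K%:R * x j) = Num.truncn (K%:R * x i) := esym (congr1 val fij).
rewrite -natr1 => ? ? ? ?.
by rewrite ler_norml; apply/andP; split; lra.
Qed.

(** The multiples of a short return [t] sweep the circle with gaps less than [e], and at most
    [1 / |t|] of them go once around; this makes [L] independent of [z]. *)
Lemma rotation_syndetic (alpha e : R) : irrational alpha -> 0 < e ->
  exists L : nat, forall z : circle R, exists l t,
    [/\ (l <= L)%N, `|t| < e & z + toS1 t = toS1 alpha *+ l].
Proof.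
move=> irr e0; have [m [t [m0 t0 te mt]]] := rotation_small_return irr e0.
pose u := `|t|; have u0 : 0 < u by rewrite normr_gt0.
exists (m * (Num.truncn u^-1))%N => z.
(* The lift of [z] is taken on the side of 0 towards which multiples of [t] move. *)
have [x x1 xz] : exists2 x, 0 <= x < 1 & toS1 (x * Num.sg t) = z.
  have [x x01 xz] := toS1_frac (if 0 < t then z else - z).
  exists x => //; case: ltP xz => [t_gt0|]; first by rewrite gtr0_sg // mulr1.
  rewrite le_eqVlt (negbTE t0) /= => t_lt0 xz.
  by rewrite ltr0_sg // mulrN1 toS1N xz opprK.
have /andP[x0 xlt1] := x1.
have xu0 : 0 <= x / u by rewrite divr_ge0 // ltW.
pose j := Num.truncn (x / u); have /andP[j1 j2] := truncn_itv xu0.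
exists (m * j)%N, (t * j%:R - x * Num.sg t); split.
- rewrite leq_mul2l; apply/orP; right; apply: le_truncn.
  by rewrite -[leRHS]mul1r ler_pM2r ?invr_gt0 // ltW.
- have -> : t * j%:R - x * Num.sg t = (u * j%:R - x) * Num.sg t.
    by rewrite [X in X * j%:R](numEsg t) -/u; ring.
  rewrite normrM normr_sg t0 mulr1.
  apply: le_lt_trans te; rewrite -/u.
  move: j1 j2; rewrite ler_pdivlMr // ltr_pdivrMr // -/j -natr1 => j1 j2.
  by rewrite ler_norml; apply/andP; split; lra.
- by rewrite -xz -toS1D addrC subrK mulr_natr toS1Mn mulrnA mt.
Qed.

Lemma rotation_dense (alpha e : R) (x z : circle R) : irrational alpha -> 0 < e ->
  exists l t, `|t| < e /\ z + toS1 t = x + toS1 alpha *~ Posz l.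
Proof.
move=> irr e0; have [L LP] := rotation_syndetic irr e0.
have [l [t [_ te E]]] := LP (z - x); exists l, t; split => //.
by rewrite -pmulrn -E addrA [x + _]addrC subrK.
Qed.

End irrational_rotation.

Section regular_open_facts.
Context {R : realType}.
Implicit Types (U : set (circle R)) (V W : RO R).

Lemma RO_interior V : interior (closure V) = RO_set V.
Proof. by have [] := RO_setP V. Qed.

Lemma RO_neq0 V : RO_set V !=set0.
Proof. by have [] := RO_setP V. Qed.

(** Regularity improves the inclusion in a closure, which is all that itineraries provide, to an
    inclusion in the open set. *)
Lemma open_sub_RO U V : open U -> U `<=` closure V -> U `<=` V.
Proof. by move=> oU UV; rewrite -(RO_interior V) -open_subsetE. Qed.

Lemma RO_not_dense V : ~ (closure V = setT).
Proof.
have [_ /eqP VT VE] := RO_setP V; move=> clV; apply: VT.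
by rewrite -VE clV; exact: interiorT.
Qed.

Lemma ext_partE U : ext_part U = ~` closure U.
Proof. by rewrite /ext_part interiorC. Qed.

Lemma ext_part_neq0 V : ext_part V !=set0.
Proof.
rewrite ext_partE; apply/set0P/eqP => E.
by apply: (@RO_not_dense V); rewrite -[closure V]setCK E setC0.
Qed.

Lemma frontierE U : open U -> frontier U = closure U `\` U.
Proof. by move=> /interior_id E; rewrite /frontier E. Qed.

Lemma frontier_closed U : closed (frontier U).
Proof.
by apply: closedI; [exact: closed_closure|apply: open_closedC; exact: open_interior].
Qed.

Lemma not_frontierP V x : ~ frontier V x <-> RO_set V x \/ ext_part V x.
Proof.
rewrite ext_partE (frontierE (@RO_open _ V)).
split=> [nF|[Vx [_]|ncl [/ncl]] //].
have [Vx|nV] := pselect (RO_set V x); first by left.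
by right => cl; apply: nF.
Qed.

(** Baire category on the line, applied to the pull-backs of the complements of the rotated
    frontiers. *)
Lemma codingB_dense V (r : circle R) (O : set (circle R)) : open O -> O !=set0 ->
  exists2 x, O x & codingB V r x.
Proof.
move=> oO [z Oz].
pose W (i : int) : set R := [set x | ~ frontier V (toS1 x + r *~ i)].
pose F n := if unpickle n is Some i then W i else setT.
have WE i : W i = (rotation (r *~ i) \o toS1) @^-1` (~` frontier V) by [].
have cWi i : continuous (rotation (r *~ i) \o (@toS1 R)).
  by move=> x; apply: continuous_comp; [exact: toS1_continuous|exact: rot_continuous].
have /Baire dF : forall n, open (F n) /\ dense (F n).
  move=> n; rewrite /F; case: unpickle => [i|]; last first.
    by split; [exact: openT|move=> A [x Ax] _; exists x].
  split.
    rewrite WE; apply: open_comp => [x _|]; first exact: cWi.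
    by rewrite openC; exact: frontier_closed.
  (* Otherwise a rotated image of [A] would be a nonempty open subset of the frontier of an open
     set. *)
  move=> A [x Ax] oA; apply: contrapT => AW.
  pose P : set (circle R) := rotation (r *~ i) @` (toS1 @` A).
  have oP : open P by rewrite /P image_rot; apply: rotation_open; exact: open_toS1_image.
  have PF : P `<=` frontier V.
    move=> _ [_ [y Ay <-] <-]; apply: contrapT => nF; apply: AW.
    by exists y; split.
  have Px : P (rotation (r *~ i) (toS1 x)) by exists (toS1 x) => //; exists x.
  have [cl _] := PF _ Px.
  have [w [Vw Pw]] := cl _ (open_nbhs_nbhs (conj oP Px)).
  by have := PF _ Pw; rewrite (frontierE (@RO_open _ V)) => -[].
have [] := dF (toS1 @^-1` O).
- by exists (repr z); rewrite /= toS1K.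
- by apply: open_comp => // x _; exact: toS1_continuous.
- move=> x [Ox Fx]; exists (toS1 x) => // i.
  by have := Fx (pickle i) Logic.I; rewrite /F pickleK.
Qed.

End regular_open_facts.

Section itineraries.
Context {R : realType}.
Implicit Types (U : set (circle R)) (V W : RO R) (r x y : circle R) (s : Sigma2).

(* Unlike the graph of the coding map, which it contains, this relation is closed. *)
Definition follows U r s x :=
  forall i : int, if s i then closure U (x + r *~ i) else ~ U (x + r *~ i).

Lemma follows_coding U r x : follows U r (coding U r x) x.
Proof. by move=> i; rewrite /coding; case: asboolP => // /subset_closure. Qed.

Lemma follows_shiftz U r s x k :
  follows U r s x -> follows U r (shiftz k s) (x + r *~ k).
Proof. by move=> sx i; rewrite -addrA -mulrzDr addrC addrC [k + i]addrC; exact: sx. Qed.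

Lemma follows_codingB V r s x : codingB V r x -> follows V r s x -> s = coding V r x.
Proof.
move=> Bx sx; apply/funext => i; have := sx i; rewrite /coding.
have /not_frontierP := Bx i; rewrite ext_partE; case: (s i) => -[Vx|nV] //.
- by rewrite asboolT.
- by rewrite asboolF // => /subset_closure.
Qed.

(** A violation at a single index is an open condition on the pair. *)
Lemma follows_closed U r : open U ->
  closed [set z : Sigma2 * circle R | follows U r z.1 z.2].
Proof.
move=> oU; rewrite -[X in closed X]setCK; apply: open_closedC.
rewrite openE => -[s x] /= nf; have [i] := (existsNP _).2 nf.
pose A : set (circle R) := if s i then ~` closure U else U.
have oA : open A by rewrite /A; case: (s i); rewrite ?openC //; exact: closed_closure.
move=> ni; have Ax : A (x + r *~ i).
  by move: ni; rewrite /A; case: (s i) => //; exact: contrapT.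
exists ([set s' : Sigma2 | s' i = s i], rotation (r *~ i) @^-1` A).
  split; first exact: nbhs_coord.
  by apply: open_nbhs_nbhs; split; [exact: rotation_open|exact: Ax].
move=> [s' x'] /= [s'i Ax'] /(_ i); move: Ax'; rewrite s'i /A /rotation.
by case: (s i).
Qed.

Lemma prod_closed_compact (Z : set (Sigma2 * circle R)) : closed Z -> compact Z.
Proof.
move=> cZ; apply: (@subclosed_compact _ _ [set: Sigma2 * circle R]) => //.
have -> : [set: Sigma2 * circle R] = [set: Sigma2] `*` [set: circle R].
  by apply/seteqP; split.
by apply: compact_setX; [exact: Sigma2_compact|exact: circle_compact].
Qed.

(** [follows] need not be the graph of a function in either direction; closedness of its
    projections, obtained from compactness, takes the place of continuity. *)
Lemma followed_closed U r (C : set Sigma2) : open U -> closed C ->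
  closed [set x | exists2 s, C s & follows U r s x].
Proof.
move=> oU cC; apply: compact_closed; first exact: circle_hausdorff.
pose Z := [set z : Sigma2 * circle R | follows U r z.1 z.2] `&` fst @^-1` C.
have -> : [set x | exists2 s, C s & follows U r s x] = snd @` Z.
  apply/seteqP; split=> [x [s Cs sx]|_ [[s x] [/= sx Cs] <-]]; last by exists s.
  by exists (s, x).
apply: continuous_compact; first by apply: continuous_subspaceT => z; exact: cvg_snd.
apply: prod_closed_compact; apply: closedI; first exact: follows_closed.
by apply: closed_comp => // z _; exact: cvg_fst.
Qed.

Lemma follower_closed U r (F : set (circle R)) : open U -> closed F ->
  closed [set s | exists2 x, F x & follows U r s x].
Proof.
move=> oU cF; apply: compact_closed; first exact: Sigma2_hausdorff.
pose Z := [set z : Sigma2 * circle R | follows U r z.1 z.2] `&` snd @^-1` F.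
have -> : [set s | exists2 x, F x & follows U r s x] = fst @` Z.
  apply/seteqP; split=> [s [x Fx sx]|_ [[s x] [/= sx Fx] <-]]; last by exists x.
  by exists (s, x).
apply: continuous_compact; first by apply: continuous_subspaceT => z; exact: cvg_fst.
apply: prod_closed_compact; apply: closedI; first exact: follows_closed.
by apply: closed_comp => // z _; exact: cvg_snd.
Qed.

Lemma coding_closure_follows U r s : open U -> hyper_set (coding_closure U r) s ->
  exists x, follows U r s x.
Proof.
move=> oU; have /closure_id cE := @follower_closed U r _ oU (@closedT _).
suff : coding_closure U r `<=` [set s | exists2 x, setT x & follows U r s x].
  by move=> /[apply] -[x _ sx]; exists x.
rewrite cE; apply: closureS => _ [x _ <-]; exists x => //; exact: follows_coding.
Qed.

Lemma coding_shiftz U r x k : coding U r (x + r *~ k) = shiftz k (coding U r x).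
Proof. by apply/funext => i; rewrite /shiftz /coding mulrzDr -addrA [r *~ k + _]addrC. Qed.

Lemma codingB_shiftz U r x k : codingB U r x -> codingB U r (x + r *~ k).
Proof. by move=> Bx i; rewrite -addrA -mulrzDr; exact: Bx. Qed.

Lemma coding_closure_shiftz U r s k :
  hyper_set (coding_closure U r) s -> hyper_set (coding_closure U r) (shiftz k s).
Proof.
move=> Ls A /(@shiftz_continuous k) /Ls [_ [[x Bx <-] Ax]].
exists (shiftz k (coding U r x)); split => //.
by rewrite -coding_shiftz; exists (x + r *~ k) => //; exact: codingB_shiftz.
Qed.

Lemma coding_in_closure U r x : codingB U r x -> hyper_set (coding_closure U r) (coding U r x).
Proof. by move=> Bx; apply: subset_closure; exists x. Qed.

Lemma coding_closure_compact U r : compact (coding_closure U r).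
Proof.
apply: (@subclosed_compact _ _ [set: Sigma2]) => //; last exact: Sigma2_compact.
exact: hyper_closed.
Qed.

Lemma coding_closure_system U r : dynamical_system (coding_closure U r) full_shift.
Proof.
split; first exact: coding_closure_compact.
exists (shiftz (-1)); split.
- by move=> s /(@coding_closure_shiftz U r s 1).
- by move=> s /(@coding_closure_shiftz U r s (-1)).
- by split=> s _; rewrite full_shiftE shiftzD ?subrr ?addNr shiftz0.
- by apply: continuous_subspaceT => s; exact: (@shiftz_continuous 1).
- by apply: continuous_subspaceT => s; exact: shiftz_continuous.
Qed.

Section irrational_angle.
Context (alpha : R) (irr : irrational alpha).
Local Notation a := (toS1 alpha).

Lemma follows_translate V W s x y : follows V a s x -> follows W a s y ->
  forall z, RO_set V z -> RO_set W (z + (y - x)).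
Proof.
move=> sx sy; suff sub z : RO_set V z -> closure W (z + (y - x)).
  have oVr : open (rotation (- (y - x)) @^-1` V) by apply: rotation_open; exact: RO_open.
  move=> z Vz; apply: (open_sub_RO oVr); last by rewrite /= /rotation addrK.
  by move=> w /= /sub; rewrite /rotation subrK.
move=> Vz; have /closure_id -> := @closed_closure _ (RO_set W).
apply/closure_circleP => e e0.
have [d d0 dV] := (open_circleP _).1 (@RO_open _ V) _ Vz.
(* The orbit of [x] enters [V] near [z], where the symbol has to be 1; the same symbol puts the
   orbit of [y] in the closure of [W] near [z + (y - x)]. *)
have [|l [t [td E]]] := @rotation_dense _ alpha (Num.min d e) x z irr.
  by rewrite lt_min d0.
move: td; rewrite lt_min => /andP[td te]; exists t => //.
have := sx l; have := sy l; rewrite -E; case: (s l) => [Wy _|_ []]; last exact: dV.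
by rewrite addrAC E addrC addrA subrK.
Qed.

End irrational_angle.

End itineraries.

(** * Minimality and almost one to one extensions *)

Section coding_dynamics.
Context {R : realType} (alpha : R) (irr : irrational alpha).
Implicit Types (V W : RO R) (x y : circle R) (s : Sigma2).
Local Notation a := (toS1 alpha).

Lemma follows_rotated V W s x y :
  follows V a s x -> follows W a s y -> rotated V W.
Proof.
move=> sx sy; exists (y - x); rewrite image_rot; apply/seteqP; split=> z /=.
  by rewrite /rotation opprB; exact: (follows_translate irr sy sx).
by rewrite /rotation => /(follows_translate irr sx sy); rewrite subrK.
Qed.

(* The itinerary of a point of B is the only one it has, so its followers vary
   continuously there. *)
Lemma followers_near V r x (A : set Sigma2) : codingB V r x ->
  nbhs (coding V r x) A -> nbhs x [set z | forall s, follows V r s z -> A s].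
Proof.
move=> Bx nA; pose C := ~` interior A.
have cC : closed C by apply: open_closedC; exact: open_interior.
have cF := @followed_closed _ V r _ (@RO_open _ V) cC.
have nx : nbhs x (~` [set z | exists2 s, C s & follows V r s z]).
  apply: open_nbhs_nbhs; split; first by rewrite openC.
  by move=> [s Cs /(follows_codingB Bx) sE]; apply: Cs; rewrite sE; exact: nA.
apply: filterS nx => z nz s sz; apply: contrapT => As; apply: nz; exists s => //.
by move/interior_subset.
Qed.

(** The orbit of [x] comes close to [z], and there all followers share the central block of the
    coding of [z]. *)
Lemma follows_recurrent V s x z N : follows V a s x -> codingB V a z ->
  exists l, agree N (coding V a z) (iter l full_shift s).
Proof.
move=> sx Bz; have /nbhs_circleP[e e0 eA] := followers_near Bz (nbhs_agree _ N).
have [l [t [te E]]] := @rotation_dense _ alpha e x z irr e0.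
exists l; rewrite iter_full_shift; apply: eA te _ _.
by rewrite E; exact: follows_shiftz.
Qed.

Lemma coding_closure_minimal V : minimal_system (coding_closure V a) full_shift.
Proof.
move=> s Ls; have [x sx] := coding_closure_follows (@RO_open _ V) Ls.
have /closure_id -> := @closed_closure _ (dyn_orbit (coding_closure V a) full_shift s).
apply: closureS => _ [z Bz <-]; apply/closure_Sigma2P => N.
have [l lN] := follows_recurrent N sx Bz; exists (iter l full_shift s) => //.
split; last by exists l; left.
by rewrite iter_full_shift; exact: coding_closure_shiftz.
Qed.

End coding_dynamics.

(** * Reduction to sets with trivial stabilizer *)

Section stabilizer.
Context {R : realType}.
Implicit Types (V : RO R) (eta x z : circle R) (t : R).

Definition stabilizes V eta := forall z, RO_set V (z + eta) <-> RO_set V z.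

Lemma stabilizesD V eta theta :
  stabilizes V eta -> stabilizes V theta -> stabilizes V (eta + theta).
Proof. by move=> Ve Vt z; rewrite addrA Vt. Qed.

Lemma stabilizesN V eta : stabilizes V eta -> stabilizes V (- eta).
Proof. by move=> Ve z; rewrite -Ve subrK. Qed.

Lemma stabilizesMz V eta (i : int) : stabilizes V eta -> stabilizes V (eta *~ i).
Proof.
move=> Ve; have nat_case n : stabilizes V (eta *+ n).
  elim: n => [|n IH]; first by move=> z; rewrite mulr0n addr0.
  by rewrite mulrS; exact: stabilizesD.
by case: i => n; rewrite ?NegzE ?mulrNz; [|apply: stabilizesN]; exact: nat_case.
Qed.

(** Arbitrarily small translations preserving [V] would spread one point of [V] over a dense set. *)
Lemma stabilizer_gap V :
  exists2 d : R, 0 < d & forall t, 0 < t -> stabilizes V (toS1 t) -> d <= t.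
Proof.
apply: contrapT => nogap; apply: (@RO_not_dense _ V); apply/seteqP; split => // z _.
have [x Vx] := RO_neq0 V; apply/closure_circleP => e e0.
have [t [t0 Vt te]] : exists t, [/\ 0 < t, stabilizes V (toS1 t) & t < e].
  apply: contrapT => nt; apply: nogap; exists e => // t t0 Vt.
  by rewrite leNgt; apply/negP => te; apply: nt; exists t.
pose u := repr (z - x); pose j := Num.floor (u / t).
have /andP[j1 j2] := floor_itv (u / t).
exists (t *~ j - u).
  move: j1 j2; rewrite ler_pdivlMr // ltr_pdivrMr // -/j intrD mulr1z => j1 j2.
  by rewrite -mulrzr ltr_norml; apply/andP; split; lra.
rewrite toS1B toS1K addrCA opprB [z + _]addrC subrK addrC toS1Mz.
by apply/(stabilizesMz j Vt).
Qed.

(** The real lifts of the stabilizer form a discrete group, generated by its least positive element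
    [t0]; it contains 1, so [t0] is [1 / n]. *)
Lemma stabilizer_finite V :
  exists2 n, (0 < n)%N & forall eta, stabilizes V eta <-> eta *+ n = 0.
Proof.
have [d d0 gap] := stabilizer_gap V.
pose T : set R := [set t | 0 < t /\ stabilizes V (toS1 t)].
have V1 : stabilizes V (toS1 1) by move=> z; rewrite (toS1_int 1) addr0.
have Tinf : has_inf T.
  by split; [exists 1; split|exists d => t [t0 Vt]; exact: gap].
pose t0 := inf T.
have t0d : d <= t0 by apply: lb_le_inf; [exact: Tinf.1|move=> t [? ?]; exact: gap].
have t0T t : T t -> t0 <= t by move=> Tt; apply: ge_inf => //; exact: Tinf.2.
have [t Tt tlt] := inf_adherent d0 Tinf.
(* The infimum is attained: otherwise two elements within [d] of it would differ by a positive
   element smaller than the gap [d]. *)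
have {t Tt tlt} Vt0 : stabilizes V (toS1 t0).
  have [<-|ne] := eqVneq t t0; first exact: Tt.2.
  have tt0 : t0 < t by rewrite lt_neqAle eq_sym ne t0T.
  have [t' Tt' t'lt] : exists2 t', T t' & t' < t.
    have [] := @inf_adherent _ T (t - t0) _ Tinf; first by rewrite subr_gt0.
    by move=> t' Tt'; rewrite -/t0 addrC subrK; exists t'.
  have : d <= t - t'; last by have := t0T _ Tt'; move: tlt; rewrite -/t0; lra.
  apply: gap; first by rewrite subr_gt0.
  by rewrite toS1B; apply: stabilizesD; [exact: Tt.2|apply: stabilizesN; exact: Tt'.2].
have t0_gt0 : 0 < t0 by exact: lt_le_trans t0d.
have gen u : stabilizes V (toS1 u) -> exists j : int, u = t0 *~ j.
  move=> Vu; exists (Num.floor (u / t0)).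
  have /andP[j1 j2] := floor_itv (u / t0).
  move: j1 j2; set j := Num.floor _.
  rewrite ler_pdivlMr // ltr_pdivrMr // intrD mulr1z -mulrzr => j1 j2.
  apply/eqP; rewrite -subr_eq0 -mulrzr; apply/negPn/negP => ne.
  have : t0 <= u - t0 * j%:~R; last by lra.
  apply: t0T; split; first by rewrite lt_neqAle eq_sym ne subr_ge0; lra.
  rewrite toS1B mulrzr toS1Mz; apply: stabilizesD => //.
  by apply: stabilizesN; exact: stabilizesMz.
have [n nE] := gen _ V1.
have n0 : 0 < n by rewrite -(ltr0z R) -(pmulr_rgt0 _ t0_gt0) mulrzr -nE.
exists `|n|%N => [|eta]; first by rewrite absz_gt0 gt_eqF.
split=> [Ve|en].
  rewrite -(toS1K eta) in Ve *; have [j ->] := gen _ Ve.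
  rewrite -toS1Mn pmulrn gez0_abs ?ltW // -mulrzA mulrC mulrzA -nE toS1Mz.
  by rewrite (toS1_int 1) mul0rz.
move: en; rewrite -(toS1K eta) -toS1Mn -(toS1_0) => /toS1_eq[m]; rewrite subr0.
rewrite pmulrn gez0_abs ?ltW // -(mulr1 m%:~R) mulrzl nE -mulrzA mulrC mulrzA.
rewrite -[LHS]mulrzr -[RHS]mulrzr => /mulIf ->; last by rewrite intr_eq0 gt_eqF.
by rewrite toS1Mz; exact: stabilizesMz.
Qed.

End stabilizer.

Section multiplication.
Context {R : realType} (n : nat) (n0 : (0 < n)%N).
Implicit Types (A : set (circle R)) (V W : RO R) (x y : circle R).
Local Notation mul := (fun x : circle R => x *+ n).

Let nR0 : 0 < n%:R :> R. Proof. by rewrite ltr0n. Qed.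

Lemma mul_surj y : exists x, x *+ n = y.
Proof.
exists (toS1 (repr y / n%:R)); rewrite -toS1Mn -(mulr_natr (_ / _)) divfK ?toS1K //.
by rewrite gt_eqF.
Qed.

(** Multiplication by [n] stretches displacements by exactly [n], so small ones can be both pushed
    forward and divided. *)
Lemma closure_preimage_mul A : closure (mul @^-1` A) = mul @^-1` closure A.
Proof.
apply/seteqP; split=> x /= /closure_circleP cA; apply/closure_circleP => e e0.
  have [|t te At] := cA (e / n%:R); first by rewrite divr_gt0.
  exists (t *+ n); last by move: At; rewrite /= mulrnDl -toS1Mn.
  by rewrite normrMn -(mulr_natr `|t|) -ltr_pdivlMr.
have [|t te At] := cA (e * n%:R); first by rewrite mulr_gt0.
exists (t / n%:R); first by rewrite normrM normfV (gtr0_norm nR0) ltr_pdivrMr.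
by rewrite /= mulrnDl -toS1Mn -(mulr_natr (_ / _)) divfK // gt_eqF.
Qed.

Lemma interior_preimage_mul A : interior (mul @^-1` A) = mul @^-1` interior A.
Proof.
have iE (W : set (circle R)) : interior W = ~` closure (~` W) by rewrite -interiorC setCK.
by rewrite !iE preimage_setC closure_preimage_mul preimage_setC.
Qed.

Lemma frontier_preimage_mul A : frontier (mul @^-1` A) = mul @^-1` frontier A.
Proof. by rewrite /frontier closure_preimage_mul interior_preimage_mul. Qed.

Lemma preimage_mul_inj A A' : mul @^-1` A = mul @^-1` A' -> A = A'.
Proof.
move=> E; apply/seteqP; split=> y; have [x <-] := mul_surj y => Ax.
  by have : (mul @^-1` A) x by []; rewrite E.
by have : (mul @^-1` A') x by []; rewrite -E.
Qed.

(** Multiplication by [n] carries the rotation by [r] to the rotation by [n r] and preserves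
    itineraries. *)
Lemma coding_closure_mul A r :
  coding_closure (mul @^-1` A) r = coding_closure A (r *+ n).
Proof.
have mulE x i : (x + r *~ i) *+ n = x *+ n + r *+ n *~ i.
  by rewrite mulrnDl !pmulrn -!mulrzA mulrC.
apply: hyperspace_inj => /=; congr closure; apply/seteqP; split=> _ [x Bx <-].
  exists (x *+ n).
    by move=> i; rewrite -mulE; have := Bx i; rewrite frontier_preimage_mul.
  by apply/funext => i; rewrite /coding -mulE.
have [z zx] := mul_surj x; exists z.
  by move=> i; rewrite frontier_preimage_mul /= mulE zx; exact: Bx.
by apply/funext => i; rewrite /coding /= mulE zx.
Qed.

(** Invariance under n-torsion makes [V] the full preimage of its image [W]. A translation
    stabilizing [W] lifts to one stabilizing [V], which is torsion and so becomes 0 after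
    multiplication by [n]. *)
Lemma stabilizer_quotient V : (forall eta, stabilizes V eta <-> eta *+ n = 0) ->
  exists W, RO_set V = mul @^-1` RO_set W /\ forall eta, stabilizes W eta -> eta = 0.
Proof.
move=> stabV; pose W := mul @` RO_set V.
have VW : RO_set V = mul @^-1` W.
  apply/seteqP; split=> [x Vx|x [z Vz /= zx]]; first by exists x.
  have /(stabV (x - z)).2/(_ z) : (x - z) *+ n = 0 by rewrite mulrnBl zx subrr.
  by rewrite addrC subrK => ->.
have roW : is_regular_open W.
  split.
  - by have [x Vx] := RO_neq0 V; exists (x *+ n); exists x.
  - apply/eqP => WT; apply: (@RO_not_dense _ V).
    by rewrite VW WT preimage_setT; apply/seteqP; split => // x _; exact: subset_closure.
  - apply: preimage_mul_inj.
    by rewrite -interior_preimage_mul -closure_preimage_mul -VW RO_interior.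
exists (MkRO roW); split => // eta.
have [th <-] := mul_surj eta => Weta; apply/stabV => z.
by rewrite VW /= mulrnDl; exact: Weta.
Qed.

End multiplication.

Section almost_one_to_one.
Context {R : realType} (alpha : R) (irr : irrational alpha).
Context (V : RO R) (Vstab : forall eta, stabilizes V eta -> eta = 0).
Implicit Types (x y : circle R) (s : Sigma2).
Local Notation a := (toS1 alpha).
Local Notation K := (hyper_set (coding_closure V a)).

Lemma follows_inj s x y : follows V a s x -> follows V a s y -> x = y.
Proof.
move=> sx sy; apply/eqP; rewrite -subr_eq0 -opprB oppr_eq0; apply/eqP.
apply: Vstab => z; split=> [Vz|]; last exact: (follows_translate irr sx sy).
by have := follows_translate irr sy sx Vz; rewrite -(opprB y x) addrK.
Qed.

Definition followed s : circle R := xget 0 [set x | follows V a s x].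

Lemma followedP s : K s -> follows V a s (followed s).
Proof. by move=> /(coding_closure_follows (@RO_open _ V)); exact: xgetPex. Qed.

Lemma followed_eq s x : follows V a s x -> followed s = x.
Proof. by move=> sx; apply: (follows_inj _ sx); apply: xgetPex; exists x. Qed.

Lemma followed_shift s : K s -> followed (full_shift s) = rotation a (followed s).
Proof. by move=> Ks; apply/followed_eq/(follows_shiftz 1)/followedP. Qed.

Lemma followed_continuous : {within K, continuous followed}.
Proof.
apply/subspace_continuousP => s Ks A nA.
pose C := ~` interior A.
have cC : closed C by apply: open_closedC; exact: open_interior.
have cF := @follower_closed _ V a _ (@RO_open _ V) cC.
have ns : nbhs s (~` [set s | exists2 x, C x & follows V a s x]).
  apply: open_nbhs_nbhs; split; first by rewrite openC.
  by move=> [x Cx /followed_eq sE]; apply: Cx; rewrite -sE; exact: nA.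
apply: filterS ns => s' ns' Ks'; apply: contrapT => As; apply: ns'.
exists (followed s'); last exact: followedP.
by move/interior_subset.
Qed.

(** The image is closed and contains the dense set [codingB V a]. *)
Lemma followed_image : followed @` K = setT.
Proof.
have cI : closed (followed @` K).
  apply: compact_closed; first exact: circle_hausdorff.
  by apply: continuous_compact followed_continuous _; exact: coding_closure_compact.
apply/seteqP; split => // x _; apply: contrapT => nx.
have oC : open (~` (followed @` K)) by rewrite openC.
have [|z nz Bz] := @codingB_dense _ V a _ oC; first by exists x.
apply: nz; exists (coding V a z); first exact: coding_in_closure.
by apply: followed_eq; exact: follows_coding.
Qed.

Lemma coding_closure_extension :
  almost_one_to_one_extension (coding_closure V a) full_shift setT (rotation a).
Proof.
split; [exact: coding_closure_system|exact: rotation_compact_system|].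
exists followed.
  split; [exact: followed_continuous|exact: followed_image|].
  by move=> s /set_mem; exact: followed_shift.
pose F (i : int) : set (circle R) := rotation (a *~ i) @^-1` frontier V.
have cF i : closed (F i) by apply: rotation_closed; exact: frontier_closed.
(* The dense G_delta set consists of the sequences that follow no point whose orbit meets the
   frontier; the index [i] is decoded from [n]. *)
pose G n := if unpickle n is Some i then ~` [set s | exists2 x, F i x & follows V a s x]
  else setT.
have GB s x : (\bigcap_n G n) s -> follows V a s x -> codingB V a x.
  move=> Gs sx i Fi; have := Gs (pickle i) Logic.I; rewrite /G pickleK; apply.
  by exists x.
exists (\bigcap_n G n); split.
- exists G => // n; rewrite /G; case: unpickle => [i|]; last exact: openT.
  by rewrite openC; apply: follower_closed => //; exact: RO_open.
- apply: closureS => _ [x Bx <-]; split; first exact: coding_in_closure.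
  move=> n _; rewrite /G; case: unpickle => // i -[y Fy /followed_eq].
  by rewrite (followed_eq (follows_coding V a x)) => xy; apply: (Bx i); rewrite xy.
- move=> s s' Ks Gs Ks' ss'; have sx := followedP Ks; have s'x := followedP Ks'.
  have Bx := GB _ _ Gs sx; rewrite (follows_codingB Bx sx).
  by apply: (follows_codingB Bx); rewrite -ss'.
Qed.

End almost_one_to_one.

Section injectivity.
Context {R : realType} (alpha : R) (irr : irrational alpha).
Implicit Types (U V : RO R).
Local Notation a := (toS1 alpha).

Lemma coding_closure_rotatedP U V s : hyper_set (coding_closure U a) s ->
  hyper_set (coding_closure V a) s ->
  rotated U V.
Proof.
move=> /(coding_closure_follows (@RO_open _ U))[x sx].
move=> /(coding_closure_follows (@RO_open _ V))[y sy].
exact: follows_rotated sx sy.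
Qed.

Lemma coding_closure_neq0 U : hyper_set (coding_closure U a) !=set0.
Proof.
have [|x _ Bx] := @codingB_dense _ U a _ (@openT _); first by exists 0.
by exists (coding U a x); exact: coding_in_closure.
Qed.

Lemma Lambda_inj : injective (fun U : RO' R => Lambda (U, a)).
Proof.
move=> U V /(congr1 (@hyper_set _)) UV.
have {}UV : hyper_set (coding_closure (repr U) a) = hyper_set (coding_closure (repr V) a).
  exact: UV.
rewrite -[U]reprK -[V]reprK.
apply/eqmodP/asboolP; have [s Us] := coding_closure_neq0 (repr U).
by apply: (coding_closure_rotatedP Us); rewrite -UV.
Qed.

Lemma haar_codingB_coding_measure (V : RO0 R) r :
  coding_measure V r (coding_closure V r) = 1%E.
Proof.
rewrite -(haar_codingB V r) /coding_measure; congr haar.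
by apply/setIidl => x Bx; exact: coding_in_closure.
Qed.

(** The measure of [U] gives full mass to the closed set coded by [V], so that set contains a coding
    for [U]. *)
Lemma lambda_inj (U V : RO0' R) :
  eq_on_Borel (lambda (U, a)) (lambda (V, a)) -> U = V.
Proof.
move=> UV; rewrite -[U]reprK -[V]reprK; apply/eqmodP/asboolP.
have mV : measurable (coding_closure (repr V) a : set (Borel Sigma2)).
  rewrite -[X in measurable X]setCK; apply: measurableC; apply: measurable_open.
  by rewrite openC; exact: hyper_closed.
have := UV _ mV; rewrite /= haar_codingB_coding_measure => U1.
have [x [Bx Vx]] : codingB (repr U) a `&` coding (repr U) a @^-1` coding_closure (repr V) a !=set0.
  apply/set0P/eqP => E; move: U1; rewrite /coding_measure E measure0 => /eqP.
  by rewrite eq_sym onee_eq0.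
by apply: coding_closure_rotatedP Vx; exact: coding_in_closure.
Qed.

End injectivity.

(** * Unique ergodicity *)

Section probability_facts.
Context d (T : measurableType d) (R : realType) (mu : probability T R).
Local Open Scope ereal_scope.

Lemma probability_setI1 (K A : set T) : measurable K -> measurable A ->
  mu K = 1 -> mu (K `&` A) = mu A.
Proof.
move=> mK mA K1; have mKC := measurableC mK.
have KC0 : mu (~` K) = 0 by rewrite probability_setC // K1 subee.
rewrite -[A in RHS](setIT A) -(setUv K) setIUr.
rewrite (measureU mu (measurableI _ _ mA mK) (measurableI _ _ mA mKC)); last first.
  by rewrite setIACA setICr setI0.
rewrite setIC [X in _ + X](_ : _ = 0) ?adde0 //.
apply: (subset_measure0 (measurableI _ _ mA mKC) mKC _ KC0).
by move=> x [].
Qed.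

Let sum_visitsE (D : set T) (E : nat -> set T) M : measurable D ->
  (forall k, measurable (E k)) ->
  \int[mu]_(x in D) (\sum_(k < M) (x \in E k : nat))%N%:R%:E =
  \sum_(k < M) mu (E k `&` D).
Proof.
move=> mD mE; transitivity (\int[mu]_(x in D) \sum_(k < M) (\1_(E k) x)%:E).
  apply: eq_integral => x _; rewrite sumEFin natr_sum; congr EFin.
rewrite ge0_integral_sum //.
- by apply: eq_bigr => k _; rewrite integral_indic.
- by move=> k; apply/measurable_EFinP; exact: measurable_indic.
Qed.

Let measurable_visits (D : set T) (E : nat -> set T) M : measurable D ->
  (forall k, measurable (E k)) ->
  measurable_fun D (fun x => (\sum_(k < M) (x \in E k : nat))%N%:R%:E : \bar R).
Proof.
move=> mD mE; apply/measurable_EFinP.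
rewrite (_ : (fun x => _) = (fun x => \sum_(k < M) (\1_(E k) x))%R); last first.
  by apply/funext => x; rewrite natr_sum; apply: eq_bigr => k _; rewrite indicE.
by apply: measurable_sum => k; exact: measurable_indic.
Qed.

(** The pointwise bound on the number of visits is integrated over the set [D] of full measure where
    it is known. *)
Lemma sum_visits_le (D : set T) (E : nat -> set T) (M c : nat) : measurable D ->
  mu D = 1 -> (forall k, measurable (E k)) ->
  (forall x, D x -> (\sum_(k < M) (x \in E k) <= c)%N) ->
  \sum_(k < M) mu (E k) <= c%:R%:E.
Proof.
move=> mD D1 mE Ec.
under eq_bigr do rewrite -(probability_setI1 mD) // setIC.
rewrite -sum_visitsE //; apply: (@le_trans _ _ (\int[mu]_(x in D) cst c%:R%:E x)).
  apply: ge0_le_integral => //; first exact: measurable_visits.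
  by move=> x Dx; rewrite lee_fin ler_nat; exact: Ec.
by rewrite integral_cst // [X in _ * X]D1 mule1.
Qed.

Lemma sum_visits_ge (E : nat -> set T) (M c : nat) :
  (forall k, measurable (E k)) -> (forall x, (c <= \sum_(k < M) (x \in E k))%N) ->
  c%:R%:E <= \sum_(k < M) mu (E k).
Proof.
move=> mE Ec; under eq_bigr do rewrite -(setIT (E _)).
rewrite -sum_visitsE //; apply: (@le_trans _ _ (\int[mu]_(x in setT) cst c%:R%:E x)).
  by rewrite integral_cst // [X in _ * X]probability_setT mule1.
apply: ge0_le_integral => //.
- by move=> x _; rewrite lee_fin.
- exact: measurable_visits.
- by move=> x _; rewrite lee_fin ler_nat; exact: Ec.
Qed.

End probability_facts.

Section Borel_facts.
Context {R : realType}.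

Lemma measurable_closed (T : ptopologicalType) (A : set T) :
  closed A -> measurable (A : set (Borel T)).
Proof.
move=> cA; rewrite -[A]setCK; apply: measurableC; apply: measurable_open.
by rewrite openC.
Qed.

Lemma eq_on_Borel_open (T : ptopologicalType) (mu nu : probability (Borel T) R) :
  (forall A : set T, open A -> mu A = nu A) -> eq_on_Borel mu nu.
Proof.
move=> E A mA; apply: (@measure_unique _ R (Borel T) (@open T) (fun=> setT)) => //.
- by move=> B C; exact: openI.
- by move=> _; exact: openT.
- by rewrite bigcup_const.
- by move=> _; rewrite ltey_eq fin_num_measure.
Qed.

(* An open subset of the shift is an increasing union of sets depending on
   finitely many coordinates, which are clopen. *)
Lemma eq_on_Borel_clopen (mu nu : probability (Borel Sigma2) R) :
  (forall A : set Sigma2, open A -> closed A -> mu A = nu A) -> eq_on_Borel mu nu.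
Proof.
move=> E; apply: eq_on_Borel_open => A oA.
pose F N : set Sigma2 := [set s | forall s', agree N s s' -> A s'].
have agree_trans N s s' s'' : agree N s s' -> agree N s' s'' -> agree N s s''.
  by move=> ss' ss'' i iN; rewrite ss'' // ss'.
have agree_sym N s s' : agree N s s' -> agree N s' s by move=> ss' i iN; rewrite ss'.
have oF N : open (F N).
  apply/open_Sigma2P => s Fs; exists N => s' ss' s'' /(agree_trans _ _ _ _ ss').
  exact: Fs.
have cF N : closed (F N).
  move=> s /closure_Sigma2P/(_ N)[s' Fs' ss'] s'' ss''; apply: Fs'.
  by apply: agree_trans ss''; exact: agree_sym.
have AF : A = \bigcup_n F n.
  apply/seteqP; split=> [s /((open_Sigma2P _).1 oA)[N NA]|s [N _ FN]]; first by exists N.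
  exact: FN.
have ndF : nondecreasing_seq F.
  move=> m n mn; apply/subsetPset => s Fs s' ss'; apply: Fs; exact: agreeW ss'.
have mF n : measurable (F n : set (Borel Sigma2)) by exact: measurable_open.
have mUF : measurable (\bigcup_n F n : set (Borel Sigma2)) by exact: bigcupT_measurable.
have cmu := nondecreasing_cvg_mu (mu := mu) mF mUF ndF.
have cnu := nondecreasing_cvg_mu (mu := nu) mF mUF ndF.
rewrite AF -(cvg_lim _ cmu) // -(cvg_lim _ cnu) //.
by have -> : mu \o F = nu \o F by apply/funext => n /=; exact: E.
Qed.

End Borel_facts.

(** * Comparison of visit counts along different orbits *)

Section equidistribution.
Context {R : realType} (alpha : R) (irr : irrational alpha).
Implicit Types (x y : circle R) (F : set (circle R)).
Local Notation a := (toS1 alpha).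

Definition thicken F (d : R) : set (circle R) :=
  [set y | exists2 t, `|t| < d & F (y + toS1 t)].

Lemma thicken_open F d : open (thicken F d).
Proof.
apply/open_circleP => y [t td Ft]; exists (d - `|t|); first by rewrite subr_gt0.
move=> u ud; exists (t - u); last by rewrite -addrA -toS1D [u + _]addrC subrK.
by apply: le_lt_trans (ler_normB _ _) _; rewrite addrC -ltrBrDr.
Qed.

(** Continuity from above along the radii [1 / (n + 1)]. A pair of sets is allowed because the
    comparison of an open set with its translates thickens its closure and its complement
    separately. *)
Lemma haar_thickenI F F' (c : R) : closed F -> closed F' ->
  (forall d : R, 0 < d -> (c%:E <= haar (thicken F d `&` thicken F' d))%E) ->
  (c%:E <= haar (F `&` F'))%E.
Proof.
move=> cF cF' Fc; pose d n : R := n.+1%:R^-1.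
pose G n := thicken F (d n) `&` thicken F' (d n).
have d_lt e : 0 < e -> exists n, d n < e.
  move=> e0; exists (Num.truncn e^-1).
  rewrite -[ltRHS]invrK ltf_pV2 ?posrE ?invr_gt0 //.
  have ie0 : 0 <= e^-1 by rewrite invr_ge0 ltW.
  by have /andP[] := truncn_itv ie0.
have thick_sub A n y : A y -> thicken A (d n) y.
  by move=> Ay; exists 0; rewrite ?normr0 ?invr_gt0 // toS1_0 addr0.
have thick_closed A y : closed A -> (forall n, thicken A (d n) y) -> A y.
  move/closure_id => -> Ay; apply/closure_circleP => e /d_lt[n ne].
  have [t td At] := Ay n.
  have /closure_circleP cA := At; have et : 0 < e - `|t| by rewrite subr_gt0 (lt_trans td).
  have [t' t'e At'] := cA _ et; exists (t + t'); last by rewrite toS1D addrA.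
  by apply: le_lt_trans (ler_normD _ _) _; rewrite addrC -ltrBrDr.
have FG : F `&` F' = \bigcap_n G n.
  apply/seteqP; split=> [y [Fy F'y] n _|y Gy]; first by split; exact: thick_sub.
  by split; apply: thick_closed => // n; have [] := Gy n I.
have mG n : measurable (G n : set (Borel (circle R))).
  by apply: measurable_open; apply: openI; exact: thicken_open.
have niG : nonincreasing_seq G.
  move=> m n mn; apply/subsetPset; apply: setISS => y [t td Ft]; exists t => //;
    by apply: lt_le_trans td _; rewrite lef_pV2 ?posrE // ler_nat.
have mIG : measurable (\bigcap_n G n : set (Borel (circle R))).
  by rewrite -FG; apply: measurable_closed; exact: closedI.
have G0 : (haar (G 0%N) < +oo)%E by rewrite ltey_eq fin_num_measure.
have cG := @nonincreasing_cvg_mu _ (Borel (circle R)) R haar G G0 mG mIG niG.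
rewrite {1}FG -(cvg_lim _ cG) //.
apply: lime_ge; first exact: (cvgP (haar (\bigcap_n G n))).
by apply: nearW => n; apply: Fc; rewrite invr_gt0.
Qed.

Lemma haar_thicken F (c : R) : closed F ->
  (forall d : R, 0 < d -> (c%:E <= haar (thicken F d))%E) -> (c%:E <= haar F)%E.
Proof.
by move=> cF Fc; rewrite -(setIid F); apply: haar_thickenI => // d; rewrite setIid; exact: Fc.
Qed.

(* The orbit of x enters F only when the orbit of y, started l <= L steps
   earlier, enters the d-neighborhood of F. *)
Lemma visits_le F (d : R) : 0 < d -> exists L, forall x y M,
  (\sum_(k < M) ((x + a *~ Posz k)%R \in F) <=
   \sum_(k < M + L) ((y + a *~ Posz k)%R \in thicken F d))%N.
Proof.
move=> d0; have [L LP] := rotation_syndetic irr d0; exists L => x y M.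
have [l [t [lL td E]]] := LP (x - y).
have step k : ((x + a *~ Posz k)%R \in F <= ((y + a *~ Posz (k + l))%R \in thicken F d))%N.
  case: (boolP (_ \in F)) => // /set_mem Fx; rewrite mem_set //.
  exists (- t); first by rewrite normrN.
  have shuffle (u v w p : circle R) : v + (w + (u - v + p)) - p = u + w.
    by rewrite addrA addrA addrK [v + w]addrC -addrA [v + _]addrC subrK addrC.
  by rewrite PoszD mulrzDr -[a *~ Posz l]pmulrn -E toS1N shuffle.
apply: (@leq_trans (\sum_(0 <= k < M + l) ((y + a *~ Posz k)%R \in thicken F d))); last first.
  rewrite -(big_mkord xpredT (fun k => (y + a *~ Posz k)%R \in thicken F d : nat)).
  by rewrite [leqRHS](@big_cat_nat _ _ _ (M + l)) ?leq_add2l //= leq_addr.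
rewrite [leqRHS](@big_cat_nat _ _ _ l) ?leq_addl //=; apply: (leq_trans _ (leq_addl _ _)).
rewrite -{1}[l]add0n big_addn addnK big_mkord; apply: leq_sum => k _; exact: step.
Qed.

End equidistribution.

Lemma full_shift_continuous : continuous full_shift.
Proof. by move=> s; exact: (@shiftz_continuous 1). Qed.

Lemma measurable_full_shift (A : set (Borel Sigma2)) : measurable A ->
  measurable (full_shift @^-1` A : set (Borel Sigma2)).
Proof.
move=> mA; rewrite -[X in measurable X]setTI.
suff : measurable_fun setT (full_shift : Borel Sigma2 -> Borel Sigma2) by exact.
refine (@measurability _ _ (Borel Sigma2) (Borel Sigma2) setT full_shift
  (@open Sigma2) _ _); first by [].
move=> _ [B oB <-]; rewrite setTI; apply: measurable_open.
by apply: open_comp => // s _; exact: full_shift_continuous.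
Qed.

Section unique_ergodicity.
Context {R : realType} (alpha : R) (irr : irrational alpha) (V : RO0 R).
Local Notation a := (toS1 alpha).
Local Notation K := (hyper_set (coding_closure V a)).

Let measurableK : measurable (K : set (Borel Sigma2)).
Proof. by apply: measurable_closed; exact: hyper_closed. Qed.

Lemma iter_full_shift_closed k (C : set Sigma2) : closed C ->
  closed (iter k full_shift @^-1` C).
Proof.
move=> cC; apply: closed_comp => // s _.
rewrite (_ : iter k full_shift = shiftz k); first exact: shiftz_continuous.
by apply/funext => s'; rewrite iter_full_shift.
Qed.

Let measurable_iter k (C : set Sigma2) : closed C ->
  measurable (iter k full_shift @^-1` C : set (Borel Sigma2)).
Proof. by move=> cC; apply: measurable_closed; exact: iter_full_shift_closed. Qed.

Section invariant.
Context (nu : probability (Borel Sigma2) R) (nuK : invariant_on K full_shift nu).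

Lemma invariant_iter k (C : set Sigma2) : closed C ->
  nu (iter k full_shift @^-1` C) = nu C.
Proof.
move=> cC; have [K1 inv] := nuK; elim: k => [//|k IH].
rewrite (_ : _ @^-1` C = full_shift @^-1` (iter k full_shift @^-1` C)); last first.
  by apply/funext => s /=; rewrite -iterSr.
rewrite -IH -[RHS]inv; last exact: measurable_iter.
rewrite probability_setI1 //; have := measurable_iter k.+1 cC.
by rewrite (_ : _ @^-1` C = full_shift @^-1` (iter k full_shift @^-1` C)) //;
  apply/funext => s /=; rewrite -iterSr.
Qed.

(** [M * nu C] is the mean number of visits to [C] in [M] steps. Each such number is at most the
    number of visits of an arbitrary orbit to the thickened set in [M + L] steps, whose mean is
    [(M + L) * h]. *)
Lemma invariant_le_thicken (C : set Sigma2) (d : R) : closed C -> 0 < d ->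
  (nu C <= haar (thicken [set x | exists2 s, C s & follows V a s x] d))%E.
Proof.
move=> cC d0; set F := [set x | _].
have [L LP] := visits_le irr F d0.
have mG : measurable (thicken F d : set (Borel (circle R))).
  by apply: measurable_open; exact: thicken_open.
have mC : measurable (C : set (Borel Sigma2)) by exact: measurable_closed.
pose h := fine (haar (thicken F d)); pose n := fine (nu C).
have hE : haar (thicken F d) = h%:E by rewrite fineK // haar_fin_num.
have nE : nu C = n%:E by rewrite fineK // fin_num_measure.
have h0 : 0 <= h by rewrite -lee_fin -hE.
rewrite hE nE lee_fin.
(* As [M] grows this gives [n <= h]; an [M] beyond [L * h / (n - h)] contradicts the opposite. *)
suff Mn (M : nat) : M%:R * n <= (M + L)%:R * h.
  rewrite leNgt; apply/negP => hn; have nh0 : 0 < n - h by rewrite subr_gt0.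
  have Lh0 : 0 <= L%:R * h / (n - h) by rewrite divr_ge0 ?mulr_ge0 // ltW.
  have /andP[_] := truncn_itv Lh0; rewrite ltr_pdivrMr // => lt.
  by have := Mn (Num.truncn (L%:R * h / (n - h))).+1; rewrite natrD; nra.
(* Visit counts are integers, so the real bound may be rounded down. *)
pose c := Num.truncn ((M + L)%:R * h).
have Mh0 : 0 <= (M + L)%:R * h by rewrite mulr_ge0.
apply: (@le_trans _ _ c%:R); last by have /andP[] := truncn_itv Mh0.
rewrite -lee_fin; have [K1 inv] := nuK.
have -> : ((M%:R * n)%:E = \sum_(k < M) nu (iter k full_shift @^-1` C))%E.
  under eq_bigr do rewrite invariant_iter // nE.
  by rewrite sumEFin sumr_const card_ord mulr_natl.
apply: (@sum_visits_le _ (Borel Sigma2) R nu K (fun k => iter k full_shift @^-1` C) M c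
  measurableK K1) => [k|s Ks]; first exact: measurable_iter.
have [x sx] := coding_closure_follows (@RO_open _ V) Ks.
apply: (@leq_trans (\sum_(k < M) ((x + a *~ Posz k)%R \in F))).
  apply: leq_sum => k _; case: (boolP (s \in _)) => // /set_mem /= Ck.
  rewrite mem_set //; exists (iter k full_shift s) => //.
  by rewrite iter_full_shift; exact: follows_shiftz.
rewrite /c truncn_ge_nat // -lee_fin.
have -> : (((M + L)%:R * h)%:E =
    \sum_(k < M + L) haar (rotation (a *~ Posz k) @^-1` thicken F d))%E.
  under eq_bigr do rewrite haar_rot // hE.
  by rewrite sumEFin sumr_const card_ord mulr_natl.
apply: (@sum_visits_ge _ (Borel (circle R)) R haar
  (fun k => rotation (a *~ Posz k) @^-1` thicken F d)) => [k|y].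
  by apply: measurable_open; apply: rotation_open; exact: thicken_open.
apply: leq_trans (LP x y M) _; apply: leq_sum => k _.
by rewrite /rotation; case: (boolP (_ \in thicken _ _)) => // /set_mem ?; rewrite mem_set.
Qed.

(** On [codingB] a point is followed only by its coding, so up to a null set [F] consists of the
    points coded into [C]. *)
Lemma invariant_le_coding_measure (C : set Sigma2) : closed C ->
  (nu C <= coding_measure V a C)%E.
Proof.
move=> cC; set F := [set x | exists2 s, C s & follows V a s x].
have cF : closed F by apply: followed_closed => //; exact: RO_open.
have mB := measurable_codingB V a; have mF := measurable_closed cF.
have <- : haar F = coding_measure V a C.
  rewrite -(probability_setI1 (mu := haar) mB mF (haar_codingB V a)).
  rewrite /coding_measure; congr haar; apply/seteqP; split=> x [Bx].
    by move=> [s Cs /(follows_codingB Bx) sE]; split=> //=; rewrite -sE.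
  by move=> Cx; split=> //; exists (coding V a x) => //; exact: follows_coding.
have nE : nu C = (fine (nu C))%:E.
  by rewrite fineK // fin_num_measure //; exact: measurable_closed.
rewrite nE; apply: haar_thicken => // d d0.
by rewrite -nE; exact: invariant_le_thicken.
Qed.

End invariant.

Lemma coding_closure_uniquely_ergodic : uniquely_ergodic R K full_shift.
Proof.
have mK1 := haar_codingB_coding_measure V a.
have mE A : coding_prob V a A = coding_measure V a A by [].
exists (coding_prob V a); split.
  split=> // A mA; rewrite probability_setI1 //; last exact: measurable_full_shift.
  exact: coding_measure_shift.
move=> nu nuK; apply: eq_on_Borel_clopen => A oA cA.
have mA : measurable (A : set (Borel Sigma2)) by exact: measurable_open.
apply/eqP; rewrite eq_le invariant_le_coding_measure //=.
have cAC : closed (~` A) by exact: open_closedC.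
have := invariant_le_coding_measure nuK cAC.
rewrite -(mE (~` A)) -(mE A) !probability_setC //.
rewrite -[nu A]fineK ?fin_num_measure // -[coding_prob V a A]fineK ?fin_num_measure //.
by rewrite -!EFinB !lee_fin; lra.
Qed.

End unique_ergodicity.

(** * Denjoy homeomorphisms by blowing up the points of an invariant set *)

Lemma degree_one_int {R : realType} (f : R -> R) : (forall x, f (x + 1) = f x + 1) ->
  forall x (m : int), f (x + m%:~R) = f x + m%:~R.
Proof.
move=> f1; have fn n x : f (x + n%:R) = f x + n%:R.
  by elim: n => [|n IH]; rewrite ?addr0 // -natr1 addrA f1 IH addrA.
move=> x [n|n]; first exact: fn.
have := fn n.+1 (x + (Negz n)%:~R); rewrite NegzE mulrNz -pmulrn subrK => ->.
by rewrite addrK.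
Qed.

Section blowup.
Context {R : realType} (J : R -> R) (D : set R).
Implicit Types (x y z e : R).

(* J is discontinuous exactly at the points of D, where it jumps from the right,
   so that every real lies in exactly one of the intervals [J x, J x+]. *)
Record blowup_map := BlowupMap {
  blowup_lt : {homo J : x y / x < y} ;
  blowup1 : forall x, J (x + 1) = J x + 1 ;
  blowup_left : forall x e, 0 < e ->
    exists2 d, 0 < d & forall y, x - d < y -> y <= x -> J x - e < J y ;
  blowup_right : forall x e, ~ D x -> 0 < e ->
    exists2 d, 0 < d & forall y, x <= y -> y < x + d -> J y < J x + e ;
  blowup_jump : forall x, D x ->
    exists2 e, 0 < e & forall y, x < y -> J x + e <= J y }.

Context (HJ : blowup_map).

Definition right_limit x := inf [set J y | y in [set y | x < y]].
Local Notation Jp := right_limit.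

Let imJ0 x : [set J y | y in [set y | x < y]] !=set0.
Proof. by exists (J (x + 1)); exists (x + 1) => //=; rewrite ltrDl. Qed.

Let has_infJ x : has_inf [set J y | y in [set y | x < y]].
Proof.
by split; [exact: imJ0|exists (J x) => _ [y /= xy <-]; exact/ltW/(blowup_lt HJ)].
Qed.

Lemma le_right_limit x c : (forall y, x < y -> c <= J y) -> c <= Jp x.
Proof. by move=> xc; apply: lb_le_inf => // _ [y /= xy <-]; exact: xc. Qed.

Lemma right_limit_ge x : J x <= Jp x.
Proof. by apply: le_right_limit => y /(blowup_lt HJ)/ltW. Qed.

Lemma right_limit_le x y : x < y -> Jp x <= J y.
Proof. by move=> xy; apply: ge_inf; [exact: (has_infJ x).2|exists y]. Qed.

Lemma right_limit_lt x y : x < y -> Jp x < J y.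
Proof.
move=> xy; have [xm my] := midf_lt xy.
by apply: le_lt_trans (blowup_lt HJ my); exact: right_limit_le.
Qed.

Lemma right_limit_adherent x e : 0 < e -> exists2 y, x < y & J y < Jp x + e.
Proof. by move=> e0; have [_ [y xy <-] ye] := inf_adherent e0 (has_infJ x); exists y. Qed.

Lemma right_limit_nD x : ~ D x -> Jp x = J x.
Proof.
move=> nD; apply/eqP; rewrite eq_le right_limit_ge andbT; apply/ler_addgt0Pr => e e0.
have [d d0 dJ] := blowup_right HJ nD e0.
apply: (@le_trans _ _ (J (x + d / 2))).
  by apply: right_limit_le; rewrite ltrDl divr_gt0.
by apply/ltW/dJ; [rewrite lerDl divr_ge0 // ltW|rewrite ltrD2l; lra].
Qed.

Lemma right_limit_D x : D x -> J x < Jp x.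
Proof.
move=> Dx; have [e e0 eJ] := blowup_jump HJ Dx.
by apply: (@lt_le_trans _ _ (J x + e)); rewrite ?ltrDl //; exact: le_right_limit.
Qed.

Lemma right_limit1 x : Jp (x + 1) = Jp x + 1.
Proof.
apply/eqP; rewrite eq_le; apply/andP; split.
  rewrite -lerBlDr; apply: le_right_limit => y xy.
  by rewrite lerBlDr -(blowup1 HJ); apply: right_limit_le; rewrite ltrD2r.
apply: le_right_limit => y xy.
rewrite -(subrK 1 y) (blowup1 HJ) lerD2r; apply: right_limit_le.
by rewrite ltrBrDr.
Qed.

Lemma blowup_decomp y : exists x, J x <= y <= Jp x.
Proof.
pose S := [set x | J x <= y].
have S0 : S !=set0.
  pose n := (Num.truncn `|J 0 - y|).+1; exists (- n%:R).
  have /andP[_ nJ] := truncn_itv (normr_ge0 (J 0 - y)).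
  rewrite /S /=; have := degree_one_int (blowup1 HJ) (- n%:R) n; rewrite -pmulrn addNr.
  have := ler_norm (J 0 - y); move: nJ; rewrite -/n => ? ? ?; lra.
have ubS : has_ubound S.
  pose n := (Num.truncn `|y - J 0|).+1; exists n%:R => x Sx.
  have /andP[_ nJ] := truncn_itv (normr_ge0 (y - J 0)).
  rewrite leNgt; apply/negP => /(blowup_lt HJ).
  rewrite -[n%:R]add0r (degree_one_int (blowup1 HJ) 0 n).
  have := ler_norm (y - J 0); move: nJ Sx; rewrite -/n /S /= => ? ? ? ?; lra.
(* Left continuity of [J] puts the supremum in [S], and every larger real lies outside [S]. *)
exists (sup S); apply/andP; split.
  rewrite leNgt; apply/negP => yJ.
  have e0 : 0 < J (sup S) - y by rewrite subr_gt0.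
  have [d d0 dJ] := blowup_left HJ (sup S) e0.
  have [x Sx xd] := sup_adherent d0 (conj S0 ubS).
  have := dJ _ xd (ub_le_sup ubS Sx); rewrite opprB addrC subrK => /lt_le_trans.
  by move=> /(_ _ Sx); rewrite ltxx.
apply: le_right_limit => z Sz; rewrite leNgt; apply/negP => Jz.
by have := ub_le_sup ubS (ltW Jz : S z); rewrite leNgt Sz.
Qed.

Lemma blowup_decomp_uniq x x' y : J x <= y <= Jp x -> J x' <= y <= Jp x' -> x = x'.
Proof.
move=> /andP[x1 x2] /andP[x1' x2'].
have [/right_limit_lt|/right_limit_lt|//] := ltgtP x x'; lra.
Qed.

(** This is the lift of the monotone map that is constant on each gap and semiconjugates the Denjoy
    homeomorphism to the rotation. *)
Definition collapse y := xget 0 [set x | J x <= y <= Jp x].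

Lemma collapseP y : J (collapse y) <= y <= Jp (collapse y).
Proof. by have := xgetPex 0 (blowup_decomp y). Qed.

Lemma collapse_eq x y : J x <= y <= Jp x -> collapse y = x.
Proof. exact: (blowup_decomp_uniq (collapseP y)). Qed.

Lemma collapse_le y z : y <= z -> collapse y <= collapse z.
Proof.
move=> yz; rewrite leNgt; apply/negP => /right_limit_lt.
have /andP[? ?] := collapseP y; have /andP[? ?] := collapseP z; lra.
Qed.

Lemma collapse1 y : collapse (y + 1) = collapse y + 1.
Proof.
apply: collapse_eq; rewrite (blowup1 HJ) right_limit1 !lerD2r; exact: collapseP.
Qed.

(** Monotonicity and degree one bound the displacement; this transfers the rotation number from the
    translation to its blow-up. *)
Lemma collapse_near_id : exists C, forall y, `|collapse y - y| <= C.
Proof.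
exists (`|collapse 0| + 2) => y.
have := floor_itv y; rewrite intrD mulr1z; set m := Num.floor y => /andP[m1 m2].
have := degree_one_int collapse1 0 m; rewrite add0r => czm.
have := collapse_le m1; have := collapse_le (ltW m2); rewrite collapse1 czm.
have := ler_norm (collapse 0); have := ler_norm (- collapse 0); rewrite normrN.
by move=> ? ? ? ?; rewrite ler_norml; apply/andP; split; lra.
Qed.

Section rotation_lift.
Context (b : R) (Db : forall x, D (x + b) <-> D x).

(* The interval [J x, J x+] is mapped affinely onto [J (x + b), J (x + b)+]; when it
   is a point, the slope 0 / 0 = 0 is harmless. *)
Definition denjoy_lift y := let x := collapse y in
  J (x + b) + (y - J x) * ((Jp (x + b) - J (x + b)) / (Jp x - J x)).
Local Notation G := denjoy_lift.

Lemma gap_eq0 x : (Jp (x + b) - J (x + b) == 0) = (Jp x - J x == 0).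
Proof.
have [Dx|nDx] := pselect (D x).
  by rewrite !gt_eqF // subr_gt0 right_limit_D //; exact/Db.
by rewrite !right_limit_nD ?subrr // => /Db.
Qed.

Lemma denjoy_liftE x t : 0 <= t <= 1 ->
  G (J x + t * (Jp x - J x)) = J (x + b) + t * (Jp (x + b) - J (x + b)).
Proof.
move=> /andP[t0 t1]; have xJ := right_limit_ge x.
rewrite /G (@collapse_eq x); last first.
  rewrite lerDl mulr_ge0 ?subr_ge0 //= addrC -lerBrDr.
  by rewrite -[leRHS]mul1r ler_pM ?subr_ge0.
congr (_ + _); rewrite addrAC subrr add0r.
have [x0|xN0] := eqVneq (Jp x - J x) 0.
  by have /eqP := gap_eq0 x; rewrite x0 eqxx => /eqP /eqP ->; rewrite !mulr0 mul0r.
by rewrite -mulrA [(Jp x - J x) * _]mulrC divfK.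
Qed.

Lemma blowup_coord y : exists x t, 0 <= t <= 1 /\ y = J x + t * (Jp x - J x).
Proof.
have /andP[y1 y2] := collapseP y; set x := collapse y in y1 y2.
exists x, ((y - J x) / (Jp x - J x)); have xJ := right_limit_ge x.
have [x0|xN0] := eqVneq (Jp x - J x) 0.
  rewrite x0 invr0 !mulr0 lexx ler01 addr0; split => //.
  by apply/eqP; rewrite eq_le y1 andbT; move: y2; rewrite (subr0_eq x0).
have gap : 0 < Jp x - J x by rewrite lt_neqAle eq_sym xN0 subr_ge0.
rewrite divfK // [J x + _]addrC subrK divr_ge0 ?subr_ge0 //; split => //.
by rewrite ler_pdivrMr // mul1r lerD2r.
Qed.

Lemma collapse_denjoy_lift y : collapse (G y) = collapse y + b.
Proof.
have [x [t [t01 ->]]] := blowup_coord y; have /andP[t0 t1] := t01.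
have H z : J z <= J z + t * (Jp z - J z) <= Jp z.
  have zJ := right_limit_ge z.
  rewrite lerDl mulr_ge0 ?subr_ge0 //= addrC -lerBrDr.
  by rewrite -[leRHS]mul1r ler_pM ?subr_ge0.
by rewrite denjoy_liftE // !(collapse_eq (H _)).
Qed.

Lemma denjoy_lift_J x : G (J x) = J (x + b).
Proof. by have := @denjoy_liftE x 0; rewrite !mul0r !addr0 lexx ler01; exact. Qed.

Lemma denjoy_lift_Jp x : G (Jp x) = Jp (x + b).
Proof.
have := @denjoy_liftE x 1; rewrite !mul1r lexx ler01 addrC subrK => -> //.
by rewrite addrC subrK.
Qed.

Lemma denjoy_lift_lt y z : y < z -> G y < G z.
Proof.
move=> yz; have /andP[y1 y2] := collapseP (G y); have /andP[z1 z2] := collapseP (G z).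
(* Over distinct base points the image intervals are disjoint and ordered; over a common one the
   affine map has positive slope. *)
have := collapse_le (ltW yz); rewrite le_eqVlt => /orP[/eqP E|lt]; last first.
  have := right_limit_lt (_ : collapse (G y) < collapse (G z)).
  by rewrite !collapse_denjoy_lift ltrD2r => /(_ lt); rewrite -!collapse_denjoy_lift; lra.
rewrite /G -E; set x := collapse y.
have /andP[xy _] := collapseP y; have /andP[_ zx] := collapseP z.
have gap : 0 < Jp x - J x by rewrite -E -/x in zx; rewrite -/x in xy; lra.
have gapb : 0 < Jp (x + b) - J (x + b).
  by rewrite lt_neqAle eq_sym gap_eq0 gt_eqF //= subr_ge0 right_limit_ge.
by rewrite ltrD2l ltr_pM2r ?divr_gt0 // ltrD2r.
Qed.

Lemma denjoy_lift1 y : G (y + 1) = G y + 1.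
Proof.
have H z : z + 1 + b = z + b + 1 by rewrite addrAC.
have E (u v : R) : u + 1 - (v + 1) = u - v by ring.
by rewrite /G collapse1 H !(blowup1 HJ) !right_limit1 !E addrAC.
Qed.

Lemma denjoy_lift_iter n y : collapse (iter n G y) = collapse y + n%:R * b.
Proof.
elim: n => [|n IH]; first by rewrite mul0r addr0.
by rewrite iterS collapse_denjoy_lift IH -natr1 mulrDl mul1r addrA.
Qed.

(** After collapsing, the n-th iterate is translation by exactly [n * b]; undoing the collapse costs
    at most [2 * C], which division by [n] removes. *)
Lemma denjoy_lift_rotation y : (fun n => (iter n G y - y) / n%:R) @ \oo --> b.
Proof.
have [C nearC] := collapse_near_id.
apply/cvgrPdist_le => e e0; near=> n.
have n0 : 0 < n%:R :> R by near: n; exact: nbhs_infty_gtr.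
have Cn : 2 * C / e <= n%:R by near: n; exact: nbhs_infty_ger.
rewrite -(ler_pM2r n0) -[X in _ * X <= _](gtr0_norm n0) -normrM mulrBl divfK ?gt_eqF //.
move: Cn; rewrite ler_pdivrMr // [n%:R * e]mulrC => Cn; apply: le_trans Cn.
have := nearC y; have := nearC (iter n G y); rewrite denjoy_lift_iter.
rewrite !ler_norml => /andP[? ?] /andP[? ?]; apply/andP; split; lra.
Unshelve. all: by end_near. Qed.

End rotation_lift.

Lemma denjoy_liftK b : (forall x, D (x + b) <-> D x) ->
  cancel (denjoy_lift b) (denjoy_lift (- b)).
Proof.
move=> Db y; have [x [t [t01 ->]]] := blowup_coord y.
have DNb z : D (z - b) <-> D z by rewrite -(Db (z - b)) subrK.
by rewrite !denjoy_liftE // addrK.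
Qed.

(** An increasing bijection is continuous: the preimages of [G y - e] and [G y + e] bracket a
    neighborhood of [y]. *)
Lemma denjoy_lift_continuous b : (forall x, D (x + b) <-> D x) ->
  continuous (denjoy_lift b).
Proof.
move=> Db y; have DNb z : D (z - b) <-> D z by rewrite -(Db (z - b)) subrK.
have GK : cancel (denjoy_lift (- b)) (denjoy_lift b).
  by have := denjoy_liftK DNb; rewrite opprK.
apply/cvgrPdist_lt => e e0; set G := denjoy_lift b.
pose y1 := denjoy_lift (- b) (G y - e); pose y2 := denjoy_lift (- b) (G y + e).
have y1y : y1 < y.
  by rewrite -[ltRHS](denjoy_liftK Db); apply: denjoy_lift_lt => //; rewrite gtrBl.
have yy2 : y < y2.
  by rewrite -[ltLHS](denjoy_liftK Db); apply: denjoy_lift_lt => //; rewrite ltrDl.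
near=> z.
have /(denjoy_lift_lt Db) : y1 < z by near: z; exact: lt_nbhsr.
have /(denjoy_lift_lt Db) : z < y2 by near: z; exact: lt_nbhsl.
rewrite !GK -/G => z2 z1; rewrite ltr_norml; apply/andP; split; lra.
Unshelve. all: by end_near. Qed.

End blowup.

(** * A degree one function with prescribed jumps *)

Section jump_function.
Context {R : realType} (a : nat -> R) (a01 : forall k, 0 <= a k < 1).
Implicit Types (x y e d : R) (k n : nat).

Let w k : R := (2 ^ k.+1)%:R^-1.

Let w_gt0 k : 0 < w k.
Proof. by rewrite invr_gt0 ltr0n expn_gt0. Qed.

Let sum_w n : series w n = 1 - (2 ^ n)%:R^-1.
Proof.
elim: n => [|n IH]; first by rewrite seriesEnat /= big_geq // expn0 invr1 subrr.
rewrite seriesSr IH /w expnS natrM invfM; field.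
by rewrite pnatr_eq0 expn_eq0.
Qed.

Let cvg_w : series w @ \oo --> (1 : R).
Proof.
have := @cvg_geometric_series_half R 1 0; rewrite expr0 divr1.
by under eq_fun do rewrite addn1 div1r.
Qed.

(** Both [u] and [C * w - u] have nonnegative terms, and the tail of [C * w] after [n] terms is
    [C / 2 ^ n]. *)
Let series_bounds (u : nat -> R) C n : (forall k, 0 <= u k <= C * w k) ->
  cvgn (series u) -> series u n <= limn (series u) <= series u n + C * (2 ^ n)%:R^-1.
Proof.
move=> uC cu; apply/andP; split.
  apply: nondecreasing_cvgn_le cu _ => i j; rewrite !seriesEnat => ij.
  by apply: nondecreasing_series ij => k _ _; have /andP[] := uC k.
have cv : series (fun k => C * w k) @ \oo --> C.
  have -> : series (fun k => C * w k) = (fun n => C * series w n).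
    by apply/funext => m; rewrite !seriesEnat /= -mulr_sumr.
  by rewrite -[X in _ --> X]mulr1; apply: cvgM => //; exact: cvg_cst.
have := @nondecreasing_cvgn_le R (series ((fun k => C * w k) - u)) _ _ n.
rewrite lim_seriesB //; last exact: cvgP cv.
rewrite (cvg_lim _ cv) //.
have -> : series ((fun k => C * w k) - u) = (fun n => C * series w n - series u n).
  by apply/funext => m; rewrite !seriesEnat /= mulr_sumr -sumrB.
rewrite sum_w => H; suff : C * (1 - (2 ^ n)%:R^-1) - series u n <= C - limn (series u) by lra.
apply: H.
  have -> : (fun n => C * series w n - series u n) = series (fun k => C * w k - u k).
    by apply/funext => m; rewrite !seriesEnat /= mulr_sumr -sumrB.
  move=> i j; rewrite !seriesEnat => ij.
  by apply: nondecreasing_series ij => k _ _; have /andP[] := uC k; rewrite subr_ge0.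
have <- : series ((fun k => C * w k) - u) = (fun n => C * series w n - series u n).
  by apply/funext => m; rewrite !seriesEnat /= mulr_sumr -sumrB.
have cvu := cvgP _ cv; have := is_cvg_seriesB cvu cu.
by rewrite lim_seriesB // (cvg_lim _ cv).
Qed.

(** The ceiling is continuous from the left and increases by one immediately to the right of each
    point of [a k + Z], which is the kind of jump that [blowup_map] asks for. *)
Let c x k : R := w k * (Num.ceil (x - a k))%:~R.

Let ceil_bounds x : x <= (Num.ceil x)%:~R < x + 1.
Proof.
have /andP[] := ceil_itv x; rewrite intrD mulrNz => ? ?; apply/andP; split => //.
by rewrite -ltrBlDr.
Qed.

Let cvg_c x : cvgn (series (c x)).
Proof.
apply: normed_cvg; apply: (@series_le_cvg _ _ (fun k => (`|x| + 2) * w k)) => [k|k|k|].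
- exact: normr_ge0.
- by rewrite mulr_ge0 ?addr_ge0 // ltW.
- rewrite /= /c normrM (gtr0_norm (w_gt0 k)) mulrC ler_pM2r //.
  have := ceil_bounds (x - a k); have := a01 k => /andP[? ?] /andP[? ?].
  have := ler_norm x; have := ler_norm (- x); rewrite normrN => ? ?.
  by rewrite ler_norml; apply/andP; split; lra.
- have -> : series (fun k => (`|x| + 2) * w k) = (fun n => (`|x| + 2) * series w n).
    by apply/funext => m; rewrite !seriesEnat /= -mulr_sumr.
  by apply: is_cvgM; [exact: is_cvg_cst|exact: cvgP cvg_w].
Qed.

(* The identity makes J strictly increasing; the weights sum to 1, so that the
   division by 2 restores the degree 1. *)
Definition jump_function x : R := (x + limn (series (c x))) / 2.
Local Notation J := jump_function.

Let c_mono x y k : x <= y -> 0 <= c y k - c x k <= (y - x + 1) * w k.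
Proof.
move=> xy; rewrite -mulrBr mulrC pmulr_lge0 // subr_ge0 ler_int ler_pM2r //.
rewrite le_ceil ?lerD2r //=.
have /andP[? ?] := ceil_bounds (y - a k); have /andP[? ?] := ceil_bounds (x - a k); lra.
Qed.

Let J_bounds x y n : x <= y ->
  (y - x) / 2 + series (c y - c x) n / 2 <= J y - J x <=
  (y - x) / 2 + series (c y - c x) n / 2 + (y - x + 1) / 2 * (2 ^ n)%:R^-1.
Proof.
move=> xy; have cD : cvgn (series (c y - c x)) by exact: is_cvg_seriesB.
have := @series_bounds (c y - c x) (y - x + 1) n (fun k => c_mono k xy) cD.
rewrite lim_seriesB // => /andP[? ?].
by rewrite /J; apply/andP; split; lra.
Qed.

Let uniform_gap (Q : nat -> R -> Prop) n :
  (forall k, exists2 d, 0 < d & forall t, 0 <= t -> t < d -> Q k t) ->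
  exists2 d, 0 < d & forall t, 0 <= t -> t < d -> forall k, (k < n)%N -> Q k t.
Proof.
move=> HQ; elim: n => [|n [d d0 dQ]]; first by exists 1.
have [d' d'0 d'Q] := HQ n; exists (Num.min d d'); first by rewrite lt_min d0.
move=> t t0; rewrite lt_min => /andP[td td'] k; rewrite ltnS leq_eqVlt.
by move=> /orP[/eqP ->|]; [exact: d'Q|exact: dQ].
Qed.

Let small_power e : 0 < e -> exists n, (2 ^ n)%:R^-1 < e.
Proof.
move=> e0; exists (Num.truncn e^-1).+1.
have ie0 : 0 <= e^-1 by rewrite invr_ge0 ltW.
rewrite -[ltRHS]invrK ltf_pV2 ?posrE ?invr_gt0 ?ltr0n ?expn_gt0 //.
have /andP[_ lt] := truncn_itv ie0; apply: (lt_trans lt); rewrite ltr_nat.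
exact: ltn_expl.
Qed.

(* If the first n ceilings do not change on a short interval, the remaining ones
   contribute at most 2 ^ (1 - n). *)
Let J_close x e (sg : R) : `|sg| = 1 -> 0 < e ->
  (forall k, exists2 d, 0 < d & forall t, 0 <= t -> t < d ->
     Num.ceil (x + sg * t - a k) = Num.ceil (x - a k)) ->
  exists2 d, 0 < d & forall t, 0 <= t -> t < d -> `|J (x + sg * t) - J x| < e.
Proof.
move=> sg1 e0 HQ; have e20 : 0 < e / 2 by rewrite divr_gt0.
have [n ne] := small_power e20; have [d d0 dQ] := uniform_gap n HQ.
exists (Num.min d (Num.min 1 (e / 2))); first by rewrite !lt_min d0 ltr01 e20.
move=> t t0; rewrite !lt_min => /and3P[td t1 te].
have key y z : y <= z -> z - y = t -> (forall k, (k < n)%N ->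
    Num.ceil (z - a k) = Num.ceil (y - a k)) -> `|J z - J y| < e.
  move=> yz zy cE; have /andP[lo hi] := J_bounds n yz.
  have s0 : series (c z - c y) n = 0.
    rewrite seriesEord /= big1 // => k _.
    by change (c z k - c y k = 0); rewrite /c cE ?subrr.
  move: lo hi; rewrite s0 zy mul0r addr0 => lo hi.
  have : (t + 1) / 2 * (2 ^ n)%:R^-1 <= (2 ^ n)%:R^-1.
    by rewrite ger_pMl ?invr_gt0 ?ltr0n ?expn_gt0 //; lra.
  by move=> ?; rewrite ltr_norml; apply/andP; split; lra.
have [sgE|sgE] : sg = 1 \/ sg = -1.
  by move: sg1; case: ger0P => _ E; [left|right]; lra.
- by apply: key => [||k kn]; [rewrite sgE; lra|rewrite sgE; lra|exact: dQ].
- by rewrite distrC; apply: key => [||k kn]; [rewrite sgE; lra|rewrite sgE; lra|rewrite dQ].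
Qed.

Lemma jump_function_blowup :
  blowup_map J [set x | exists k (m : int), x = a k + m%:~R].
Proof.
split.
- move=> x y xy; have /andP[+ _] := J_bounds 0 (ltW xy).
  rewrite seriesEnat /= big_geq // mul0r addr0 => lo.
  by rewrite -subr_gt0; apply: lt_le_trans lo; rewrite divr_gt0 // subr_gt0.
- move=> x; rewrite /J.
  have -> : c (x + 1) = c x + w.
    apply/funext => k; change (c (x + 1) k = c x k + w k).
    rewrite /c addrAC ceilDrz ?rpred1 // ceil1 intrD mulr1z; ring.
  rewrite lim_seriesD //; last exact: cvgP cvg_w.
  by rewrite (cvg_lim _ cvg_w) //; field.
- move=> x e e0; have [|k|d d0 dJ] := @J_close x e (-1) _ e0.
  + by rewrite normrN1.
  + have /andP[lo hi] := ceil_itv (x - a k).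
    (* A ceiling is constant on a short interval to the left of any point. *)
    exists (x - a k - (Num.ceil (x - a k) - 1)%:~R); first by rewrite subr_gt0.
    move=> t t0 td; apply: ceil_def; apply/andP; split; lra.
  + exists d => // y yd yx; have := dJ (x - y).
    rewrite mulN1r opprB [x + (y - x)]addrC subrK subr_ge0 ltrBlDr -ltrBlDl => /(_ yx yd).
    by rewrite ltr_norml => /andP[? _]; lra.
- move=> x e nD e0; have [|k|d d0 dJ] := @J_close x e 1 _ e0.
  + by rewrite normr1.
  + have /andP[lo hi] := ceil_itv (x - a k).
    (* To the right it is constant up to the next integer, which is at positive distance because [x]
       is not in [a k + Z]. *)
    exists ((Num.ceil (x - a k))%:~R - (x - a k)).
      rewrite subr_gt0 lt_neqAle hi andbT; apply/eqP => E; apply: nD.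
      by exists k, (Num.ceil (x - a k)); rewrite -E addrC subrK.
    by move=> t t0 td; apply: ceil_def; apply/andP; split; lra.
  + exists d => // y xy yd; have := dJ (y - x).
    rewrite mul1r [x + (y - x)]addrC subrK subr_ge0 ltrBlDl => /(_ xy yd).
    by rewrite ltr_norml => /andP[_ ?]; lra.
(* To the right of [x] the k-th ceiling gains at least 1, of weight [w k], which the definition of
   [J] halves. *)
- move=> _ [k [m ->]]; set x := a k + _; exists (w k / 2); first by rewrite divr_gt0.
  move=> y xy; have /andP[+ _] := J_bounds k.+1 (ltW xy).
  suff : w k <= series (c y - c x) k.+1 by move=> ? ?; lra.
  rewrite seriesSr; apply: (@le_trans _ _ ((c y - c x) k)).
    change (w k <= c y k - c x k); rewrite -mulrBr ler_peMr ?(ltW (w_gt0 k)) //.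
    rewrite [x - _]addrC addKr intrKceil.
    have : m + 1 <= Num.ceil (y - a k) by rewrite lezD1 ceil_gt_int ltrBrDl.
    by rewrite -(ler_int R) intrD mulr1z; lra.
  rewrite lerDr seriesEnat /=; apply: sumr_ge0 => i _.
  by have /andP[] := c_mono i (ltW xy).
Qed.

End jump_function.

Section compact_homeomorphism.

Lemma compact_homeo_on (S : ptopologicalType) (T : topologicalType) (K : set S)
    (f : S -> T) : hausdorff_space T -> compact K -> {within K, continuous f} ->
  {in K &, injective f} -> homeo_on K (f @` K) f.
Proof.
move=> hT cK cf fI; pose g y := xget point [set x | K x /\ f x = y].
have gP x : K x -> K (g (f x)) /\ f (g (f x)) = f x.
  by move=> Kx; apply: (@xgetPex S point [set z | K z /\ f z = f x]); exists x.
have gK x : K x -> g (f x) = x.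
  by move=> Kx; have [Kg fg] := gP _ Kx; apply: fI; rewrite ?mem_set.
exists g; split.
- by move=> x Kx; exists x.
- by move=> _ [x Kx <-]; exact: (gP _ Kx).1.
- by split=> [x /set_mem /gK//|_ /set_mem [x Kx <-]]; rewrite gK.
- exact: cf.
- apply/subspace_continuousP => _ [x Kx <-] A nA.
  have {}nA : nbhs x A by rewrite -(gK x Kx).
  pose C := K `&` ~` interior A.
  have cC : compact C.
    by apply: compact_closedI => //; apply: open_closedC; exact: open_interior.
  have cfC : closed (f @` C).
    apply: compact_closed => //; apply: continuous_compact cC.
    by apply: continuous_subspaceW cf => z [].
  have nfx : nbhs (f x) (~` (f @` C)).
    apply: open_nbhs_nbhs; split; first by rewrite openC.
    move=> [z [Kz Az]] zx; apply: Az; suff -> : z = x by exact: nA.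
    by apply: fI; rewrite ?mem_set.
  apply: filterS nfx => y ny [z Kz zy]; apply: contrapT => Ag; apply: ny.
  exists z => //; split => // /interior_subset; apply: contra_not Ag.
  by rewrite -{1}(gK _ Kz) zy.
Qed.

End compact_homeomorphism.

(** * One-sided symbols at the points of a finite frontier *)

Section frontier_sides.
Context {R : realType} (V : RO R) (finF : finite_set (frontier V)).
Implicit Types (z : circle R) (sg t : R) (b : bool).

Lemma circle_connected : connected [set: circle R].
Proof.
rewrite -circle_image_itv; apply: connected_continuous_connected.
  exact: segment_connected.
by apply: continuous_subspaceT => x; exact: toS1_continuous.
Qed.

Lemma frontier_neq0 : frontier V !=set0.
Proof.
apply/set0P/eqP => F0; have oV := @RO_open _ V.
have cV : closed (RO_set V).
  move=> z clz; apply: contrapT => nV; have : frontier V z by rewrite frontierE.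
  by rewrite F0.
apply: (@RO_not_dense _ V).
rewrite -(circle_connected (RO_neq0 V)); last 2 first.
- by exists (RO_set V) => //; rewrite setTI.
- by exists (RO_set V) => //; rewrite setTI.
- by rewrite -((closure_id _).1 cV).
Qed.

(* sg is 1 or -1 and selects the right or the left of z. *)
Definition side sg z b := exists2 d : R, 0 < d & forall t, 0 < t -> t < d ->
  if b then RO_set V (z + toS1 (sg * t)) else ~ closure V (z + toS1 (sg * t)).

Definition unit_sign sg := sg = 1 \/ sg = -1.

Lemma unit_signM sg t : unit_sign sg -> `|sg * t| = `|t|.
Proof. by case=> ->; rewrite ?mul1r // mulN1r normrN. Qed.

Lemma side_uniq sg z b b' : side sg z b -> side sg z b' -> b = b'.
Proof.
move=> [d d0 db] [d' d'0 db']; pose t := Num.min d d' / 2.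
have m0 : 0 < Num.min d d' by rewrite lt_min d0.
have t0 : 0 < t by rewrite divr_gt0.
have : t < Num.min d d' by rewrite /t; lra.
rewrite lt_min => /andP[td td']; have := db _ t0 td; have := db' _ t0 td'.
by case: b {db}; case: b' {db'} => // h h'; absurd (closure V (z + toS1 (sg * t)));
  rewrite //; exact: subset_closure.
Qed.

(** A short one-sided arc at [z] misses the finite frontier, so by connectedness it lies in [V] or
    outside the closure of [V]. *)
Lemma side_exists sg z : unit_sign sg -> exists b, side sg z b.
Proof.
move=> sg1; have cF : closed (frontier V `\` [set z]).
  apply: (accessible_finite_set_closed.1 (hausdorff_accessible circle_hausdorff)).
  exact: finite_setD.
have oF : open (~` (frontier V `\` [set z])) by rewrite openC.
have [|e e0 eF] := (open_circleP _).1 oF z; first by move=> [_]; apply.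
(* The bound 1 keeps the arc from going round the circle back to [z]. *)
pose d := Num.min e 1; have d0 : 0 < d by rewrite lt_min e0 ltr01.
pose I : set R := `]0, d[%classic.
pose f t := z + toS1 (sg * t).
have cf : continuous f.
  move=> t; have -> : f = rotation z \o (@toS1 R \o *%R sg).
    by apply/funext => u; rewrite /f /= /rotation addrC.
  apply: continuous_comp; last exact: rot_continuous.
  apply: continuous_comp; last exact: toS1_continuous.
  exact: mulrl_continuous.
have nF t : I t -> ~ frontier V (f t).
  rewrite /I /= in_itv /= lt_min => /and3P[t0 te t1] Ft.
  have tn : `|sg * t| = t by rewrite unit_signM // gtr0_norm.
  apply: (eF (sg * t)); first by rewrite tn.
  split=> // zE; have /addrI : f t = z + 0 by rewrite addr0; exact: zE.
  rewrite -(toS1_0 (R := R)) => /toS1_eq[m]; rewrite subr0 => mE; move: tn; rewrite mE => mt.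
  have : `|m|%:~R = t by rewrite -mt intr_norm.
  move=> tE; move: t0 t1; rewrite -tE ltr0z -[1]mulr1z ltr_int; lia.
have [VI|nVI] := pselect (exists2 t, I t & RO_set V (f t)); last first.
  exists false; exists d => // t t0 td clV.
  have It : I t by rewrite /I /= in_itv /= t0.
  apply: (nF t It); rewrite frontierE //; first by split => // Vt; apply: nVI; exists t.
  exact: RO_open.
exists true; exists d => // t t0 td.
have It : I t by rewrite /I /= in_itv /= t0.
have cI : connected I by apply/connected_intervalP; exact: interval_is_interval.
have IE : I `&` f @^-1` RO_set V = I.
  apply: cI.
  - by have [u Iu Vu] := VI; exists u.
  - exists (f @^-1` RO_set V) => //; apply: open_comp => [u _|]; [exact: cf|exact: RO_open].
  - exists (f @^-1` closure V).
      by apply: closed_comp => [u _|]; [exact: cf|exact: closed_closure].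
    apply/seteqP; split=> u [Iu Vu]; split => //; first exact: subset_closure.
    apply: contrapT => nV; apply: (nF u Iu); rewrite frontierE //; exact: RO_open.
by move: It; rewrite -{1}IE => -[].
Qed.

Lemma side_not_frontier sg z : unit_sign sg -> ~ frontier V z ->
  side sg z `[< RO_set V z >].
Proof.
move=> sg1 /not_frontierP; rewrite ext_partE => -[Vz|nVz].
  rewrite asboolT //; have [d d0 dV] := (open_circleP _).1 (@RO_open _ V) _ Vz.
  by exists d => // t t0 td; apply: dV; rewrite unit_signM // gtr0_norm.
have oC : open (~` closure V) by rewrite openC; exact: closed_closure.
have [d d0 dV] := (open_circleP _).1 oC _ nVz.
rewrite asboolF; last by move/subset_closure.
by exists d => // t t0 td; apply: dV; rewrite unit_signM // gtr0_norm.
Qed.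

(** If the sides agreed, [z] would be a puncture of [V], which regularity excludes, or an isolated
    point of the complement of the exterior, which is not in the closure of [V]. *)
Lemma side_frontier z b b' : frontier V z -> side 1 z b -> side (-1) z b' -> b != b'.
Proof.
move=> Fz [d d0 db] [d' d'0 db']; apply/eqP => E; subst b'.
pose e := Num.min d d'; have e0 : 0 < e by rewrite lt_min d0.
have punct t : `|t| < e -> t != 0 ->
    if b then RO_set V (z + toS1 t) else ~ closure V (z + toS1 t).
  rewrite lt_min => /andP[td td'] tN0.
  have [t0|t0|t0] := ltgtP t 0; last by rewrite t0 eqxx in tN0.
    have := db' (- t); rewrite mulN1r opprK; apply; first by rewrite oppr_gt0.
    by rewrite -(ltr0_norm t0).
  by have := db t; rewrite mul1r; apply => //; rewrite -(gtr0_norm t0).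
move: Fz; rewrite (frontierE (@RO_open _ V)) => -[clz nVz].
case: b punct {db db'} => punct.
  apply: nVz; rewrite -(RO_interior V); apply/nbhs_circleP; exists e => // t te.
  have [->|tN0] := eqVneq t 0; first by rewrite toS1_0 addr0.
  by apply: subset_closure; exact: punct.
have [t te Vt] := (closure_circleP _ _).1 clz _ e0.
have [t0|tN0] := eqVneq t 0; first by apply: nVz; move: Vt; rewrite t0 toS1_0 addr0.
by apply: (punct t te tN0); exact: subset_closure.
Qed.

End frontier_sides.

Section circle_maps.
Context {R : realType}.
Implicit Types (F G : R -> R).

Definition circle_map F (z : circle R) : circle R := toS1 (F (repr z)).

Lemma circle_mapE F x : (forall x, F (x + 1) = F x + 1) ->
  circle_map F (toS1 x) = toS1 (F x).
Proof.
move=> F1; have /toS1_eq[m mE] := toS1K (toS1 x : circle R).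
by rewrite /circle_map -(subrK x (repr _)) mE addrC (degree_one_int F1) toS1Dz.
Qed.

Lemma circle_map_continuous F : (forall x, F (x + 1) = F x + 1) -> continuous F ->
  continuous (circle_map F).
Proof.
move=> F1 cF; apply/quotient_continuous.
rewrite (_ : _ \o _ = toS1 \o F); last by apply/funext => x; exact: circle_mapE.
by move=> x; apply: continuous_comp; [exact: cF|exact: toS1_continuous].
Qed.

Lemma circle_mapK F G : (forall x, F (x + 1) = F x + 1) ->
  (forall x, G (x + 1) = G x + 1) -> cancel F G ->
  cancel (circle_map F) (circle_map G).
Proof. by move=> F1 G1 FK z; rewrite -(toS1K z) !circle_mapE ?FK. Qed.

End circle_maps.

(** * Conjugacy of the coding closure with a Denjoy minimal set *)

Section denjoy_conjugacy.
Context {R : realType} (alpha : R) (irr : irrational alpha).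
Context (V : RO R) (Vstab : forall eta, stabilizes V eta -> eta = 0).
Context (finF : finite_set (frontier V)).
Implicit Types (x y t : R) (z : circle R) (s : Sigma2).
Local Notation a := (toS1 alpha).
Local Notation K := (hyper_set (coding_closure V a)).
Local Notation p := (followed alpha V).

Let pP s : K s -> follows V a s (p s).
Proof. exact: followedP. Qed.

Let D : set R := [set x | exists i : int, frontier V (toS1 x + a *~ i)].

Let D_shift x : D (x + alpha) <-> D x.
Proof.
have E (i : int) : toS1 (x + alpha) + a *~ i = toS1 x + a *~ (i + 1).
  by rewrite toS1D mulrzDr mulr1z -addrA [a + _]addrC.
split=> -[i Di]; first by exists (i + 1); rewrite -E.
by exists (i - 1); rewrite E subrK.
Qed.

Let D_enum : exists2 e : nat -> R, (forall k, 0 <= e k < 1) &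
  D = [set x | exists k (m : int), x = e k + m%:~R].
Proof.
have [fs fsE] := (finite_seqP _).1 finF; have [f0 Ff0] := frontier_neq0 V.
(* Codes of no pair, and positions beyond the end of the list, fall back on the frontier point [f0],
   so the enumeration stays inside [D]. *)
pose c k : circle R := if @unpickle (int * nat)%type k is Some (i, j)
  then nth f0 fs j - a *~ i else f0.
have [|e eP] := @choice nat R (fun k x => 0 <= x < 1 /\ toS1 x = c k).
  by move=> k; have [x x01 xk] := toS1_frac (c k); exists x.
exists e => [k|]; first by have [] := eP k.
apply/seteqP; split=> [x [i Fi]|_ [k [m ->]]].
  have fsi : toS1 x + a *~ i \in fs by move: Fi; rewrite fsE.
  pose k := pickle (i, index (toS1 x + a *~ i) fs).
  have /toS1_eq[m xm] : toS1 x = toS1 (e k).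
    by rewrite (eP k).2 /c /k pickleK nth_index // addrK.
  by exists k, m; rewrite -xm addrC subrK.
rewrite /D /= toS1Dz (eP k).2 /c; case: (unpickle k) => [[i j]|].
  exists i; rewrite subrK fsE /=.
  have [jl|jl] := ltnP j (size fs); first exact: mem_nth.
  by rewrite nth_default //; move: Ff0; rewrite fsE.
by exists 0; rewrite mulr0z addr0.
Qed.

Let blowup_exists : exists J, blowup_map J D.
Proof.
have [e e01 ->] := D_enum; exists (jump_function e); exact: jump_function_blowup.
Qed.

Let J : R -> R := projT1 (cid blowup_exists).
Let HJ : blowup_map J D := projT2 (cid blowup_exists).
Local Notation Jp := (right_limit J).
Local Notation G := (denjoy_lift J alpha).
Local Notation g := (circle_map G).

Let D_shiftN x : D (x - alpha) <-> D x.
Proof. by rewrite -(D_shift (x - alpha)) subrK. Qed.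

Let G1 x : G (x + 1) = G x + 1. Proof. exact: (denjoy_lift1 HJ). Qed.
Let GN1 x : denjoy_lift J (- alpha) (x + 1) = denjoy_lift J (- alpha) x + 1.
Proof. exact: (denjoy_lift1 HJ). Qed.

Let gK : cancel g (circle_map (denjoy_lift J (- alpha))).
Proof. by apply: circle_mapK => //; exact: (denjoy_liftK HJ D_shift). Qed.

Let gNK : cancel (circle_map (denjoy_lift J (- alpha))) g.
Proof.
apply: circle_mapK => //.
by have := denjoy_liftK HJ D_shiftN; rewrite opprK.
Qed.

Let g_continuous : continuous g.
Proof. by apply: circle_map_continuous => //; exact: (denjoy_lift_continuous HJ D_shift). Qed.

Let gN_continuous : continuous (circle_map (denjoy_lift J (- alpha))).
Proof. by apply: circle_map_continuous => //; exact: (denjoy_lift_continuous HJ D_shiftN). Qed.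

(* s is the limit of the codings of the points approaching z from the side sg. *)
Let one_sided sg s z := forall i, side V sg (z + a *~ i) (s i).

Let one_sided_codingB sg s x : unit_sign sg -> K s -> ~ D x -> toS1 x = p s ->
  one_sided sg s (p s).
Proof.
move=> sg1 Ks nD xp; have Bx : codingB V a (p s).
  by move=> i Fi; apply: nD; exists i; rewrite xp.
move=> i; have -> : s i = coding V a (p s) i by rewrite {1}(follows_codingB Bx (pP Ks)).
by apply: side_not_frontier => //; exact: Bx.
Qed.

Let p_near s (d : R) : K s -> 0 < d ->
  nbhs s [set s' | K s' -> exists2 t, `|t| < d & p s' = p s + toS1 t].
Proof.
move=> Ks d0; have /subspace_continuousP cp := followed_continuous irr Vstab.
apply: (cp s Ks [set z | exists2 t, `|t| < d & z = p s + toS1 t]).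
by apply/nbhs_circleP; exists d => // t td; exists t.
Qed.

Let follows_side sg s (x : circle R) t (i : int) (b : bool) (d : R) :
  follows V a s (x + toS1 (sg * t)) ->
  (forall t, 0 < t -> t < d -> if b then RO_set V (x + a *~ i + toS1 (sg * t))
     else ~ closure V (x + a *~ i + toS1 (sg * t))) ->
  0 < t -> t < d -> s i = b.
Proof.
move=> sx db t0 td; have := db _ t0 td; have := sx i; rewrite addrAC.
by case: (s i); case: b {db}.
Qed.

(** If both descriptions failed, at indices [i] and [j], take a coding near [s] with the same
    symbols there: its point lies to the right of [p s], to the left, or at it, and each case
    contradicts a failure. *)
Let one_sided_exists s : K s -> one_sided 1 s (p s) \/ one_sided (-1) s (p s).
Proof.
move=> Ks; apply: contrapT => /not_orP[/existsNP[i nr] /existsNP[j nl]].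
have sgr : unit_sign (1 : R) by left. have sgl : unit_sign (-1 : R) by right.
have [b br] := side_exists finF (p s + a *~ i) sgr.
have [b' bl] := side_exists finF (p s + a *~ j) sgl.
have [[d d0 db] [d' d'0 db']] := (br, bl).
have dd0 : 0 < Num.min d d' by rewrite lt_min d0.
have nb : nbhs s ([set s' | K s' -> exists2 t, `|t| < Num.min d d' & p s' = p s + toS1 t]
    `&` ([set s' : Sigma2 | s' i = s i] `&` [set s' : Sigma2 | s' j = s j])).
  apply: filterI; first exact: p_near.
  by apply: filterI; exact: nbhs_coord.
have [_ [[x Bx <-] [near_p [/= si sj]]]] := Ks _ nb.
have Kx := coding_in_closure Bx; have [t] := near_p Kx.
rewrite (followed_eq irr Vstab (follows_coding V a x)) lt_min => /andP[td td'] xE.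
have cx := follows_coding V a x.
have [t0|t0|t0] := ltgtP t 0.
- apply: nl; rewrite -sj; have {}cx : follows V a (coding V a x) (p s + toS1 (-1 * - t)).
    by rewrite mulN1r opprK -xE.
  have -> // : coding V a x j = b'.
  by apply: (follows_side cx db'); rewrite ?oppr_gt0 // -(ltr0_norm t0).
- apply: nr; rewrite -si; have {}cx : follows V a (coding V a x) (p s + toS1 (1 * t)).
    by rewrite mul1r -xE.
  have -> // : coding V a x i = b.
  by apply: (follows_side cx db t0); rewrite -(gtr0_norm t0).
- move: xE; rewrite t0 toS1_0 addr0 => xE; apply: nr; rewrite -si -xE.
  by apply: side_not_frontier => //; exact: Bx.
Qed.

(** Over [D] this selects an end of the gap; elsewhere [J] agrees with its right limit, so both ends
    are the same point. *)
Let rightb s := `[< one_sided 1 s (p s) >].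

Let leftP s : K s -> ~~ rightb s -> one_sided (-1) s (p s).
Proof. by move=> Ks /asboolPn nr; have [] := one_sided_exists Ks. Qed.

Let lift s x := if rightb s then Jp x else J x.

Let lift_bounds s x : J x <= lift s x <= Jp x.
Proof.
by rewrite /lift; case: ifP => _; rewrite !lexx ?andbT (right_limit_ge HJ).
Qed.

Let psi s : circle R := toS1 (lift s (repr (p s))).

Let psiE s x : toS1 x = p s -> psi s = toS1 (lift s x).
Proof.
rewrite -[RHS]toS1K => /esym/toS1_eq[m mE].
rewrite /psi -(subrK x (repr _)) mE addrC /lift.
have J1 := degree_one_int (blowup1 HJ); have Jp1 := degree_one_int (right_limit1 HJ).
by case: ifP => _; rewrite ?J1 ?Jp1 toS1Dz.
Qed.

Let K_shift s : K s -> K (full_shift s).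
Proof. by move=> Ks; exact: (@coding_closure_shiftz _ _ _ s 1). Qed.

Let rightb_shift s : K s -> rightb (full_shift s) = rightb s.
Proof.
move=> Ks; apply: asbool_equiv_eq; rewrite (followed_shift irr Vstab Ks).
have E (i : int) : rotation a (p s) + a *~ i = p s + a *~ (i + 1).
  by rewrite /rotation mulrzDr mulr1z -addrA [a + _]addrC.
split=> H i; last by rewrite E; exact: H.
by have := H (i - 1); rewrite E /full_shift !subrK.
Qed.

Let psi_shift s : K s -> psi (full_shift s) = g (psi s).
Proof.
move=> Ks; rewrite /psi circle_mapE //; rewrite -/(psi _).
rewrite (@psiE _ (repr (p s) + alpha)); last first.
  by rewrite (followed_shift irr Vstab Ks) toS1D toS1K.
congr toS1; rewrite /lift rightb_shift //; case: ifP => _.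
  by rewrite (denjoy_lift_Jp HJ D_shift).
by rewrite (denjoy_lift_J HJ D_shift).
Qed.

Let psi_lift s x : psi s = toS1 x -> exists2 y, toS1 y = p s & lift s y = x.
Proof.
move=> /esym/toS1_eq[m mE]; exists (repr (p s) + m%:~R); first by rewrite toS1Dz toS1K.
rewrite -(subrK (lift s (repr (p s))) x) mE [RHS]addrC /lift.
by case: ifP => _; [exact: (degree_one_int (right_limit1 HJ))|exact: (degree_one_int (blowup1 HJ))].
Qed.

Let one_sided_uniq sg s s' z : one_sided sg s z -> one_sided sg s' z -> s = s'.
Proof. by move=> H H'; apply/funext => i; exact: (side_uniq (H i) (H' i)). Qed.

Let psi_inj : {in K &, injective psi}.
Proof.
move=> s s' /set_mem Ks /set_mem Ks' E.
pose x := repr (p s); have xp : toS1 x = p s by exact: toS1K.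
have [x' xp' xE'] := psi_lift (esym E); rewrite -/x in xE'.
have xx' : x = x'.
  apply: (blowup_decomp_uniq HJ (lift_bounds s x)); rewrite -xE'; exact: lift_bounds.
subst x'; have pp : p s' = p s by rewrite -xp'.
have [Dx|nDx] := pselect (D x); last first.
  have sg : unit_sign (1 : R) by left.
  apply: (one_sided_uniq (one_sided_codingB sg Ks nDx xp)).
  by rewrite -pp; exact: (one_sided_codingB sg Ks' nDx xp').
(* At a jump the ends of the gap differ, so equal images force the same side. *)
have lt := right_limit_D HJ Dx; move: xE'; rewrite /lift.
case: (boolP (rightb s)); case: (boolP (rightb s')) => r' r E'; try by move: lt; rewrite E' ltxx.
  by apply: one_sided_uniq (asboolP _ r) _; rewrite -pp; exact: asboolP.
by apply: one_sided_uniq (leftP Ks r) _; rewrite -pp; exact: leftP.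
Qed.

(** The orbit of [p s] meets the frontier at some index [i], where the symbol distinguishes the two
    sides; sequences with the symbol [s i] follow points on the side of [s]. *)
Let at_jump s x (d : R) : K s -> D x -> toS1 x = p s -> 0 < d ->
  nbhs s [set s' | K s' -> exists t, [/\ p s' = p s + toS1 t, `|t| < d,
    t = 0 -> rightb s' = rightb s & if rightb s then 0 <= t else t <= 0]].
Proof.
move=> Ks [i Fi] xp d0; rewrite xp in Fi.
have sgr : unit_sign (1 : R) by left. have sgl : unit_sign (-1 : R) by right.
have [b br] := side_exists finF (p s + a *~ i) sgr.
have [b' bl] := side_exists finF (p s + a *~ i) sgl.
have bb' := side_frontier Fi br bl.
have sideE s' : K s' -> p s' = p s -> s' i = if rightb s' then b else b'.
  move=> Ks' pp; case: (boolP (rightb s')) => [/asboolP|/(leftP Ks')] /(_ i).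
    by rewrite pp => /(side_uniq br).
  by rewrite pp => /(side_uniq bl).
have rE s' s'' : (if rightb s' then b else b') = (if rightb s'' then b else b') ->
    rightb s' = rightb s''.
  by move: bb'; case: (rightb s'); case: (rightb s'') => // + E; rewrite E eqxx.
have [[dr dr0 dbr] [dl dl0 dbl]] := (br, bl).
have dd0 : 0 < Num.min d (Num.min dr dl) by rewrite !lt_min d0 dr0.
have nb : nbhs s ([set s' | K s' ->
    exists2 t, `|t| < Num.min d (Num.min dr dl) & p s' = p s + toS1 t]
    `&` [set s' : Sigma2 | s' i = s i]).
  by apply: filterI; [exact: p_near|exact: nbhs_coord].
apply: filterS nb => s' [near_p s'i] Ks'; have [t] := near_p Ks'.
rewrite !lt_min => /and3P[td tr tl] pt; exists t; split => //.
  move=> t0; have pp : p s' = p s by rewrite pt t0 toS1_0 addr0.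
  by apply: rE; rewrite -!sideE.
have sx := pP Ks'; rewrite pt in sx; have siE := sideE s Ks erefl.
case: ifP siE => r siE; rewrite leNgt; apply/negP => t0.
  have {}sx : follows V a s' (p s + toS1 (-1 * - t)) by rewrite mulN1r opprK.
  have := follows_side sx dbl; rewrite oppr_gt0 -(ltr0_norm t0) => /(_ t0 tl).
  by rewrite s'i siE => E; rewrite E eqxx in bb'.
have {}sx : follows V a s' (p s + toS1 (1 * t)) by rewrite mul1r.
have := follows_side sx dbr t0; rewrite -(gtr0_norm t0) => /(_ tr).
by rewrite s'i siE => E; rewrite E eqxx in bb'.
Qed.

Let J_right x (e : R) : 0 < e -> exists2 d : R, 0 < d &
  forall y, x < y -> y < x + d -> Jp y < Jp x + e.
Proof.
move=> e0; have [z xz ze] := right_limit_adherent HJ x e0.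
exists (z - x) => [|y xy yz]; first by rewrite subr_gt0.
by apply: le_lt_trans ze; apply: (right_limit_le HJ); move: yz; rewrite addrC subrK.
Qed.

(** At a jump, neighbors stay on the side of [s], and there [J] converges to the end of the gap that
    was selected; elsewhere [J] is continuous. *)
Let psi_continuous : {within K, continuous psi}.
Proof.
apply/subspace_continuousP => s Ks A /nbhs_circleP[e e0 eA].
pose x := repr (p s); have xp : toS1 x = p s by exact: toS1K.
have [dr dr0 Jr] := J_right x e0; have [dl dl0 Jl] := blowup_left HJ x e0.
have d0 : 0 < Num.min dr dl by rewrite lt_min dr0.
have closeA s' t : p s' = p s + toS1 t -> `|lift s' (x + t) - lift s x| < e -> A (psi s').
  move=> pt le; rewrite (@psiE s' (x + t)); last by rewrite toS1D xp.
  rewrite -(subrK (lift s x) (lift _ _)) addrC toS1D -(psiE xp); exact: eA.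
have right_t s' t : 0 < t -> t < dr -> Jp x <= lift s' (x + t) < Jp x + e.
  move=> t0 td; have /andP[lo hi] := lift_bounds s' (x + t).
  rewrite (le_trans _ lo) /=; last by apply: (right_limit_le HJ); rewrite ltrDl.
  by apply: le_lt_trans hi _; apply: Jr; rewrite ?ltrDl ?ltrD2l.
have left_t s' t : t < 0 -> - t < dl -> J x - e < lift s' (x + t) <= J x.
  move=> t0 td; have /andP[lo hi] := lift_bounds s' (x + t).
  rewrite (le_trans hi) /=; last by apply: (right_limit_le HJ); rewrite gtrDl.
  rewrite andbT; apply: lt_le_trans lo; apply: Jl; last by rewrite gerDl ltW.
  by rewrite ltrBlDr -ltrBlDl; lra.
have [Dx|nDx] := pselect (D x).
  apply: filterS (at_jump Ks Dx xp d0) => s' near_s Ks'.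
  have [t [pt]] := near_s Ks'; rewrite lt_min => /andP[tr tl] t0r sgt.
  apply: (closeA _ t pt).
  have [tE|tN0] := eqVneq t 0.
    by rewrite tE addr0 /lift t0r // subrr normr0.
  rewrite {2}/lift; case: ifP sgt => _ t0.
    have {}t0 : 0 < t by rewrite lt_neqAle eq_sym tN0.
    have := right_t s' t t0; rewrite -{1}(gtr0_norm t0) => /(_ tr) /andP[? ?].
    by rewrite ltr_norml; apply/andP; split; lra.
  have {}t0 : t < 0 by rewrite lt_neqAle tN0.
  have := left_t s' t t0; rewrite -{1}(ltr0_norm t0) => /(_ tl) /andP[? ?].
  by rewrite ltr_norml; apply/andP; split; lra.
have JJ := right_limit_nD HJ nDx.
have liftE s' : lift s' x = J x by rewrite /lift JJ if_same.
apply: filterS (p_near Ks d0) => s' near_s Ks'.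
have [t] := near_s Ks'; rewrite lt_min => /andP[tr tl] pt.
apply: (closeA _ t pt); rewrite (liftE s).
have [t0|t0|->] := ltgtP t 0; last by rewrite addr0 liftE subrr normr0.
  have := left_t s' t t0; rewrite -{1}(ltr0_norm t0) => /(_ tl) /andP[? ?].
  by rewrite ltr_norml; apply/andP; split; lra.
have := right_t s' t t0; rewrite -{1}(gtr0_norm t0) => /(_ tr); rewrite JJ => /andP[? ?].
by rewrite ltr_norml; apply/andP; split; lra.
Qed.

Let N := psi @` K.

Let N_compact : compact N.
Proof. exact: continuous_compact psi_continuous (@coding_closure_compact _ _ _). Qed.

Let N_closed : closed N.
Proof. exact: compact_closed circle_hausdorff N_compact. Qed.

Let N_g z : N z -> N (g z).
Proof.
by move=> [s Ks <-]; exists (full_shift s); [exact: K_shift|exact: psi_shift].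
Qed.

Let N_gN z : N (g z) -> N z.
Proof.
move=> [s Ks sz]; have Ks' := @coding_closure_shiftz _ V a s (-1) Ks.
exists (shiftz (-1) s) => //; apply: (can_inj gK); rewrite -sz -psi_shift //.
by rewrite full_shiftE shiftzD subrr shiftz0.
Qed.

Let psi_iter n s : K s -> K (iter n full_shift s) /\ psi (iter n full_shift s) = iter n g (psi s).
Proof.
move=> Ks; elim: n => [//|n [Kn IH]]; rewrite !iterS -IH.
by split; [exact: K_shift|exact: psi_shift].
Qed.

Let N_minimal : minimal_system N g.
Proof.
move=> _ [s Ks <-] _ [s' Ks' <-] A nA.
have /subspace_continuousP cp := psi_continuous.
have [s'' [[Ks'' [n orb]] sA]] := coding_closure_minimal irr Ks Ks' (cp s' Ks' A nA).
exists (psi s''); split; last exact: sA.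
split; first by exists s''.
exists n; case: orb => E; [left|right].
  by rewrite -(psi_iter n Ks).2 E.
by rewrite -(psi_iter n Ks'').2 E.
Qed.

(** Only ends of gaps are values of [psi], so the midpoint of a gap is missed. *)
Let N_gap : ~ (N = setT).
Proof.
move=> NT; have [f0 [i Fi]] : exists x, D x.
  have [f Ff] := frontier_neq0 V; exists (repr f); exists 0.
  by rewrite mulr0z addr0 toS1K.
set x := f0; have Dx : D x by exists i.
have lt := right_limit_D HJ Dx; pose y := (J x + Jp x) / 2.
have [s Ks sy] : N (toS1 y) by rewrite NT.
have [x' _ x'y] := psi_lift sy.
have x'x : x' = x.
  apply: (blowup_decomp_uniq HJ (lift_bounds s x')).
  by rewrite x'y /y; apply/andP; split; lra.
by move: x'y; rewrite x'x /lift /y; case: ifP => _; lra.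
Qed.

Lemma coding_closure_denjoy : denjoy_minimal_set (coding_closure V a) full_shift alpha.
Proof.
have G_lift : is_lift g G.
  split; [exact: (denjoy_lift_continuous HJ D_shift)|exact: (denjoy_lift_lt HJ D_shift)| |].
    exact: G1.
  by move=> x; rewrite circle_mapE.
have G_rot : rotation_number g alpha.
  by exists G => // x; exact: (denjoy_lift_rotation HJ D_shift).
have [s0 Ks0] := coding_closure_neq0 alpha V.
exists g, N; split => //.
- split; last 1 first.
  (* If every orbit were dense, the closed set [N], invariant under [g] and its inverse, would be
     the whole circle. *)
  + move=> gmin; apply: N_gap; apply/seteqP; split => // z _.
    have N0 : N (psi s0) by exists s0.
    have : closure N z; last by rewrite -((closure_id _).1 N_closed).
    apply: closureS (gmin (psi s0) I z I) => w [_ [n [<-|wE]]].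
      by elim: n => [//|n IH]; rewrite iterS; exact: N_g.
    by elim: n w wE => [w /= ->//|n IH w]; rewrite iterSr => /IH/N_gN.
  + exists (circle_map (denjoy_lift J (- alpha))).
    by split=> //; [split=> z _; [exact: gK|exact: gNK]|
      apply: continuous_subspaceT; exact: g_continuous|
      apply: continuous_subspaceT; exact: gN_continuous].
  + by exists G.
  + by exists alpha.
- split; [by exists (psi s0), s0| |exact: N_minimal].
  split; first exact: N_compact.
  exists (circle_map (denjoy_lift J (- alpha))); split.
  + exact: N_g.
  + by move=> z Nz; apply: N_gN; rewrite gNK.
  + by split=> z _; [exact: gK|exact: gNK].
  + by apply: continuous_subspaceT; exact: g_continuous.
  + by apply: continuous_subspaceT; exact: gN_continuous.
- exists psi; last by move=> s /set_mem; exact: psi_shift.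
  apply: compact_homeo_on => //; [exact: circle_hausdorff|exact: coding_closure_compact].
Qed.

End denjoy_conjugacy.

(** * Periodic sequences and rational rotations *)

Section periodic_sequences.
Context (q : nat) (q0 : (0 < q)%N).
Implicit Types (s : Sigma2).

Definition periodic_seqs : set Sigma2 := [set s | shiftz q s = s].

Lemma periodic_shiftz s k : periodic_seqs s -> periodic_seqs (shiftz k s).
Proof. by move=> sq; rewrite /periodic_seqs /= shiftzD addrC -shiftzD sq. Qed.

Lemma periodic_mul s (m : int) : periodic_seqs s -> shiftz (q%:Z * m) s = s.
Proof.
move=> sq; have H n : shiftz (q%:Z * n%:Z) s = s.
  by elim: n => [|n IH]; rewrite ?mulr0 ?shiftz0 // intS mulrDr mulr1 -shiftzD IH.
case: m => n; first exact: H.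
by rewrite NegzE mulrN -{1}(H n.+1) shiftzD addNr shiftz0.
Qed.

Lemma periodic_eqmod s (i j : int) : periodic_seqs s -> (i = j %[mod q])%Z -> s i = s j.
Proof.
move=> sq ij; have per k : s (k %% q)%Z = s k.
  by rewrite [in RHS](divz_eq k q) addrC mulrC -[LHS](congr1 (@^~ _) (periodic_mul (k %/ q)%Z sq)).
by rewrite -per ij per.
Qed.

Definition word : finType := {ffun 'I_q -> bool}.

Let modP (i : int) : (`|(i %% q)%Z| < q)%N.
Proof. by rewrite -ltz_nat gez0_abs ?modz_ge0 ?ltz_pmod //; lia. Qed.

Definition word_seq (w : word) : Sigma2 := fun i => w (Ordinal (modP i)).

Lemma word_seq_periodic w : periodic_seqs (word_seq w).
Proof.
apply/funext => i; rewrite /shiftz /word_seq; congr (w _); apply: val_inj => /=.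
by rewrite modzDr.
Qed.

Lemma periodic_word_seq s : periodic_seqs s -> exists w, word_seq w = s.
Proof.
move=> sq; exists [ffun j : 'I_q => s (val j : nat)]; apply/funext => i.
rewrite /word_seq ffunE /=; apply: periodic_eqmod => //.
by rewrite gez0_abs ?modz_ge0 ?modz_mod //; lia.
Qed.

Lemma word_seq_inj : injective word_seq.
Proof.
move=> w w' E; apply/ffunP => j; have := congr1 (@^~ (val j : int)) E.
rewrite /word_seq; have -> : Ordinal (modP (val j)) = j => //.
by apply: val_inj => /=; rewrite modz_small //; have := ltn_ord j; lia.
Qed.

Definition nth_seq (l : 'I_#|word|) : Sigma2 := word_seq (enum_val l).

Lemma nth_seq_inj : injective nth_seq.
Proof. by move=> l l' /word_seq_inj/enum_val_inj. Qed.

Lemma periodic_nth_seq s : periodic_seqs s <-> exists l, nth_seq l = s.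
Proof.
split=> [/periodic_word_seq[w <-]|[l <-]]; last exact: word_seq_periodic.
by exists (enum_rank w); rewrite /nth_seq enum_rankK.
Qed.

Lemma periodic_seqs_finite : finite_set periodic_seqs.
Proof.
have -> : periodic_seqs = nth_seq @` setT.
  apply/seteqP; split=> [s /periodic_nth_seq[l <-]|_ [l _ <-]]; first by exists l.
  exact: word_seq_periodic.
by apply: finite_image; exact: finite_finset.
Qed.

Lemma Sigma2_finite_closed (A : set Sigma2) : finite_set A -> closed A.
Proof. exact: (accessible_finite_set_closed.1 (hausdorff_accessible Sigma2_hausdorff)). Qed.

Lemma periodic_minimal_period s : periodic_seqs s ->
  exists2 k, minimal_period full_shift s k & (k %| q)%N.
Proof.
move=> sq; pose P k := (0 < k)%N && `[< shiftz k s = s >].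
have exP : exists k, P k by exists q; rewrite /P q0; apply/asboolP.
case: (ex_minnP exP) => k /andP[k0 /asboolP sk] kmin.
exists k.
  split=> //; first by rewrite iter_full_shift.
  move=> j /andP[j0 jk]; rewrite iter_full_shift => sj.
  by have := kmin j; rewrite /P j0 (asboolT sj) leqNgt jk => /(_ isT).
rewrite /dvdn; apply/eqP; case: (posnP (q %% k)) => // m0.
have smod : shiftz (q %% k)%N s = s.
  have kn n : shiftz (k * n)%N s = s.
    by elim: n => [|n IH]; rewrite ?muln0 ?shiftz0 // mulnS PoszD -shiftzD IH.
  have := sq; rewrite /periodic_seqs /= {1}(divn_eq q k) mulnC PoszD addrC -shiftzD kn.
  exact.
have := kmin (q %% k)%N; rewrite /P m0 (asboolT smod) => /(_ isT).
by rewrite leqNgt ltn_mod k0.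
Qed.

Lemma minimal_period_periodic s k : minimal_period full_shift s k -> (k %| q)%N ->
  periodic_seqs s.
Proof.
move=> [k0 sk _] /dvdnP[m qE]; rewrite iter_full_shift in sk.
rewrite /periodic_seqs /= qE; elim: m {qE} => [|m IH]; first by rewrite mul0n shiftz0.
by rewrite mulSn PoszD addrC -shiftzD sk.
Qed.

Lemma orbit_periodic s : periodic_seqs s ->
  dyn_orbit setT full_shift s `<=` periodic_seqs.
Proof.
move=> sq y [_ [n [<-|yE]]]; first by rewrite iter_full_shift; exact: periodic_shiftz.
have -> : y = shiftz (- n%:Z) s by rewrite -yE iter_full_shift shiftzD addNr shiftz0.
exact: periodic_shiftz.
Qed.

End periodic_sequences.

Section rational_rotation.
Context {R : realType} (q : nat) (q0 : (0 < q)%N) (r : circle R) (rq : r *+ q = 0).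

Lemma coding_periodic (U : set (circle R)) x : periodic_seqs q (coding U r x).
Proof.
apply/funext => i; rewrite /shiftz /coding; congr `[< U (_ + _) >].
by rewrite mulrzDr -[r *~ q]pmulrn rq addr0.
Qed.

Lemma coding_closure_periodic (U : set (circle R)) :
  coding_closure U r `<=` periodic_seqs q.
Proof.
have /closure_id cE := Sigma2_finite_closed (periodic_seqs_finite q0).
by rewrite [X in _ `<=` X]cE; apply: closureS => _ [x _ <-]; exact: coding_periodic.
Qed.

Lemma coding_closure_orbits (U : set (circle R)) : exists X : set Sigma2,
  [/\ finite_set X,
      forall s, X s -> exists2 k, minimal_period full_shift s k & (k %| q)%N &
      hyper_set (coding_closure U r) = \bigcup_(s in X) dyn_orbit setT full_shift s].
Proof.
(* Every point serves as a representative of its own orbit; the set is finite and shift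
   invariant. *)
exists (hyper_set (coding_closure U r)); split.
- exact: sub_finite_set (@coding_closure_periodic U) (periodic_seqs_finite q0).
- by move=> s /coding_closure_periodic; exact: periodic_minimal_period.
- apply/seteqP; split=> [s Us|y [s Us [_ [n [<-|yE]]]]].
  + by exists s => //; split => //; exists 0%N; left.
  + by rewrite iter_full_shift; exact: coding_closure_shiftz.
  + have -> : y = shiftz (- n%:Z) s by rewrite -yE iter_full_shift shiftzD addNr shiftz0.
    exact: coding_closure_shiftz.
Qed.

End rational_rotation.

Section orbit_measures.
Context {R : realType} (q : nat) (s : Sigma2).

(* The index is shifted so that the number q.+1 of points averaged is nonzero. *)
Definition orbit_measure : set (Borel Sigma2) -> \bar R :=
  mscale (NngNum (ltW (ltr0Sn R q) : 0 <= q.+1%:R :> R))%:num^-1%:nng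
    (msum (fun j => dirac (iter j full_shift s : Borel Sigma2)) q.+1).

HB.instance Definition _ := Measure.on orbit_measure.

Lemma orbit_measureE A :
  orbit_measure A = (q.+1%:R^-1%:E * \sum_(j < q.+1) \d_(iter j full_shift s : Borel Sigma2) A)%E.
Proof. by []. Qed.

Let orbit_measure_setT : orbit_measure setT = 1%E.
Proof.
rewrite orbit_measureE (eq_bigr (fun=> 1%:E)); last by move=> j _; rewrite diracT.
by rewrite sumEFin sumr_const card_ord -EFinM mulVf.
Qed.

HB.instance Definition _ :=
  Measure_isProbability.Build _ (Borel Sigma2) R orbit_measure orbit_measure_setT.

End orbit_measures.

Section convex_hulls.
Context {R : realType} (q' : nat).
Local Notation q := q'.+1.
Local Notation P := (periodic_seqs q).
Local Notation sq := (nth_seq (ltn0Sn q')).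
Implicit Types (mu : probability (Borel Sigma2) R).
Local Open Scope ereal_scope.

Let finite_measurable (A : set Sigma2) : finite_set A -> measurable (A : set (Borel Sigma2)).
Proof. by move=> fA; apply: measurable_closed; exact: Sigma2_finite_closed. Qed.

Lemma measurable_periodic_seqs : measurable (P : set (Borel Sigma2)).
Proof. exact: finite_measurable (periodic_seqs_finite _). Qed.

Lemma periodic_decomp mu (A : set (Borel Sigma2)) : mu P = 1 -> measurable A ->
  mu A = \sum_(l < #|word q|) mu [set sq l] * \d_(sq l : Borel Sigma2) A.
Proof.
move=> P1 mA; rewrite -(probability_setI1 measurable_periodic_seqs mA P1).
pose F (l : 'I_#|word q|) : set (Borel Sigma2) := A `&` [set sq l].
have m1 (l : 'I_#|word q|) : measurable ([set sq l] : set (Borel Sigma2)).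
  exact: finite_measurable.
have -> : P `&` A = \big[setU/set0]_(l in 'I_#|word q|) F l.
  rewrite -bigcup_pred; apply/seteqP.
  split=> [s [/(periodic_nth_seq (ltn0Sn q'))[l <-] As]|s [l _ [As sE]]].
    by exists l.
  by split=> //; apply/(periodic_nth_seq (ltn0Sn q')); exists l.
rewrite measure_bigsetU_ord; first last.
- by apply/trivIsetP => l l' _ _ ll'; apply/seteqP; split => // s [[_ ->] [_]]
    /nth_seq_inj; move/eqP: ll'.
- by move=> l; apply: measurableI.
apply: eq_big => // l _; rewrite /F diracE; case: (boolP (_ \in A)) => [/set_mem Al|nAl].
  by rewrite mule1; congr (mu _); apply/seteqP; split=> [s [_ ->]//|s ->].
rewrite mule0 (_ : _ `&` _ = set0) ?measure0 //.
by apply/seteqP; split => // s [As sE]; move: nAl; rewrite notin_setE -sE; apply.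
Qed.

End convex_hulls.

Section finite_unions.
Context d (T : measurableType d) (R : realType) (mu : {measure set T -> \bar R}).

Lemma measure_finType_bigcup (I : finType) (F : I -> set T) :
  (forall i, measurable (F i)) -> trivIset setT F ->
  mu (\bigcup_i F i) = (\sum_(i : I) mu (F i))%E.
Proof.
move=> mF tF; rewrite measure_fin_bigcup //; last exact: finite_finset.
have IE : [set` index_enum I] = [set: I].
  by apply/seteqP; split => // i _; rewrite /= mem_index_enum.
by rewrite [RHS]fsbig_seq ?index_enum_uniq // IE.
Qed.

End finite_unions.

Section periodic_hull.
Context {R : realType} (q' : nat).
Local Notation q := q'.+1.
Local Notation P := (periodic_seqs q).
Local Notation sq := (nth_seq (ltn0Sn q')).
Implicit Types (mu : shift_invariant R) (s : Sigma2).
Local Open Scope ereal_scope.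

Lemma orbit_measure_shift s (A : set (Borel Sigma2)) : P s ->
  @orbit_measure R q' s (full_shift @^-1` A) = orbit_measure q' s A.
Proof.
move=> Ps; rewrite !orbit_measureE; congr (_ * _).
(* The shift permutes the averaged points cyclically: the last one returns to [s]. *)
rewrite big_ord_recr big_ord_recl /= addeC; congr (_ + _).
  rewrite !diracE; congr (_%:R%:E); congr nat_of_bool.
  have E : full_shift (iter q' full_shift s) = s by rewrite -iterS iter_full_shift; exact: Ps.
  by apply/idP/idP => /set_mem /= H; rewrite mem_set //=; move: H; rewrite E.
Qed.

Let orbit_measureP (l : 'I_#|word q|) : shift_invariant R :=
  MkInvProb (inv_prob := orbit_measure q' (sq l))
    (fun A _ => orbit_measure_shift A (word_seq_periodic (ltn0Sn q') (enum_val l))).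

Lemma orbit_measure_orbit s : @orbit_measure R q' s (dyn_orbit setT full_shift s) = 1.
Proof.
rewrite orbit_measureE (eq_bigr (fun=> 1%:E)); last first.
  by move=> j _; rewrite diracE mem_set //; split => //; exists j; left.
by rewrite sumEFin sumr_const card_ord -EFinM mulVf.
Qed.

Let weight mu l : R := fine (mu [set sq l]).

Let weightE mu l : mu [set sq l] = (weight mu l)%:E.
Proof.
rewrite fineK // fin_num_measure //; apply: measurable_closed.
exact: Sigma2_finite_closed.
Qed.

Let weight_ge0 mu l : (0 <= weight mu l)%R.
Proof. exact/fine_ge0/measure_ge0. Qed.

Lemma invariant_shift mu k (A : set (Borel Sigma2)) : measurable A ->
  measurable (iter k full_shift @^-1` A : set (Borel Sigma2)) /\
  mu (iter k full_shift @^-1` A) = mu A.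
Proof.
move=> mA; elim: k => [//|k [mk IH]].
have -> : iter k.+1 full_shift @^-1` A = full_shift @^-1` (iter k full_shift @^-1` A).
  by apply/funext => s /=; rewrite -iterSr.
by split; [exact: measurable_full_shift|rewrite inv_probP].
Qed.

(** Invariance allows all atoms to be moved [k] steps; averaging over [k] then replaces each atom by
    an orbit measure. *)
Lemma periodic_decomp_shift mu k (A : set (Borel Sigma2)) : mu P = 1 -> measurable A ->
  mu A = \sum_(l < #|word q|) (weight mu l)%:E * \d_(iter k full_shift (sq l) : Borel Sigma2) A.
Proof.
move=> P1 mA; have [mk <-] := invariant_shift mu k mA.
rewrite (periodic_decomp P1 mk); apply: eq_bigr => l _; rewrite weightE !diracE.
by congr (_ * _%:R%:E); congr nat_of_bool; apply/idP/idP => /set_mem H; rewrite mem_set.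
Qed.

Lemma sum_weight mu : mu P = 1 -> (\sum_(l < #|word q|) weight mu l = 1)%R.
Proof.
move=> P1; have := periodic_decomp_shift 0 P1 (@measurableT _ (Borel Sigma2)).
rewrite probability_setT (eq_bigr (fun l => (weight mu l)%:E)); last first.
  by move=> l _; rewrite diracE mem_set // mule1.
by rewrite sumEFin => -[<-].
Qed.

(** The combination is indexed by periodic sequences rather than by orbits: an orbit measure occurs
    once for each point of its orbit, weighted by the mass of that point. *)
Lemma convex_hull_periodicP mu : convex_hull (periodic_measures q) mu <-> mu P = 1.
Proof.
have mP : measurable (P : set (Borel Sigma2)) by exact: measurable_periodic_seqs.
split=> [[n [c [nu [c0 c1 Enu muE]]]]|P1].
  rewrite muE // (eq_bigr (fun i => (c i)%:E)); first by rewrite sumEFin c1.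
  move=> i _; have [s [k [sk kq nu1]]] := Enu i.
  have Ps : P s by exact: minimal_period_periodic sk kq.
  suff -> : nu i P = 1 by rewrite mule1.
  apply/eqP; rewrite eq_le probability_le1 //= -nu1; apply: le_measure; rewrite ?inE //.
    apply: measurable_closed; apply: Sigma2_finite_closed.
    exact: sub_finite_set (orbit_periodic Ps) (periodic_seqs_finite _).
  exact: orbit_periodic.
exists #|word q|, (weight mu), orbit_measureP; split.
- exact: weight_ge0.
- exact: sum_weight.
- move=> l; have [k sk kq] := periodic_minimal_period (ltn0Sn q')
    (word_seq_periodic (ltn0Sn q') (enum_val l)).
  by exists (sq l), k; split => //; exact: orbit_measure_orbit.
- move=> A mA; transitivity (\sum_(l < #|word q|) \sum_(j < q)
      (weight mu l)%:E * ((q%:R^-1)%:E * \d_(iter j full_shift (sq l) : Borel Sigma2) A)).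
    rewrite exchange_big /= -[LHS]mul1e.
    have -> : 1 = \sum_(j < q) (q%:R^-1)%:E :> \bar R.
      have E : (q%:R^-1 *+ q = 1 :> R)%R by rewrite -[LHS]mulr_natr mulVf.
      by rewrite sumEFin sumr_const card_ord E.
    rewrite ge0_sume_distrl //; apply: eq_bigr => j _.
    rewrite (periodic_decomp_shift j P1 mA) ge0_sume_distrr //.
      by apply: eq_bigr => l _; rewrite muleCA.
    by move=> l _; rewrite mule_ge0 // lee_fin.
  apply: eq_bigr => l _; rewrite -ge0_sume_distrr //; last by move=> j _; rewrite mule_ge0.
  by rewrite -ge0_sume_distrr.
Qed.

End periodic_hull.

Section regularization.
Context {R : realType} (U0 U1 : set (circle R)).
Context (oU0 : open U0) (oU1 : open U1) (U0N : U0 !=set0) (U1N : U1 !=set0).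
Context (disj : U0 `&` U1 = set0) (full : haar (U0 `|` U1) = 1%E).

Let U := interior (closure U0).

Let U0U : U0 `<=` U.
Proof. by rewrite -open_subsetE //; exact: subset_closure. Qed.

Let UU1 x : U1 x -> ~ closure U x.
Proof.
move=> U1x clU; have [y [Uy U1y]] := clU _ (open_nbhs_nbhs (conj oU1 U1x)).
have [z [U0z U1z]] := interior_subset Uy _ (open_nbhs_nbhs (conj oU1 U1y)).
by have : (U0 `&` U1) z by []; rewrite disj.
Qed.

(** A union of arcs need not be regular, as adjacent arcs omit common endpoints. The interior of the
    closure fills these in without meeting [U1], and its frontier lies in the null complement of
    [U0] and [U1]. *)
Lemma regularization : exists V : RO0 R,
  U0 `<=` RO_set V /\ forall x, U1 x -> ~ RO_set V x.
Proof.
have roU : is_regular_open U.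
  split.
  - by have [x U0x] := U0N; exists x; exact: U0U.
  - apply/eqP => UT; have [x U1x] := U1N; apply: (UU1 U1x).
    by apply: subset_closure; rewrite UT.
  - exact: interior_closure_idem.
have fU : haar (frontier U) = 0%E.
  have mUU : measurable (U0 `|` U1 : set (Borel (circle R))).
    by apply: measurableU; exact: measurable_open.
  apply: (@subset_measure0 _ _ _ haar _ (~` (U0 `|` U1))).
  - by apply: measurable_closed; exact: frontier_closed.
  - exact: measurableC.
  - move=> x [clU nU] [U0x|/UU1//]; apply: nU.
    by rewrite ((interior_id U).1 (@open_interior _ _)); exact: U0U.
  - by apply: (etrans (probability_setC haar mUU)); rewrite [X in (_ - X)%E]full subee.
exists (MkRO0 (fU : haar (frontier (MkRO roU)) = 0%E)); split => //.
by move=> x /UU1 + Ux; apply; exact: subset_closure.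
Qed.

End regularization.

(** * Realization of periodic measures by unions of arcs *)

Section realization.
Context {R : realType} (q' : nat) (p : int).
Local Notation q := q'.+1.
Context (pq : coprime `|p| q).
Local Notation P := (periodic_seqs q).
Local Notation K := #|word q|.
Local Notation sq := (nth_seq (ltn0Sn q')).
Local Notation r := (toS1 (p%:~R / q%:R : R)).

Lemma rational_angle : r *+ q = 0.
Proof. by rewrite -toS1Mn -[_ *+ q]mulr_natr divfK // toS1_int. Qed.

Let inverse_mod : exists u : nat, (p * u%:Z = 1 %[mod q])%Z.
Proof.
have [u [v uv]] := Bezoutz p q; exists `|(u %% q)%Z|%N.
rewrite gez0_abs ?modz_ge0 // modzMmr mulrC.
have -> : u * p = 1 - v * q.
  have -> : 1 = gcdz p q by rewrite /gcdz absz_nat; move/eqP: pq => ->.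
  by rewrite -uv addrK.
by rewrite addrC -mulNr modzMDl.
Qed.

Context (c : 'I_K -> R) (c0 : forall l, 0 <= c l) (c1 : \sum_l c l = 1).

Let S (n : nat) : R := \sum_(l < K | (l < n)%N) c l.

Let S_le m n : (m <= n)%N -> S m <= S n.
Proof.
move=> mn; rewrite /S [leRHS](bigID (fun l : 'I_K => (l < m)%N)) /=.
rewrite [X in _ <= X + _](eq_bigl (fun l : 'I_K => (l < m)%N)); last first.
  by move=> l; rewrite andb_idl // => lm; exact: leq_trans mn.
by rewrite lerDl sumr_ge0.
Qed.

Let S_succ (l : 'I_K) : S l.+1 = S l + c l.
Proof.
rewrite /S (bigD1 l) //= addrC; congr (_ + _); apply: eq_bigl => l'.
by rewrite ltnS leq_eqVlt -val_eqE /=; case: ltngtP.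
Qed.

Let S_bounds (l : 'I_K) : 0 <= S l /\ S l + c l <= 1.
Proof.
split; first exact: sumr_ge0.
rewrite -S_succ; apply: (le_trans (S_le (ltn_ord l))).
by rewrite /S (eq_bigl xpredT) ?c1 // => l'; exact: ltn_ord.
Qed.

(* The points of the cell (l, k) will be coded by the l-th periodic sequence, shifted
   by k * u where u is an inverse of p modulo q. *)
Let cell (i : 'I_K * 'I_q) : set R :=
  `](i.2%:R + S i.1) / q%:R, (i.2%:R + S i.1 + c i.1) / q%:R[%classic.

Let arc i : set (circle R) := toS1 @` cell i.

Let cellP i y : cell i y <-> i.2%:R + S i.1 < y * q%:R < i.2%:R + S i.1 + c i.1.
Proof. by rewrite /cell /= in_itv /= ltr_pdivrMr // ltr_pdivlMr. Qed.

Let cell01 i y : cell i y -> 0 <= y < 1.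
Proof.
move=> /cellP /andP[lo hi]; have [S0 S1] := S_bounds i.1.
have kq : i.2%:R + 1 <= q%:R :> R by rewrite natr1 ler_nat ltn_ord.
have k0 : 0 <= i.2%:R :> R by [].
have q0 : 0 < q%:R :> R by rewrite ltr0n.
by apply/andP; split; nra.
Qed.

Let toS1_inj01 x y : 0 <= x < 1 -> 0 <= y < 1 -> toS1 x = toS1 y :> circle R -> x = y.
Proof.
move=> /andP[x0 x1] /andP[y0 y1] /toS1_eq[m xy]; apply/eqP; rewrite -subr_eq0 xy intr_eq0.
have : (-1)%:~R < m%:~R :> R /\ m%:~R < 1%:~R :> R by rewrite -xy; split; rewrite ?mulrNz; lra.
by rewrite !ltr_int => -[? ?]; lia.
Qed.

Let arc_open i : open (arc i).
Proof. by apply: open_toS1_image; exact: interval_open. Qed.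

Let arc_measurable i : measurable (arc i : set (Borel (circle R))).
Proof. exact: measurable_open. Qed.

Let haar_arc i : haar (arc i) = (c i.1 / q%:R)%:E.
Proof.
have -> : haar (arc i) = lebesgue_measure (cell i).
  congr lebesgue_measure; apply/seteqP; split=> [y [y01 [z cz zy]]|y cy].
    by rewrite -(toS1_inj01 (cell01 cz) _ zy).
  by split; [rewrite /= in_itv; exact: (cell01 cy)|exists y].
have q0 : 0 < q%:R :> R by rewrite ltr0n.
rewrite lebesgue_measure_itv /= lte_fin ltr_pM2r ?invr_gt0 // ltrDl.
case: ifPn => [_|]; first by rewrite -EFinB -mulrBl addrAC subrr add0r.
by rewrite -leNgt => cle0; rewrite (_ : c i.1 = 0) ?mul0r //; apply: le_anti; rewrite cle0 c0.
Qed.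

Let arc_disjoint : trivIset setT arc.
Proof.
apply/trivIsetP => i j _ _ ij; apply/seteqP; split => // _ [[y cy <-] [z cz zy]].
move/eqP: ij; apply; move: (cell01 cz) (cell01 cy) => z01 y01.
have {zy}zy := toS1_inj01 z01 y01 zy; subst z.
move/cellP: cy => /andP[lo hi]; move/cellP: cz => /andP[lo' hi'].
have [Si0 Si1] := S_bounds i.1; have [Sj0 Sj1] := S_bounds j.1.
have k_eq : i.2 = j.2.
  apply: val_inj; apply/eqP; rewrite eqn_leq.
  by apply/andP; split; rewrite -ltnS -(ltr_nat R) -natr1; lra.
rewrite (surjective_pairing i) (surjective_pairing j) k_eq; congr (_, _).
rewrite k_eq in lo hi; apply: val_inj; apply/eqP; rewrite eqn_leq.
by apply/andP; split; rewrite leqNgt; apply/negP => /S_le; rewrite S_succ; lra.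
Qed.

Let arcs_full : haar (\bigcup_i arc i) = 1%E.
Proof.
rewrite (measure_finType_bigcup haar arc_measurable arc_disjoint).
rewrite (eq_bigr (fun i : 'I_K * 'I_q => (c i.1 / q%:R)%:E)) => [|i _]; last exact: haar_arc.
rewrite -(pair_bigA _ (fun l (_ : 'I_q) => (c l / q%:R)%:E)) /=.
rewrite (eq_bigr (fun l => (c l)%:E)) => [|l _]; first by rewrite sumEFin c1.
by rewrite sumEFin sumr_const card_ord -[_ *+ q]mulr_natr divfK.
Qed.

(** The rotation sends the k-th block of arcs to the (k + p)-th, so with [p * u = 1] modulo [q] the
    index [k * u] of the symbol advances by one. *)
Let half (u : nat) b : set (circle R) :=
  \bigcup_(i in [set i : 'I_K * 'I_q | sq i.1 (i.2%:Z * u%:Z) = b]) arc i.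

Let half_open u b : open (half u b).
Proof. by apply: bigcup_open => i _; exact: arc_open. Qed.

Let halves_disjoint u : half u true `&` half u false = set0.
Proof.
apply/seteqP; split => // x [[i it ix] [j jf jx]].
have [ij|/eqP ij] := pselect (i = j); first by move: it jf; rewrite /= ij => ->.
by move/trivIsetP: arc_disjoint => /(_ i j I I ij) /seteqP[+ _]; apply; split; [exact: ix|].
Qed.

Let halves_full u : half u true `|` half u false = \bigcup_i arc i.
Proof.
apply/seteqP; split=> [x [[i _ ix]|[i _ ix]]|x [i _ ix]]; try by exists i.
by case E : (sq i.1 (i.2%:Z * u%:Z)); [left|right]; exists i.
Qed.

Let arc_rotate (i : 'I_K * 'I_q) x (m : int) : arc i x ->
  exists k : 'I_q, (k = i.2%:Z + m * p %[mod q])%Z /\ arc (i.1, k) (x + r *~ m).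
Proof.
move=> [y cy <-]; pose e := i.2%:Z + m * p.
have kq : (`|(e %% q)%Z| < q)%N by rewrite -ltz_nat gez0_abs ?modz_ge0 ?ltz_pmod.
have kE : `|(e %% q)%Z|%:Z = (e %% q)%Z by rewrite gez0_abs ?modz_ge0.
exists (Ordinal kq); split; first by rewrite /= kE modz_mod.
exists (y + (`|(e %% q)%Z|%:R - i.2%:R) / q%:R).
  move/cellP: cy => cy; apply/cellP; rewrite mulrDl divfK //=.
  by move: cy => /andP[? ?]; apply/andP; split; lra.
rewrite -toS1Mz -toS1D; apply/toS1_eq; exists (- (e %/ q)%Z).
have -> : `|(e %% q)%Z|%:R = (i.2%:R + m%:~R * p%:~R - (e %/ q)%Z%:~R * q%:R) :> R.
  have eE : (e %% q)%Z = e - (e %/ q)%Z * q%:Z.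
    by apply/eqP; rewrite eq_sym subr_eq addrC -divz_eq.
  rewrite pmulrn kE eE /e !(intrD, intrM, mulrNz) -!pmulrn; ring.
by rewrite -mulrzr mulrNz; field; rewrite nat1r pnatr_eq0.
Qed.

Context (nontrivial : forall b, exists l (j : int), 0 < c l /\ sq l j = b).

(** The nontriviality hypothesis makes both halves nonempty, as [regularization] requires. The arcs
    have full measure, and on each of them the coding is constant. *)
Lemma realization : exists (V : RO0 R) (u : nat),
  forall A : set (Borel Sigma2), measurable A ->
  coding_measure V r A = (\sum_(l < K) \sum_(k < q)
    (c l / q%:R)%:E * \d_(iter (k * u) full_shift (sq l) : Borel Sigma2) A)%E.
Proof.
have [u pu] := inverse_mod; have seqP l := word_seq_periodic (ltn0Sn q') (enum_val l).
have eqmod l i j : (i = j %[mod q])%Z -> sq l i = sq l j.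
  by apply: periodic_eqmod; exact: seqP.
have half_neq0 b : half u b !=set0.
  (* Block [j * p] modulo [q] is the one whose symbol has index [j]. *)
  have [l [j [cl0 slj]]] := nontrivial b; pose e := j * p.
  have kq : (`|(e %% q)%Z| < q)%N by rewrite -ltz_nat gez0_abs ?modz_ge0 ?ltz_pmod.
  have kE : `|(e %% q)%Z|%:Z = (e %% q)%Z by rewrite gez0_abs ?modz_ge0.
  pose i := (l, Ordinal kq) : 'I_K * 'I_q.
  exists (toS1 ((i.2%:R + S l + c l / 2) / q%:R)); exists i.
    rewrite /= kE -slj; apply: eqmod.
    by rewrite modzMml -mulrA -modzMmr pu modzMmr mulr1.
  exists ((i.2%:R + S l + c l / 2) / q%:R) => //; apply/cellP.
  by rewrite divfK //=; apply/andP; split; lra.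
have [|V [V1 V0]] := regularization (@half_open u true) (@half_open u false)
  (half_neq0 true) (half_neq0 false) (halves_disjoint u).
  by rewrite halves_full arcs_full.
have VE b x : half u b x -> `[< RO_set V x >] = b.
  by case: b => [/V1 ?|/V0 ?]; [rewrite asboolT|rewrite asboolF].
have codingE (i : 'I_K * 'I_q) x : arc i x -> coding V r x = iter (i.2 * u) full_shift (sq i.1).
  move=> ix; rewrite iter_full_shift; apply/funext => m.
  have [k [ke kx]] := arc_rotate m ix; rewrite /coding /shiftz.
  rewrite (VE (sq i.1 (k%:Z * u%:Z))); last by exists (i.1, k).
  have mpu : (m * (p * u%:Z) = m %[mod q])%Z by rewrite -modzMmr pu modzMmr mulr1.
  apply: eqmod; rewrite -modzMml ke modzMml mulrDl -[m * p * _]mulrA -[LHS]modzDmr mpu modzDmr.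
  by rewrite addrC PoszM.
exists V, u => A mA; have mU : measurable (\bigcup_i arc i : set (Borel (circle R))).
  by apply: measurable_open; apply: bigcup_open => i _; exact: arc_open.
have mB := measurable_codingB V r; have mBA := measurable_coding V r mA.
rewrite /coding_measure -(probability_setI1 mU mBA arcs_full) setI_bigcupl.
rewrite measure_finType_bigcup; last 2 first.
- by move=> i; exact: measurableI.
- exact: trivIset_setIr.
rewrite pair_bigA /=; apply: eq_bigr => i _; rewrite -haar_arc diracE.
case: (boolP (_ \in A)) => [/set_mem Ai|nAi].
  rewrite mule1 -(probability_setI1 mB (arc_measurable i) (haar_codingB V r)).
  congr haar; apply/seteqP; split=> x; first by move=> [ix [Bx _]].
  by move=> [Bx ix]; split => //; split => //=; rewrite (codingE i).
rewrite mule0 (_ : _ `&` _ = set0) ?measure0 //; apply/seteqP; split => // x [ix [_ /=]].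
by rewrite (codingE i x ix) => Ax; move: nAi; rewrite notin_setE; apply.
Qed.

End realization.

Section rational_image.
Context {R : realType} (q' : nat) (p : int).
Local Notation q := q'.+1.
Context (pq : coprime `|p| q).
Local Notation P := (periodic_seqs q).
Local Notation sq := (nth_seq (ltn0Sn q')).
Local Notation r := (toS1 (p%:~R / q%:R : R)).
Local Open Scope ereal_scope.

Let rq : (r *+ q = 0)%R. Proof. exact: rational_angle. Qed.

Lemma haar_RO_lt1 (V : RO R) : haar (RO_set V) < 1.
Proof.
have mV : measurable (RO_set V : set (Borel (circle R))).
  by apply: measurable_open; exact: RO_open.
have mE : measurable (ext_part V : set (Borel (circle R))).
  by apply: measurable_open; exact: open_interior.
have e0 := haar_open_gt0 (@open_interior _ _) (ext_part_neq0 V).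
have : haar (RO_set V) + haar (ext_part V) <= 1.
  rewrite -measureU //; first exact: probability_le1 (measurableU _ _ mV mE).
  by apply/seteqP; split => // x [Vx /interior_subset].
by move=> le1; apply: lt_le_trans le1; rewrite lteDl // haar_fin_num.
Qed.

Lemma lambda_not_fixed (V : RO0 R) b : coding_measure V r [set fun=> b] <> 1.
Proof.
have sub : codingB V r `&` coding V r @^-1` [set fun=> b] `<=` [set x | `[< RO_set V x >] = b].
  move=> x [_ /= bE]; have := congr1 (fun s : Sigma2 => s 0%R) bE.
  by rewrite /coding mulr0z addr0.
have mb : measurable (codingB V r `&` coding V r @^-1` [set fun=> b] : set (Borel (circle R))).
  by apply: measurable_coding; apply: measurable_closed; exact: Sigma2_finite_closed.
have mV : measurable (RO_set V : set (Borel (circle R))).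
  by apply: measurable_open; exact: RO_open.
rewrite /coding_measure => b1; case: b {mb} b1 sub (mb) => b1 sub mb.
  suff : haar (RO_set V) >= 1 by rewrite leNgt haar_RO_lt1.
  rewrite -b1; apply: le_measure; rewrite ?inE //.
  by move=> x /sub /asboolP.
have V0 := haar_open_gt0 (@RO_open _ V) (RO_neq0 V).
have : 1 <= haar (~` RO_set V).
  rewrite -b1; apply: le_measure; rewrite ?inE //; first exact: measurableC.
  by move=> x /sub /asboolPn.
rewrite (probability_setC haar mV) leNgt => /negP; apply.
have hV : haar (RO_set V) = (fine (haar (RO_set V)))%:E by rewrite fineK ?haar_fin_num.
rewrite [X in 1 - X < 1]hV -EFinB lte_fin ltrBlDr ltrDl -lte_fin.
by move: V0; rewrite hV.
Qed.

Lemma lambda_rational_image :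
  [set mu : shift_invariant R | exists U : RO0' R, eq_on_Borel (lambda (U, r)) mu] =
  convex_hull (periodic_measures q) `\` @fixed_point_measures R.
Proof.
have mP : measurable (P : set (Borel Sigma2)) by exact: measurable_periodic_seqs.
apply/seteqP; split=> mu.
  move=> [U Umu]; split.
    apply/convex_hull_periodicP; rewrite -(Umu _ mP) /= /coding_measure.
    rewrite (_ : coding _ _ @^-1` P = setT); first by rewrite setIT haar_codingB.
    by apply/seteqP; split => // x _; exact: coding_periodic.
  move=> [b b1]; apply: (@lambda_not_fixed (repr U) b); rewrite -b1; apply: Umu.
  by apply: measurable_closed; exact: Sigma2_finite_closed.
move=> [/convex_hull_periodicP P1 nfix]; pose c l := fine (mu [set sq l]).
have ms (x : Sigma2) : measurable ([set x] : set (Borel Sigma2)).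
  by apply: measurable_closed; exact: Sigma2_finite_closed.
have cE l : mu [set sq l] = (c l)%:E by rewrite fineK // fin_num_measure.
have c0 l : (0 <= c l)%R by exact/fine_ge0/measure_ge0.
have c1 := sum_weight P1; rewrite -/c in c1.
(* If [b] occurred in no sequence of positive mass, the measure would be the Dirac mass at the other
   constant sequence. *)
have nontriv b : exists l (j : int), (0 < c l)%R /\ sq l j = b.
  apply: contrapT => H; apply: nfix; exists (~~ b).
  have const l : (0 < c l)%R -> sq l = (fun=> ~~ b).
    move=> cl0; apply/funext => j.
    have : sq l j <> b by move=> slj; apply: H; exists l, j.
    by case: (sq l j); case: (b).
  rewrite (periodic_decomp_shift 0 P1 (ms _)) -[RHS](congr1 EFin c1) -sumEFin.
  apply: eq_bigr => l _; rewrite diracE /=.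
  rewrite -/(c l); have [->|clN0] := eqVneq (c l) 0%R; first by rewrite mul0e.
  rewrite mem_set ?mule1 //; apply: const.
  by rewrite lt_neqAle eq_sym clN0 c0.
have [V [u VE]] := realization pq c0 c1 nontriv.
exists (RO0_class V) => A mA; rewrite lambdaE // VE //.
rewrite exchange_big /= -[RHS]mul1e.
have -> : 1 = \sum_(k < q) (q%:R^-1)%:E :> \bar R.
  have E : (q%:R^-1 *+ q = 1 :> R)%R by rewrite -[LHS]mulr_natr mulVf.
  by rewrite sumEFin sumr_const card_ord E.
rewrite ge0_sume_distrl //; apply: eq_bigr => k _.
rewrite (periodic_decomp_shift (k * u) P1 mA) ge0_sume_distrr //.
  by apply: eq_bigr => l _; rewrite muleA; congr (_ * _); rewrite -EFinM mulrC.
by move=> l _; rewrite mule_ge0 // lee_fin; exact: c0.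
Qed.

End rational_image.

(** * Semicontinuity of Lambda and continuity of lambda *)

Section rotated_regular_open.
Context {R : realType}.
Implicit Types (U V W : RO R) (A B : set (circle R)) (eta : circle R).

Lemma closure_preimage_rotation eta A :
  closure (rotation eta @^-1` A) = rotation eta @^-1` closure A.
Proof.
apply/seteqP; split=> x /closure_circleP cA; apply/closure_circleP => e /cA [t te At];
  by exists t => //; move: At; rewrite /= /rotation addrAC.
Qed.

Lemma interior_preimage_rotation eta A :
  interior (rotation eta @^-1` A) = rotation eta @^-1` interior A.
Proof.
have iE (W : set (circle R)) : interior W = ~` closure (~` W) by rewrite -interiorC setCK.
by rewrite !iE preimage_setC closure_preimage_rotation preimage_setC.
Qed.

Lemma ext_part_preimage_rotation eta A :
  ext_part (rotation eta @^-1` A) = rotation eta @^-1` ext_part A.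
Proof. by rewrite /ext_part preimage_setC interior_preimage_rotation. Qed.

Lemma regular_open_rotation eta U : is_regular_open (rotation eta @^-1` RO_set U).
Proof.
have [[x Ux] UT Ur] := RO_setP U; split.
- by exists (x - eta); rewrite /= /rotation subrK.
- apply: contra_neq UT => E; apply/seteqP; split => // y _.
  by have : (rotation eta @^-1` RO_set U) (y - eta); [rewrite E|rewrite /= /rotation subrK].
- by rewrite closure_preimage_rotation interior_preimage_rotation Ur.
Qed.

Definition rotate_RO eta U : RO R := MkRO (regular_open_rotation eta U).

Lemma rotate_RO_rotated eta U : rotated (rotate_RO eta U) U.
Proof.
exists eta; rewrite image_rot /=; apply/seteqP; split=> x /=;
  by rewrite /rotation subrK.
Qed.

Lemma measurable_dsym A B : measurable (A : set (Borel (circle R))) ->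
  measurable (B : set (Borel (circle R))) -> measurable (A `+` B : set (Borel (circle R))).
Proof. by move=> mA mB; apply: measurableU; exact: measurableD. Qed.

Lemma measurable_RO_set U : measurable (RO_set U : set (Borel (circle R))).
Proof. by apply: measurable_open; exact: RO_open. Qed.

Lemma measurable_ext_part A : measurable (ext_part A : set (Borel (circle R))).
Proof. by apply: measurable_open; exact: open_interior. Qed.

Lemma dsym_rotation eta A B : measurable (A : set (Borel (circle R))) ->
  measurable (B : set (Borel (circle R))) ->
  dsym (rotation eta @^-1` A) (rotation eta @^-1` B) = dsym A B.
Proof.
move=> mA mB; rewrite /dsym -(haar_rot eta (measurable_dsym mA mB)).
by congr (fine (haar _)).
Qed.

Lemma dstar_rotation eta U V : dstar (rotate_RO eta U) (rotate_RO eta V) = dstar U V.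
Proof.
rewrite /dstar /= !ext_part_preimage_rotation !dsym_rotation //.
- exact: measurable_ext_part.
- exact: measurable_ext_part.
- exact: measurable_RO_set.
- exact: measurable_RO_set.
Qed.

Lemma dstar_rotated U V W : rotated U V -> exists eta,
  rotated (rotate_RO eta W) W /\ dstar V (rotate_RO eta W) = dstar U W.
Proof.
move=> [eta VE]; exists (- eta); split; first exact: rotate_RO_rotated.
have -> : V = rotate_RO (- eta) U by apply: RO_inj; rewrite VE image_rot.
exact: dstar_rotation.
Qed.

Lemma dsym_le_dstar U V : dsym U V <= 2 * dstar U V.
Proof.
have := dsym_ge0 (ext_part U) (ext_part V).
by rewrite /dstar [2 * _]mulrC divfK //; lra.
Qed.

Lemma dsym_ext_le_dstar U V : dsym (ext_part U) (ext_part V) <= 2 * dstar U V.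
Proof. by have := dsym_ge0 U V; rewrite /dstar [2 * _]mulrC divfK //; lra. Qed.

(** Since [dstar] is invariant under rotations, a ball around any set equivalent to a point of the
    projected ball can be rotated back; so projections of balls are open. *)
Lemma nbhs_RO_class U (e : R) : 0 < e ->
  nbhs (RO_class U) [set u | exists2 V, RO_class V = u & dstar U V < e].
Proof.
move=> e0; set W := [set u | _].
have UW : W (RO_class U) by exists U => //; rewrite /dstar !dsymxx addr0 mul0r.
apply: open_nbhs_nbhs; split => //.
suff : open ((@RO_class R) @^-1` W) by [].
rewrite openE => V0 [V cV UV]; apply/nbhs_ballP; exists (e - dstar U V).
  by rewrite /= subr_gt0.
have /asboolP rV : RO_rel V0 V.
  by move/eqmodP : (esym cV : \pi_(RO' R)%qT V0 = \pi_(RO' R)%qT V).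
move=> V1; rewrite ballEmdist /= => V01.
have [eta [rot dE]] := dstar_rotated V1 rV.
exists (rotate_RO eta V1); first by apply/eqmodP/asboolP.
have := metric_triangle U V (rotate_RO eta V1); rewrite /mdist /= dE => le.
by apply: le_lt_trans le _; rewrite -ltrBrDl.
Qed.

Lemma haar_frontier_rotation eta (V : RO0 R) : haar (frontier (rotate_RO eta V)) = 0%E.
Proof.
rewrite /= frontier_preimage haar_rot ?RO0_ROP //.
by apply: measurable_closed; exact: frontier_closed.
Qed.

Lemma nbhs_RO0_class (U : RO0 R) (e : R) : 0 < e ->
  nbhs (RO0_class U) [set u | exists2 V : RO0 R, RO0_class V = u & dstar U V < e].
Proof.
move=> e0; set W := [set u | _].
have UW : W (RO0_class U) by exists U => //; rewrite /dstar !dsymxx addr0 mul0r.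
apply: open_nbhs_nbhs; split => //.
suff : open ((@RO0_class R) @^-1` W) by [].
rewrite openE => V0 [V cV UV]; apply/nbhs_ballP; exists (e - dstar U V).
  by rewrite /= subr_gt0.
have /asboolP rV : RO0_rel V0 V.
  by move/eqmodP : (esym cV : \pi_(RO0' R)%qT V0 = \pi_(RO0' R)%qT V).
move=> V1; rewrite ballEmdist /= => V01.
have [eta [rot dE]] := dstar_rotated V1 rV.
exists (MkRO0 (haar_frontier_rotation eta V1)); first by apply/eqmodP/asboolP.
have := metric_triangle (U : RO R) V (rotate_RO eta V1); rewrite /mdist /= dE => le.
by apply: le_lt_trans le _; rewrite -ltrBrDl.
Qed.

End rotated_regular_open.

Section window.
Context {R : realType}.
Implicit Types (U V : RO R) (x y : circle R) (i : int) (b : bool).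

Lemma window_uniform (P : int -> R -> Prop) (N : nat) :
  (forall i, exists2 e, 0 < e & forall v, `|v| < e -> P i v) ->
  exists2 e, 0 < e & forall i, (`|i| <= N)%N -> forall v, `|v| < e -> P i v.
Proof.
move=> HP; have step (e1 : R) i : 0 < e1 -> exists e, [/\ 0 < e, e <= e1 &
    forall v, `|v| < e -> P i v].
  move=> e10; have [e e0 eP] := HP i; exists (Num.min e e1).
  rewrite lt_min e0 e10 ge_min lexx orbT; split => // v.
  by rewrite lt_min => /andP[/eP].
elim: N => [|N [e e0 eP]].
  have [e e0 eP] := HP 0; exists e => // i; rewrite leqn0 absz_eq0 => /eqP ->.
  exact: eP.
have [e1 [e10 e1e P1]] := step e N.+1%:Z e0.
have [e2 [e20 e2e1 P2]] := step e1 (- N.+1%:Z) e10.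
exists e2 => // i iN v ve2; have ve1 := lt_le_trans ve2 e2e1.
have [iN'|iN'] := leqP `|i|%N N; first by apply: eP => //; exact: lt_le_trans e1e.
have [->|->] : i = N.+1 \/ i = - N.+1%:Z by lia.
  exact: P1.
exact: P2.
Qed.

(** For the symbol 0 the exterior is used instead of the complement: it is open, and its variation
    is the second term of [dstar]. *)
Definition part V b : set (circle R) := if b then RO_set V else ext_part V.

Lemma part_open V b : open (part V b).
Proof. by case: b; [exact: RO_open|exact: open_interior]. Qed.

Lemma partP V b x : part V b x -> `[< RO_set V x >] = b.
Proof. by case: b => [Vx|/interior_subset Vx]; [rewrite asboolT|rewrite asboolF]. Qed.

Lemma part_not_frontier V x : ~ frontier V x -> part V `[< RO_set V x >] x.
Proof.
move=> /not_frontierP[Vx|Ex]; first by rewrite asboolT.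
by rewrite asboolF //; move: Ex => /interior_subset.
Qed.

Lemma haar_part_sub U V b : (haar (part U b `\` part V b) <= (2 * dstar U V)%:E)%E.
Proof.
have mp W c : measurable (part W c : set (Borel (circle R))).
  by apply: measurable_open; exact: part_open.
apply: (@le_trans _ _ (dsym (part U b) (part V b))%:E).
  rewrite /dsym fineK ?haar_fin_num //; last exact: measurable_dsym.
  apply: le_measure; rewrite ?inE; [exact: measurableD|exact: measurable_dsym|].
  by move=> x; left.
by rewrite lee_fin; case: b; [exact: dsym_le_dstar|exact: dsym_ext_le_dstar].
Qed.

Lemma haar_window_le (N : nat) (G : set (circle R)) (W : int -> set (circle R)) (c : R) :
  measurable (G : set (Borel (circle R))) ->
  (forall i, measurable (W i : set (Borel (circle R)))) ->
  (forall i, haar (W i) <= c%:E)%E ->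
  (forall x, G x -> exists2 i, (`|i| <= N)%N & W i x) ->
  (haar G <= ((N + N).+1%:R * c)%:E)%E.
Proof.
move=> mG mW Wc GW; pose F (j : nat) := W (j%:Z - N%:Z).
have mF j : measurable (F j : set (Borel (circle R))) by exact: mW.
apply: (@le_trans _ _ (haar (\big[setU/set0]_(j < (N + N).+1) F j))).
  apply: le_measure; rewrite ?inE //; first exact: bigsetU_measurable.
  move=> x /GW [i iN Wx]; rewrite -bigcup_mkord; exists (absz (i + N%:Z)%R).
    by rewrite /=; lia.
  by rewrite /F (_ : _ - _ = i) //; lia.
apply: (le_trans (Boole_inequality haar _)) => [j _|]; first exact: mW.
apply: (@le_trans _ _ (\sum_(j < (N + N).+1) c%:E)%E).
  by apply: lee_sum => j _; exact: Wc.
by rewrite sumEFin sumr_const card_ord mulr_natl.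
Qed.

End window.

(** * Lower semicontinuity: persistence of blocks *)

Section lower_semicontinuity.
Context {R : realType}.
Implicit Types (U V : RO R) (r x : circle R).

(** The block of [x] is read on a whole ball around [x], of measure [h]. Passing to [V] spoils at
    most [h / 2] of it, so some point of the ball still has this block. *)
Lemma coding_closure_meets_near U r (O : set Sigma2) : open O ->
  (coding_closure U r `&` O) !=set0 ->
  exists2 e : R, 0 < e & forall V t, dstar U V < e -> `|t| < e ->
    (coding_closure V (r + toS1 t) `&` O) !=set0.
Proof.
move=> oO [s [Us Os]]; have [_ [[x Bx <-] Ox]] := Us _ (open_nbhs_nbhs (conj oO Os)).
have [N NO] := (open_Sigma2P _).1 oO _ Ox.
pose b i := coding U r x i.
have [i|e1 e10 e1P] := @window_uniform R (fun i v => part U (b i) (x + r *~ i + toS1 v)) N.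
  have [e e0 eU] := (open_circleP _).1 (@part_open _ U (b i)) _ (part_not_frontier (Bx i)).
  by exists e.
(* The drift [i * t] of the angle and the offset inside the ball together stay below
   [(N + 1) * d = e1]. *)
pose d := e1 / (N.+1)%:R; have d0 : 0 < d by rewrite divr_gt0.
pose G := thicken [set x] d; have oG : open G by exact: thicken_open.
have Gx : G x by exists 0; rewrite ?normr0 // toS1_0 addr0.
have Gpart t i y : `|t| < d -> (`|i| <= N)%N -> G y -> part U (b i) (y + (r + toS1 t) *~ i).
  move=> td iN [w wd yx]; have -> : y = x + toS1 (- w) by rewrite -yx toS1N addrK.
  have -> : x + toS1 (- w) + (r + toS1 t) *~ i = x + r *~ i + toS1 (t *~ i - w).
    by rewrite mulrzDl -toS1Mz toS1B toS1N addrACA [- _ + _]addrC.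
  apply: e1P => //; apply: (le_lt_trans (ler_normB _ _)).
  rewrite -mulrzr normrM; have de : d * N.+1%:R = e1 by rewrite divfK.
  have iR : `|i%:~R| <= N%:R :> R.
    by rewrite -intr_norm -abszE -pmulrn ler_nat.
  have : `|t| * `|i%:~R| <= d * N%:R by rewrite ler_pM // ltW.
  by move: de; rewrite -natr1 mulrDr mulr1; lra.
have G0 : (0 < haar G)%E by apply: haar_open_gt0 => //; exists x.
have mG : measurable (G : set (Borel (circle R))) by exact: measurable_open.
pose h := fine (haar G); have hE : haar G = h%:E by rewrite fineK ?haar_fin_num.
have h0 : 0 < h by rewrite -lte_fin -hE.
(* Each of the [2 * N + 1] indices of the window may cost [c]; the later bound [c / 2] on [dstar]
   absorbs the factor in [haar_part_sub]. *)
pose c := h / 2 / (N + N).+1%:R; have c0 : 0 < c by rewrite !divr_gt0.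
exists (Num.min d (c / 2)); first by rewrite lt_min d0 divr_gt0.
move=> V t; rewrite !lt_min => /andP[_ UV] /andP[td _]; set r' := r + toS1 t.
have [y Gy yV] : exists2 y, G y & forall i, (`|i| <= N)%N -> part V (b i) (y + r' *~ i).
  apply: contrapT => nG.
  pose W i := rotation (r' *~ i) @^-1` (part U (b i) `\` part V (b i)).
  have mp i : measurable (part U (b i) `\` part V (b i) : set (Borel (circle R))).
    by apply: measurableD; apply: measurable_open; exact: part_open.
  have mW i : measurable (W i : set (Borel (circle R))).
    by rewrite -[X in measurable X]setTI; exact: measurable_rot.
  have Wc i : (haar (W i) <= c%:E)%E.
    rewrite haar_rot //; apply: (le_trans (haar_part_sub U V (b i))).
    by rewrite lee_fin; lra.
  have /(haar_window_le mG mW Wc) : forall y, G y -> exists2 i, (`|i| <= N)%N & W i y.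
    move=> y Gy; apply: contrapT => nW; apply: nG; exists y => // i iN.
    apply: contrapT => nV; apply: nW; exists i => //; split => //.
    exact: Gpart.
  have -> : (N + N).+1%:R * c = h / 2 by rewrite mulrC divfK.
  by rewrite hE lee_fin; lra.
(* The orbit of [y] may meet the frontier of [V] outside the window; as the parts are open, a nearby
   point of [codingB] has the same block. *)
have [i|e2 e20 e2P] := @window_uniform R (fun i v => (`|i| <= N)%N ->
    part V (b i) (y + r' *~ i + toS1 v)) N.
  have [iN|] := boolP (`|i| <= N)%N; last by move/negP => niN; exists 1.
  have [e e0 eV] := (open_circleP _).1 (@part_open _ V (b i)) _ (yV i iN).
  by exists e => // v /eV.
have [|z [v ve zy] Bz] := @codingB_dense _ V r' _ (@thicken_open _ [set y] e2).
  by exists y; exists 0; rewrite ?normr0 // toS1_0 addr0.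
exists (coding V r' z); split; first exact: coding_in_closure.
apply: NO => i iN; apply: partP.
have -> : z = y + toS1 (- v) by rewrite -zy toS1N addrK.
by rewrite addrAC; apply: e2P; rewrite ?normrN.
Qed.

Lemma Lambda_lower_semicontinuous : lower_semicontinuous_map (@Lambda R).
Proof.
move=> Y cY; rewrite -[X in closed X]setCK; apply: open_closedC.
rewrite openE => -[u r] /= nsub.
have oY : open (~` Y) by rewrite openC.
have [U uE] : exists U : RO R, RO_class U = u by exists (repr u); exact: reprK.
have meet : (coding_closure U r `&` ~` Y) !=set0.
  apply/set0P/eqP => E; apply: nsub; suff : Lambda (u, r) `<=` Y by [].
  rewrite -uE LambdaE => s Us; apply: contrapT => nY.
  by have : (coding_closure U r `&` ~` Y) s by []; rewrite E.
have [e e0 eV] := coding_closure_meets_near oY meet.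
exists ([set u' | exists2 V, RO_class V = u' & dstar U V < e],
  [set r + toS1 t | t in [set t : R | `|t| < e]]).
  split; first by rewrite /= -uE; exact: nbhs_RO_class.
  by apply/nbhs_circleP; exists e => // t te; exists t.
move=> [u' r'] /= [[V <- UV] [t te <-]] sub.
have [s [Vs nY]] := eV V t UV te; apply: nY; apply: sub.
by suff : hyper_set (Lambda (RO_class V, r + toS1 t)) s by []; rewrite LambdaE.
Qed.

End lower_semicontinuity.

Section bounded_integrals.
Context d (T : measurableType d) (R : realType) (mu : probability T R).

Lemma probability_integrable (f : T -> R) M : measurable_fun setT f ->
  (forall x, `|f x| <= M) -> mu.-integrable setT (EFin \o f).
Proof.
move=> mf fM; apply: measurable_bounded_integrable => //.
  by rewrite ltey_eq fin_num_measure.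
exists M; split; first exact: num_real.
by move=> K MK x _; apply: le_trans (fM x) _; exact: ltW.
Qed.

Lemma Rintegral_close (f1 f2 : T -> R) M e c (Bad : set T) :
  measurable_fun setT f1 -> measurable_fun setT f2 ->
  (forall x, `|f1 x| <= M) -> (forall x, `|f2 x| <= M) ->
  measurable Bad -> (mu Bad <= c%:E)%E ->
  (forall x, ~ Bad x -> `|f1 x - f2 x| <= e) -> 0 <= e ->
  `|Rintegral mu setT f1 - Rintegral mu setT f2| <= e + 2 * M * c.
Proof.
move=> mf1 mf2 M1 M2 mBad Badc close e0.
have M0 : 0 <= M by apply: le_trans (M1 point).
have if1 := probability_integrable mf1 M1; have if2 := probability_integrable mf2 M2.
rewrite -RintegralB //.
have mB : measurable_fun setT (fun x => f1 x - f2 x) by exact: measurable_funB.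
have bB x : `|f1 x - f2 x| <= 2 * M.
  by apply: le_trans (ler_normB _ _) _; rewrite mulrDl mul1r lerD.
have iB := probability_integrable mB bB.
apply: le_trans (le_normr_Rintegral measurableT iB) _.
have mI : measurable_fun setT (\1_Bad : T -> R) by exact: measurable_indic.
have iI : mu.-integrable setT (EFin \o (\1_Bad : T -> R)).
  apply: (@probability_integrable _ 1) => // x.
  by rewrite indicE; case: (_ \in _); rewrite ?normr1 ?normr0.
have iMI : mu.-integrable setT (EFin \o (fun x => 2 * M * \1_Bad x)).
  apply: (@probability_integrable _ (2 * M)); first exact: measurable_funM.
  move=> x; rewrite indicE; case: (_ \in _); rewrite ?mulr1 ?mulr0 ?normr0 ?mulr_ge0 //.
  by rewrite ger0_norm // mulr_ge0.
have ie : mu.-integrable setT (EFin \o (fun=> e)).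
  by apply: (@probability_integrable _ e) => // x; rewrite ger0_norm.
apply: (@le_trans _ _ (Rintegral mu setT (fun x => e + 2 * M * \1_Bad x))).
  apply: le_Rintegral => //.
  - apply: (@probability_integrable _ (2 * M)) => [|x]; last by rewrite normr_id.
    exact: measurableT_comp.
  - apply: (@probability_integrable _ (e + 2 * M)).
      by apply: measurable_funD => //; exact: measurable_funM.
    move=> x; apply: le_trans (ler_normD _ _) _; rewrite (ger0_norm e0) lerD2l.
    rewrite indicE; case: (_ \in _); rewrite ?mulr1 ?mulr0 ?normr0 ?mulr_ge0 //.
    by rewrite ger0_norm // mulr_ge0.
  - move=> x _; rewrite indicE; case: (boolP (_ \in _)) => [_|].
      by rewrite mulr1 (le_trans (bB x)) // lerDr.
    by rewrite notin_setE mulr0 addr0 => /close.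
rewrite RintegralD // Rintegral_cst // RintegralZl //.
rewrite [X in fine X](_ : _ = 1%E) ?mulr1; last exact: probability_setT.
rewrite lerD2l ler_wpM2l ?mulr_ge0 // /Rintegral integral_indic // setIT.
by rewrite -lee_fin fineK // fin_num_measure.
Qed.

End bounded_integrals.

Section Sigma2_functions.
Context {R : realType} (g : Sigma2 -> R) (cg : continuous g).

Lemma Sigma2_bounded : exists2 M, 0 <= M & forall s, `|g s| <= M.
Proof.
have cI : compact (g @` [set: Sigma2]).
  by apply: continuous_compact; [exact: continuous_subspaceT|exact: Sigma2_compact].
have [M [_ MP]] := compact_bounded cI.
exists (`|M| + 1); first by rewrite addr_ge0.
move=> s; apply: MP; last by exists s.
by apply: le_lt_trans (ler_norm M) _; rewrite ltrDl.
Qed.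

Lemma Sigma2_uniform (e : R) : 0 < e ->
  exists N, forall s s', agree N s s' -> `|g s - g s'| < e.
Proof.
move=> e0; have /compact_near_coveringP cov := Sigma2_compact.
pose P (N : nat) (s : Sigma2) := forall s', agree N s s' -> `|g s - g s'| < e.
have [|N _ NP] := cov nat \oo P _; last by exists N => s; apply: (NP N (leqnn N)).
move=> s _; have e20 : 0 < e / 2 by rewrite divr_gt0.
have /cvgrPdist_lt/(_ _ e20)/nbhs_Sigma2P[M MP] := @cg s.
exists ([set s' | agree M s s'], [set N | (M <= N)%N]).
  by split; [exact: nbhs_agree|exists M].
move=> [s' N] /= [ss' MN] s'' s's''; have h1 := MP _ ss'.
have h2 : `|g s - g s''| < e / 2.
  apply: MP => i iM; rewrite s's''; first exact: ss'.
  exact: leq_trans MN.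
rewrite (splitr e) -[g s' - _](subrKA (g s)); apply: le_lt_trans (ler_normD _ _) _.
by rewrite distrC ltrD.
Qed.

End Sigma2_functions.

(** * Continuity of the coding measures *)

Section lambda_continuity.
Context {R : realType}.
Implicit Types (U V : RO0 R) (r : circle R) (g : Sigma2 -> R).

(** Points where [U] and its translate differ are close both to the closure and to the complement of
    [U]; these thickenings shrink to the frontier, which is null. *)
Lemma haar_translate_near U (e : R) : 0 < e -> exists2 d : R, 0 < d &
  forall t, `|t| < d -> dsym (RO_set U) (rotation (toS1 t) @^-1` RO_set U) < e.
Proof.
move=> e0; apply: contrapT => H.
have cU : closed (~` RO_set U) by apply: open_closedC; exact: RO_open.
have mU : measurable (RO_set U : set (Borel (circle R))) by exact: measurable_RO_set.
have : (e%:E <= haar (closure U `&` ~` RO_set U))%E.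
  apply: haar_thickenI => //; first exact: closed_closure.
  move=> d d0; have [t td te] : exists2 t, `|t| < d &
      e <= dsym (RO_set U) (rotation (toS1 t) @^-1` RO_set U).
    apply: contrapT => nt; apply: H; exists d => // t td.
    by rewrite ltNge; apply/negP => le; apply: nt; exists t.
  have mD := measurable_dsym mU (measurable_RO_set (rotate_RO (toS1 t) U)).
  apply: (@le_trans _ _ (haar (RO_set U `+` rotation (toS1 t) @^-1` RO_set U))).
    by rewrite -[leRHS]fineK ?haar_fin_num // lee_fin.
  apply: le_measure; rewrite ?inE //.
    by apply: measurable_open; apply: openI; exact: thicken_open.
  move=> x [[Ux Utx]|[Utx Ux]]; split.
  - by exists 0; rewrite ?normr0 // toS1_0 addr0; exact: subset_closure.
  - by exists t.
  - by exists t => //; exact: subset_closure.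
  - by exists 0; rewrite ?normr0 // toS1_0 addr0.
rewrite (_ : _ `&` _ = frontier U); last by rewrite frontierE //; exact: RO_open.
by rewrite RO0_ROP lee_fin leNgt e0.
Qed.

(** The coding is completed by a constant off [codingB], so that [coding_measure] becomes the
    push-forward of [haar] by a total measurable map. *)
Let phi V r (x : Borel (circle R)) : Borel Sigma2 :=
  if `[< codingB V r x >] then coding V r x else point.

Let phi_codingB V r x : codingB V r x -> phi V r x = coding V r x.
Proof. by move=> Bx; rewrite /phi asboolT. Qed.

Let measurable_phi V r : measurable_fun setT (phi V r).
Proof.
move=> _ A mA; rewrite setTI; have mB := measurable_codingB V r.
have -> : phi V r @^-1` A = (codingB V r `&` coding V r @^-1` A) `|`
    (~` codingB V r `&` [set _ | A point]).
  apply/seteqP; split=> x; rewrite /= /phi.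
    by case: asboolP; [left|right].
  by move=> [[Bx Ax]|[Bx Ax]]; [rewrite asboolT|rewrite asboolF].
apply: measurableU; first exact: measurable_coding.
apply: measurableI; first exact: measurableC.
have [Ap|nAp] := pselect (A point).
  by rewrite (_ : [set _ | _] = setT) //; apply/seteqP; split.
by rewrite (_ : [set _ | _] = set0) //; apply/seteqP; split.
Qed.

Let continuous_measurable g : continuous g ->
  measurable_fun setT (g : Borel Sigma2 -> R).
Proof.
move=> cg; apply: (@measurability _ _ (Borel Sigma2) _ _ _ _ (RGenOpens.measurableE R)).
move=> _ [_ [a [b ->]] <-]; rewrite setTI; apply: measurable_open.
by apply: open_comp => // s _; exact: cg.
Qed.

Lemma Rintegral_coding_measure V r g : continuous g ->
  Rintegral (coding_measure V r) setT (g : Borel Sigma2 -> R) =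
  Rintegral haar setT (g \o phi V r).
Proof.
move=> cg; have mphi := measurable_phi V r; have mg := continuous_measurable cg.
have [M M0 gM] := Sigma2_bounded cg.
congr fine; pose nu : {measure set (Borel Sigma2) -> \bar R} :=
  measure_function_pushforward__canonical__measure_function_Measure haar mphi.
transitivity (\int[nu]_x (g x)%:E)%E.
  apply: eq_measure_integral => A mA _; rewrite /nu /= /pushforward /coding_measure.
  have mB := measurable_codingB V r.
  have mpA : measurable (phi V r @^-1` A).
    by rewrite -[X in measurable X]setTI; exact: (@measurable_phi V r measurableT A mA).
  rewrite -(probability_setI1 mB mpA (haar_codingB V r)); congr haar.
  by apply/seteqP; split=> x [Bx /= Ax]; split => //=; move: Ax; rewrite phi_codingB.
rewrite /nu /= integral_pushforward //.
  exact/measurable_EFinP.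
apply: (@probability_integrable _ _ _ haar (g \o phi V r) M) => [|x]; last exact: gM.
exact: measurableT_comp.
Qed.

Lemma coding_measure_near U r g (e : R) : continuous g -> 0 < e ->
  exists2 d : R, 0 < d & forall V t, dstar U V < d -> `|t| < d ->
    `|Rintegral (coding_measure U r) setT (g : Borel Sigma2 -> R) -
      Rintegral (coding_measure V (r + toS1 t)) setT (g : Borel Sigma2 -> R)| < e.
Proof.
move=> cg e0; have [M M0 gM] := Sigma2_bounded cg.
have e20 : 0 < e / 2 by rewrite divr_gt0.
have [N gN] := Sigma2_uniform cg e20.
(* With this [c] the exceptional set contributes at most [2 * M * (n * c)], which is less than
   [e / 2]; [M + 1] avoids a division by 0. *)
pose n := (N + N).+1; pose c := e / 2 / (2 * (M + 1)) / n%:R.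
have M10 : 0 < 2 * (M + 1) by rewrite mulr_gt0 // ltr_wpDl.
have c0 : 0 < c by rewrite !divr_gt0.
have c20 : 0 < c / 2 by rewrite divr_gt0.
have [d1 d10 near1] := haar_translate_near U c20.
(* The first bound makes [dsym] less than [c / 2], the second keeps [i * t] below [d1] throughout
   the window. *)
exists (Num.min (c / 4) (d1 / N.+1%:R)); first by rewrite lt_min !divr_gt0.
move=> V t; rewrite !lt_min => /andP[UVc _] /andP[_ td]; set r' := r + toS1 t.
rewrite !Rintegral_coding_measure //.
pose W i : set (circle R) :=
  (rotation (r *~ i) @^-1` RO_set U) `+` (rotation (r' *~ i) @^-1` RO_set V).
have mR eta (V' : RO R) : measurable (rotation eta @^-1` RO_set V' : set (Borel (circle R))).
  exact: (measurable_RO_set (rotate_RO eta V')).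
have mW i : measurable (W i : set (Borel (circle R))) by exact: measurable_dsym.
have Wc i : (`|i| <= N)%N -> (haar (W i) <= c%:E)%E.
  move=> iN; rewrite -[leLHS]fineK ?haar_fin_num // lee_fin -/(dsym _ _).
  (* The angle is changed first and the set afterwards; each change costs at most [c / 2]. *)
  have mUt := mR (r' *~ i) U.
  apply: le_trans (dsym_triangle (mR _ _) mUt (mR _ _)) _.
  rewrite dsym_rotation; [|exact: measurable_RO_set|exact: measurable_RO_set].
  have -> : rotation (r' *~ i) @^-1` RO_set U =
      rotation (r *~ i) @^-1` (rotation (toS1 (t *~ i)) @^-1` RO_set U).
    by apply/funext => x; rewrite /= /rotation /r' mulrzDl toS1Mz addrA.
  rewrite dsym_rotation; [|exact: measurable_RO_set|exact: mR].
  have := dsym_le_dstar U V; have := near1 (t *~ i); rewrite -mulrzr normrM => near1i.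
  have : dsym (RO_set U) (rotation (toS1 (t * i%:~R)) @^-1` RO_set U) < c / 2.
    apply: near1i; apply: (@le_lt_trans _ _ (`|t| * N%:R)).
      by rewrite ler_wpM2l // -intr_norm -abszE -pmulrn ler_nat.
    have N1 : 0 < N.+1%:R :> R by rewrite ltr0n.
    move: td; rewrite ltr_pdivlMr // -natr1 mulrDr mulr1.
    by have := normr_ge0 t; lra.
  by move: UVc; lra.
pose W' i := if (`|i| <= N)%N then W i else set0.
have mW' i : measurable (W' i : set (Borel (circle R))).
  by rewrite /W'; case: ifP => // _; exact: measurable0.
have W'c i : (haar (W' i) <= c%:E)%E.
  by rewrite /W'; case: ifP => [/Wc//|_]; rewrite measure0 lee_fin ltW.
pose G : set (circle R) := \big[setU/set0]_(j < n) W' (j%:Z - N%:Z).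
have mG : measurable (G : set (Borel (circle R))) by exact: bigsetU_measurable.
have GP x i : (`|i| <= N)%N -> W i x -> G x.
  move=> iN Wx; rewrite /G -(bigcup_mkord n (fun j => W' (j%:Z - N%:Z))).
  exists (absz (i + N%:Z)%R); first by rewrite /=; lia.
  rewrite /W' (_ : _ - _ = i); last by lia.
  by rewrite iN.
have Gc : (haar G <= (n%:R * c)%:E)%E.
  apply: (le_trans (Boole_inequality haar (fun j _ => mW' (j%:Z - N%:Z)))).
  apply: (@le_trans _ _ (\sum_(j < n) c%:E)%E).
    by apply: lee_sum => j _; exact: W'c.
  by rewrite sumEFin sumr_const card_ord mulr_natl.
have mB := measurable_codingB U r; have mB' := measurable_codingB V r'.
(* Off [Bad] both points of the shift are genuine codings and agree on the window, so the values of
   [g] differ by less than [e / 2]. *)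
pose Bad : set (Borel (circle R)) := ~` (codingB U r `&` (codingB V r' `&` ~` G)).
have mBad : measurable Bad.
  apply: measurableC; apply: measurableI => //; apply: measurableI => //.
  exact: measurableC.
have Badc : (haar Bad <= (n%:R * c)%:E)%E.
  have mGC : measurable (~` G : set (Borel (circle R))) by exact: measurableC.
  rewrite /Bad probability_setC; last by apply: measurableI => //; exact: measurableI.
  rewrite (probability_setI1 mB _ (haar_codingB U r)); last exact: measurableI.
  rewrite (probability_setI1 mB' mGC (haar_codingB V r')) probability_setC //.
  have hG : haar G = (fine (haar G))%:E by rewrite fineK ?haar_fin_num.
  by rewrite [X in (1 - (1 - X))%E]hG -!EFinB subKr -hG.
apply: le_lt_trans.
  apply: (@Rintegral_close _ _ _ haar _ _ M (e / 2) (n%:R * c) Bad) => //.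
  - apply: measurableT_comp; [exact: continuous_measurable|exact: measurable_phi].
  - apply: measurableT_comp; [exact: continuous_measurable|exact: measurable_phi].
  - by move=> x; exact: gM.
  - by move=> x; exact: gM.
  - move=> x /contrapT [Bx [B'x nG]] /=; rewrite !phi_codingB //.
    apply/ltW/gN => i iN; rewrite /coding; apply: asbool_equiv_eq.
    split=> Vx; apply: contrapT => nV; apply: nG; apply: (GP x i iN).
      by right.
    by left.
  - exact: ltW.
have -> : 2 * M * (n%:R * c) = e / 2 * (M / (M + 1)).
  by rewrite /c; field; rewrite pnatr_eq0 /= gt_eqF // ltr_wpDl.
have : M / (M + 1) < 1 by rewrite ltr_pdivrMr ?ltr_wpDl // mul1r ltrDl.
by move=> lt1; rewrite [ltRHS]splitr ltrD2l gtr_pMr.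
Qed.

Lemma lambda_continuous : continuous (@lambda R).
Proof.
move=> [u r].
have [U uE] : exists U : RO0 R, RO0_class U = u by exists (repr u); exact: reprK.
(* The weak topology is initial for [integrals] into a product, so one function [g] can be treated
   at a time. *)
suff : (fun e => integrals (lambda e) : {ptws continuousType Sigma2 R -> R}) @ (u, r) -->
    (integrals (lambda (u, r)) : {ptws continuousType Sigma2 R -> R}).
  move=> H A; rewrite nbhsE => -[_ [[B oB <-] Bu] BA].
  by apply: filterS BA _; apply: H; apply: open_nbhs_nbhs.
apply/cvg_sup => g A [_ [[B oB <-] /= Bg] BA].
suff : (fun e => integrals (lambda e) g) @ (u, r) --> integrals (lambda (u, r)) g.
  move=> H; suff : nbhs (u, r) [set e | B (integrals (lambda e) g)].
    by apply: filterS => e Be; exact: BA.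
  by apply: H; apply: open_nbhs_nbhs.
apply/cvgrPdist_lt => e e0.
have cg : continuous (g : Sigma2 -> R) by exact: cts_fun.
have intE (V : RO0 R) r' : integrals (lambda (RO0_class V, r')) g =
    Rintegral (coding_measure V r') setT (g : Borel Sigma2 -> R).
  by congr fine; apply: eq_measure_integral => C mC _; exact: lambdaE.
have [d d0 near_d] := coding_measure_near U r cg e0.
exists ([set u' | exists2 V : RO0 R, RO0_class V = u' & dstar U V < d],
  [set r + toS1 t | t in [set t : R | `|t| < d]]).
  split; first by rewrite /= -uE; exact: nbhs_RO0_class.
  by apply/nbhs_circleP; exists d => // t td; exists t.
move=> [u' r'] /= [[V <- UV] [t td <-]].
by rewrite -uE !intE; exact: near_d.
Qed.

End lambda_continuity.

(** * Conclusion *)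

Section irrational_angle_results.
Context {R : realType} (alpha : R) (irr : irrational alpha).
Local Notation a := (toS1 alpha).

Lemma trivial_stabilizer_reduction (V : RO R) : exists n (W : RO R), [/\ (0 < n)%N,
  forall eta, stabilizes W eta -> eta = 0,
  coding_closure V a = coding_closure W (toS1 (n%:R * alpha)) &
  frontier V = (fun x => x *+ n) @^-1` frontier W].
Proof.
have [n n0 stabV] := stabilizer_finite V.
have [W [VW stabW]] := stabilizer_quotient n0 stabV.
exists n, W; split => //; last by rewrite VW frontier_preimage_mul.
by rewrite VW coding_closure_mul // -toS1Mn mulr_natl.
Qed.

Lemma coding_closure_almost_one_to_one (V : RO R) : exists2 n, (0 < n)%N &
  almost_one_to_one_extension (coding_closure V a) full_shift setT
    (rotation (toS1 (n%:R * alpha))).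
Proof.
have [n [W [n0 stabW -> _]]] := trivial_stabilizer_reduction V; exists n => //.
by apply: coding_closure_extension => //; exact: irrational_mul.
Qed.

Lemma coding_closure_denjoy_minimal (V : RO R) : finite_set (frontier V) ->
  exists2 n, (0 < n)%N &
  denjoy_minimal_set (coding_closure V a) full_shift (n%:R * alpha).
Proof.
have [n [W [n0 stabW -> FVW]]] := trivial_stabilizer_reduction V => finV; exists n => //.
apply: coding_closure_denjoy => //; first exact: irrational_mul.
apply: sub_finite_set (finite_image (fun x => x *+ n) finV) => y Fy.
by have [x xy] := mul_surj n0 y; exists x => //; rewrite FVW /= xy.
Qed.

End irrational_angle_results.

Theorem theorem2 (R : realType) :
  [/\ continuous (@lambda R) /\ lower_semicontinuous_map (@Lambda R),
      forall alpha : R, irrational alpha ->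
        [/\ forall U : RO' R, exists2 n : nat, (0 < n)%N &
              minimal_system (Lambda (U, toS1 alpha)) full_shift /\
              almost_one_to_one_extension (Lambda (U, toS1 alpha)) full_shift
                [set: circle R] (rotation (toS1 (n%:R * alpha))),
            forall U : RO0 R,
              uniquely_ergodic R (Lambda (RO_class U, toS1 alpha)) full_shift,
            forall U : RO R, finite_set (frontier (RO_set U)) ->
              exists2 n : nat, (0 < n)%N &
              denjoy_minimal_set (Lambda (RO_class U, toS1 alpha)) full_shift
                (n%:R * alpha) &
            injective (fun U : RO' R => Lambda (U, toS1 alpha)) /\
            (forall U V : RO0' R,
              eq_on_Borel (lambda (U, toS1 alpha)) (lambda (V, toS1 alpha)) ->
              U = V)] &
      forall (p : int) (q : nat), (0 < q)%N -> coprime `|p| q ->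
        (forall U : RO' R, exists X : set Sigma2,
          [/\ finite_set X,
              forall s, X s ->
                exists2 k, minimal_period full_shift s k & (k %| q)%N &
              hyper_set (Lambda (U, toS1 (p%:~R / q%:R))) =
                \bigcup_(s in X) dyn_orbit [set: Sigma2] full_shift s]) /\
        [set mu : shift_invariant R | exists U : RO0' R,
          eq_on_Borel (lambda (U, toS1 (p%:~R / q%:R))) mu] =
        convex_hull (periodic_measures q) `\` fixed_point_measures].
Proof.
split.
- by split; [exact: lambda_continuous|exact: Lambda_lower_semicontinuous].
- move=> alpha irr; split.
  + move=> U; have [n n0 ext] := coding_closure_almost_one_to_one irr (repr U).
    by exists n => //; split => //; exact: coding_closure_minimal.
  + by move=> U; rewrite LambdaE; exact: coding_closure_uniquely_ergodic.
  + by move=> U; rewrite LambdaE; exact: coding_closure_denjoy_minimal.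
  + by split; [exact: Lambda_inj|exact: lambda_inj].
- move=> p [//|q'] _ pq; split; last exact: lambda_rational_image.
  by move=> U; apply: coding_closure_orbits => //; exact: rational_angle.
Qed.
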